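(* Let $(X_n)_{n\in\mathbb Z}$ be a stationary GARCH(1,1) process (as defined in the context) with continuous marginal distribution function $F_X$, let $\mathfrak p\in(1,2)$, and let $(Y_n)_{n\ge1}$ be i.i.d. with characteristic function $\exp(-|t|^{\mathfrak p})$, independent of $(X_n)$. Let $h(x)=x^2-\mathbb E X_1^2$ and assume $h\circ F_X^{-1}\in L^r([0,1])$ for some $r>\mathfrak p$. Set $$I_n(h)=\frac1{n^{1/\mathfrak p}}\sum_{i=1}^n h(X_i)Y_i,\qquad I(h\circ F_X^{-1})=\int_0^1 h(F_X^{-1}(u))\,dM(u),$$ where $M$ is a $\mathfrak p$-stable motion on $[0,1]$ and the integral is the stable integral. Then (i) the law of $I_n(h)$ converges weakly to the law of $I(h\circ F_X^{-1})$, and (ii) for every $x\in\mathbb R$, $$\lim_{N\to\infty}\frac1{\log N}\sum_{n=1}^N\frac1n\mathbb 1_{\{I_n(h)\le x\}}=\mathbb P\big(I(h\circ F_X^{-1})\le x\big)\quad\text{almost surely.}$$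
   Context: A stationary GARCH(1,1) process: there is an i.i.d. real sequence $(\xi_n)_{n\in\mathbb Z}$ with $\mathbb E\xi_0=0$, $\mathbb E\xi_0^2=1$, constants $a_0>0$, $a_1>0$, $b_1\ge0$ with $-\infty<\mathbb E\log(a_1\xi_0^2+b_1)<0$, and a positive process $(\sigma_n)_{n\in\mathbb Z}$ such that $X_n=\sigma_n\xi_n$ and $\sigma_n^2=a_0+a_1X_{n-1}^2+b_1\sigma_{n-1}^2$ for all $n$ (stationary and ergodic solution). A $\mathfrak p$-stable motion with respect to a filtration $(\mathcal F_t)$ is an adapted process $M$ with paths in $D([0,\infty))$ and $\mathbb E[\exp(iy(M(t)-M(s)))\mid\mathcal F_s]=\exp(-(t-s)|y|^{\mathfrak p})$ for $0\le s<t$, $y\in\mathbb R$. For deterministic $g\in L^{\mathfrak p}([0,1])$ the stable integral $\int_0^1 g\,dM$ is the extension (Rosinski–Woyczynski) of the map defined on step functions $g=\sum_k c_k\mathbb 1_{(t_k,t_{k+1}]}$ by $\sum_k c_k(M(t_{k+1})-M(t_k))$; in particular it is a symmetric $\mathfrak p$-stable variable with characteristic function $\exp(-|y|^{\mathfrak p}\int_0^1|g|^{\mathfrak p})$. *)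

(* Defs.v *)
From HB Require Import structures.
From mathcomp Require Import all_boot all_order all_algebra.
From mathcomp Require Import all_classical all_reals all_analysis.
Set Implicit Arguments. Unset Strict Implicit. Unset Printing Implicit Defensive.
Import Order.TTheory GRing.Theory Num.Theory.
Import numFieldNormedType.Exports.
Local Open Scope classical_set_scope.
Local Open Scope ring_scope.

Section prob_defs.
Context {R : realType} {d : measure_display} {T : measurableType d}.
Variable P : probability T R.

Definition mutually_indep (I : eqType) (X : I -> T -> R) : Prop :=
  forall (s : seq I) (B : I -> set R), uniq s -> (forall i, measurable (B i)) ->
  P (\big[setI/setT]_(i <- s) (X i @^-1` B i)) =
  (\prod_(i <- s) P (X i @^-1` B i))%E.

Definition ident_distr (I : Type) (X : I -> T -> R) : Prop :=
  forall i j (B : set R), measurable B -> P (X i @^-1` B) = P (X j @^-1` B).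

Definition iid (I : eqType) (X : I -> T -> R) : Prop :=
  mutually_indep X /\ ident_distr X.

Definition indep_families (I J : Type) (X : I -> T -> R) (Y : J -> T -> R) : Prop :=
  forall (s : seq I) (t : seq J) (A : I -> set R) (B : J -> set R),
  (forall i, measurable (A i)) -> (forall j, measurable (B j)) ->
  P ((\big[setI/setT]_(i <- s) (X i @^-1` A i)) `&`
     (\big[setI/setT]_(j <- t) (Y j @^-1` B j))) =
  (P (\big[setI/setT]_(i <- s) (X i @^-1` A i)) *
   P (\big[setI/setT]_(j <- t) (Y j @^-1` B j)))%E.

Definition path_cylinders : set (set (int -> R * R)) :=
  [set C | exists (n : int) (A : set (R * R)), measurable A /\ C = [set f | A (f n)]].

Definition path_sigma : set (set (int -> R * R)) := <<s path_cylinders >>.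

Definition shift_path (f : int -> R * R) : int -> R * R := fun n => f (n + 1).

Definition stationary_ergodic (Phi : T -> int -> R * R) : Prop :=
  (forall B, path_sigma B -> P (Phi @^-1` B) = P (Phi @^-1` (shift_path @^-1` B))) /\
  (forall B, path_sigma B -> shift_path @^-1` B = B ->
     P (Phi @^-1` B) = 0%E \/ P (Phi @^-1` B) = 1%E).

Record garch11 (xi sigma X : int -> T -> R) (a0 a1 b1 : R) : Prop := {
  garch_xi_meas : forall n, measurable_fun setT (xi n);
  garch_sigma_meas : forall n, measurable_fun setT (sigma n);
  garch_xi_iid : iid xi;
  garch_xi_int : P.-integrable setT (EFin \o xi 0);
  garch_xi_mean : (\int[P]_w (xi 0 w)%:E = 0)%E;
  garch_xi_var : (\int[P]_w ((xi 0 w) ^+ 2)%:E = 1)%E;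
  garch_a0 : 0 < a0;
  garch_a1 : 0 < a1;
  garch_b1 : 0 <= b1;
  (* -oo < E log(a1 xi0^2 + b1) < 0 *)
  garch_log_pos : {ae P, forall w, 0 < a1 * (xi 0 w) ^+ 2 + b1};
  garch_log_int : P.-integrable setT (fun w => (ln (a1 * (xi 0 w) ^+ 2 + b1))%:E);
  garch_log_neg : (\int[P]_w (ln (a1 * (xi 0 w) ^+ 2 + b1))%:E < 0)%E;
  garch_sigma_pos : forall n w, 0 < sigma n w;
  garch_X : forall n w, X n w = sigma n w * xi n w;
  garch_rec : forall n w,
    (sigma n w) ^+ 2 = a0 + a1 * (X (n - 1) w) ^+ 2 + b1 * (sigma (n - 1) w) ^+ 2;
  garch_stat_erg : stationary_ergodic (fun w n => (xi n w, sigma n w))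
}.

Definition cadlag_nonneg (f : R -> R) : Prop :=
  forall t, 0 <= t -> f @ t^'+ --> f t /\ (0 < t -> cvg (f @ t^'-)).

Record stable_motion (p : R) (F : R -> set (set T)) (M : R -> T -> R) : Prop := {
  filt_sigma : forall t, 0 <= t -> sigma_algebra setT (F t);
  filt_sub : forall t, 0 <= t -> F t `<=` measurable;
  filt_incr : forall s t, 0 <= s -> s <= t -> F s `<=` F t;
  sm_adapted : forall t, 0 <= t -> forall B, measurable B -> F t (M t @^-1` B);
  sm_paths : forall w, cadlag_nonneg (M ^~ w);
  (* E[exp(iy(M t - M s)) | F_s] = exp(-(t-s)|y|^p), real and imaginary parts,
     written out via the defining property of conditional expectation *)
  sm_cf_re : forall s t y A, 0 <= s -> s < t -> F s A ->
    (\int[P]_(w in A) (cos (y * (M t w - M s w)))%:E =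
    P A * (expR (- ((t - s) * `|y| `^ p)))%:E)%E;
  sm_cf_im : forall s t y A, 0 <= s -> s < t -> F s A ->
    (\int[P]_(w in A) (sin (y * (M t w - M s w)))%:E = 0)%E
}.

Definition step_fun (n : nat) (t c : nat -> R) (u : R) : R :=
  \sum_(k < n) c k * \1_(`]t k, t k.+1]%classic) u.

Definition step_int (n : nat) (t c : nat -> R) (M : R -> T -> R) (w : T) : R :=
  \sum_(k < n) c k * (M (t k.+1) w - M (t k) w).

Definition stable_integral (p : R) (M : R -> T -> R) (g : R -> R) (Z : T -> R) : Prop :=
  measurable_fun setT Z /\
  exists (n : nat -> nat) (t c : nat -> nat -> R),
    (forall m, t m 0%N = 0 /\ t m (n m) = 1 /\
               forall k, (k < n m)%N -> t m k < t m k.+1) /\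
    (fun m => (\int[lebesgue_measure]_(u in `[0%R, 1%R]%classic)
                 (`|step_fun (n m) (t m) (c m) u - g u| `^ p)%:E)%E) @ \oo --> 0%E /\
    (forall eps : R, 0 < eps ->
       (fun m => P [set w | eps < `|step_int (n m) (t m) (c m) M w - Z w|]) @ \oo --> 0%E).

End prob_defs.

Definition quantile {R : realType} (F : R -> R) (u : R) : R := inf [set x | u <= F x].

(* Main.v *)
Require Import Defs.
From HB Require Import structures.
From mathcomp Require Import all_boot all_order all_algebra.
From mathcomp Require Import all_classical all_reals all_analysis.
From mathcomp Require Import measurable_realfun ring lra.
Set Implicit Arguments. Unset Strict Implicit. Unset Printing Implicit Defensive.
Import Order.TTheory GRing.Theory Num.Theory.
Import numFieldNormedType.Exports.
Local Open Scope classical_set_scope.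
Local Open Scope ring_scope.

(* Conditionally on X, the normalised sum I_n is symmetric stable with
   characteristic function exp(-|t|^p a_n), where a_n is the mean of |h(X_i)|^p
   over i <= n. By Birkhoff's theorem a_n tends almost surely to
   c = E|h(X_1)|^p, and the quantile transform identifies c with the integral
   over [0, 1] of |h o F_X^{-1}|^p, the scale of the stable integral. Dominated
   convergence and a continuity theorem for characteristic functions give (i).

   For (ii), the centred variables cos(t I_n) - exp(-|t|^p a_n) and sin(t I_n)
   have correlations of order (m/n)^{1/p} <= (m/n)^{1/2} for m <= n, so their
   logarithmic averages vanish almost surely for every t. By Fubini the
   log-empirical measures of (I_n) almost surely have characteristic functions
   converging for almost every t, which the continuity theorem accepts; and the
   limit law has no atom because c > 0.

   The continuity theorem is obtained by smoothing with a Cauchy kernel: the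
   smoothed densities are Laplace transforms of the characteristic functions,
   hence converge pointwise, and Scheffe's lemma makes them converge in L^1. *)

(** Birkhoff's theorem gives no rate for a_n, so covariances taken about the limit exp(-|t|^p c)
    could not be estimated. Centring at the random exp(-|t|^p a_n) avoids this: conditioning on X
    shows that exp(-|t|^p a_m) cos(t I_n) has mean E exp(-|t|^p (a_m + a_n)), so a covariance
    reduces to comparing E cos(t (I_n + I_m)) and E cos(t (I_n - I_m)) with that mean. With x =
    (m/n)^{1/p} the exponents differ by at most a multiple of x a_m, and only E a_m = c enters. The
    null set of the logarithmic averages depends on t, which is why the continuity theorem has to
    tolerate a null set of t. Cauchy smoothing does so because it sees a characteristic function
    only under an integral in t. The limit law is known beforehand, so tightness is not an extra
    hypothesis: the smoothed densities all have the same mass, and Scheffe's lemma lets none of it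
    escape. The Laplace formula is used for 1 + cos in place of cos, so that integrands are
    nonnegative and Tonelli's theorem applies at once. *)

Lemma measurable_cos {R : realType} : measurable_fun [set: R] cos.
Proof. by apply: continuous_measurable_fun; exact: continuous_cos. Qed.

Lemma measurable_sin {R : realType} : measurable_fun [set: R] sin.
Proof. by apply: continuous_measurable_fun; exact: continuous_sin. Qed.

#[export] Hint Extern 0 (measurable_fun _ cos) => solve [exact: measurable_cos] : core.
#[export] Hint Extern 0 (measurable_fun _ sin) => solve [exact: measurable_sin] : core.

Lemma le_distD2 {R : realDomainType} (a b c : R) : a <= b + c -> b <= a + c -> `|b - a| <= c.
Proof. by move=> ab ba; rewrite ler_distl ba andbT lerBlDr. Qed.

Lemma le_dist3 {R : realFieldType} (a b c d e : R) :
  `|a - b| <= e / 4 -> `|c - d| <= e / 4 -> `|b - d| <= e / 2 -> `|a - c| <= e.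
Proof. rewrite !ler_norml; lra. Qed.

Lemma split4 {R : realFieldType} (e : R) : e / 4 = e / 8 + e / 8.
Proof. by field. Qed.

(** * Dominated and bounded convergence for real-valued integrals *)

Section DominatedConvergence.
Context {R : realType} {d : measure_display} {T : measurableType d}.
Variable mu : {measure set T -> \bar R}.

Lemma dominated_cvg_Rintegral (f_ : nat -> T -> R) (f g : T -> R) :
  (forall n, measurable_fun setT (f_ n)) -> measurable_fun setT f ->
  mu.-integrable setT (EFin \o g) -> (forall n x, `|f_ n x| <= g x) ->
  {ae mu, forall x, f_ ^~ x @ \oo --> f x} ->
  (fun n => \int[mu]_x f_ n x) @ \oo --> \int[mu]_x f x.
Proof.
move=> mf_ mf ig fg ff.
have mE (h : T -> R) : measurable_fun setT h -> measurable_fun setT (EFin \o h : T -> \bar R).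
  by move=> ?; exact/measurable_EFinP.
have H1 : {ae mu, forall x, setT x -> (fun n => (EFin \o f_ n) x) @ \oo --> (EFin \o f) x}.
  by apply: filterS ff => x fx _; apply/fine_cvgP; split; [exact: nearW|exact: fx].
have H2 : {ae mu, forall x n, setT x -> (`|(EFin \o f_ n) x| <= (EFin \o g) x)%E}.
  by apply: aeW => x n _; rewrite /= lee_fin.
have [i _ /= h] := dominated_convergence measurableT (fun n => mE _ (mf_ n)) (mE _ mf) H1 ig H2.
by apply: fine_cvg; move: h; rewrite /Rintegral fineK// integrable_fin_num.
Qed.

End DominatedConvergence.

Section Util.
Context {R : realType} {d : measure_display} {T : measurableType d}.
Variable P : probability T R.

Lemma bounded_integrable (f : T -> R) (C : R) : measurable_fun setT f ->
  (forall x, `|f x| <= C) -> P.-integrable setT (EFin \o f).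
Proof.
move=> mf fC; apply: measurable_bounded_integrable => //.
  exact: fin_num_fun_lty.
by exists C; split; [exact: num_real | move=> M CM x _ /=; exact: le_trans (fC x) (ltW CM)].
Qed.

Lemma Rintegral_cst1 (k : R) : \int[P]_x k = k.
Proof. by rewrite Rintegral_cst//= (@probability_setT _ _ _ P) /= mulr1. Qed.

Lemma integral_cst1 (k : \bar R) : (\int[P]_x k = k)%E.
Proof. by rewrite (integral_cst P measurableT k) /= (@probability_setT _ _ _ P) mule1. Qed.

Lemma EFin_Rintegral (f : T -> R) : P.-integrable setT (EFin \o f) ->
  ((\int[P]_x f x)%:E = \int[P]_x (f x)%:E)%E.
Proof. by move=> fi; rewrite /Rintegral fineK// integrable_fin_num. Qed.

Lemma norm_Rintegral_le (f : T -> R) C : measurable_fun setT f ->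
  (forall x, `|f x| <= C) -> `|\int[P]_x f x| <= C.
Proof.
move=> mf fC; have fi := bounded_integrable mf fC.
apply: le_trans (le_normr_Rintegral _ fi) _ => //.
rewrite -[leRHS]Rintegral_cst1; apply: le_Rintegral => //.
- by apply: (@bounded_integrable _ C); [exact: measurableT_comp | move=> x; rewrite normr_id].
- by apply: (@bounded_integrable _ `|C|) => //; exact: measurable_cst.
Qed.

Lemma bounded_cvg_Rintegral (f_ : nat -> T -> R) (f : T -> R) (C : R) :
  (forall n, measurable_fun setT (f_ n)) -> measurable_fun setT f ->
  (forall n x, `|f_ n x| <= C) ->
  {ae P, forall x, f_ ^~ x @ \oo --> f x} ->
  (fun n => \int[P]_x f_ n x) @ \oo --> \int[P]_x f x.
Proof.
move=> mf_ mf fC ff; apply: (@dominated_cvg_Rintegral _ _ _ _ _ _ (cst C)) => //.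
by apply: (@bounded_integrable _ `|C|) => //; exact: measurable_cst.
Qed.

End Util.

(** * A continuity theorem for characteristic functions *)

Section Kernel.
Context {R : realType}.
Notation mu := (@lebesgue_measure R).

(** Up to the factor pi, the density of the Cauchy law of scale [e]. It is left unnormalised, so the
    total masses below are [pi]. *)
Definition cauchy_kernel (e x : R) : R := e / (e ^+ 2 + x ^+ 2).

Lemma cauchy_kernel_ge0 e x : 0 <= e -> 0 <= cauchy_kernel e x.
Proof. by move=> e0; rewrite divr_ge0// addr_ge0// sqr_ge0. Qed.

Lemma continuous_cauchy_kernel e : 0 < e -> continuous (cauchy_kernel e).
Proof.
move=> e0 x; apply: cvgM; first exact: cvg_cst.
apply: cvgV; first by rewrite gt_eqF// ltr_pwDl ?exprn_gt0 ?sqr_ge0.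
by apply: cvgD; [exact: cvg_cst|exact: exprn_continuous].
Qed.

Lemma cvgr_expRM (e : R) : 0 < e -> expR (- (e * t)) @[t --> +oo] --> (0 : R).
Proof.
move=> e0.
apply: (@cvg_comp _ _ _ (fun t => e * t) (fun t => expR (- t))); last exact: cvgr_expR.
by apply: gt0_cvgMry => //; exact: cvg_id.
Qed.

(** The summand 1 makes the integrand nonnegative, which Tonelli's theorem will need; its price is
    the constant [e^-1]. The formula is the fundamental theorem of calculus on a half-line. *)
Lemma cauchy_kernel_laplace (e x : R) : 0 < e ->
  (\int[mu]_(t in `[0%R, +oo[) (expR (- (e * t)) * (1 + cos (t * x)))%:E =
   (e^-1 + cauchy_kernel e x)%:E)%E.
Proof.
move=> e0.
have k0 : e ^+ 2 + x ^+ 2 != 0 by rewrite gt_eqF// ltr_pwDl ?exprn_gt0 ?sqr_ge0.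
(* An antiderivative that vanishes at infinity: the first term belongs to the exponential alone, the
   second to the cosine part. *)
pose F t : R := - expR (- (e * t)) / e +
  expR (- (e * t)) * (x * sin (t * x) - e * cos (t * x)) / (e ^+ 2 + x ^+ 2).
have dF (t : R) : is_derive t 1 F (expR (- (e * t)) * (1 + cos (t * x))).
  rewrite /F; apply: is_derive_eq.
  rewrite /GRing.scale/=; field. by rewrite k0 gt_eqF.
have Fcvg : F t @[t --> +oo] --> (0 : R).
  suff : F t @[t --> +oo] --> (- 0 * e^-1 + 0 : R) by rewrite oppr0 mul0r addr0.
  apply: cvgD; first by apply: cvgM; [apply: cvgN; exact: cvgr_expRM|exact: cvg_cst].
  apply/cvgr0Pnorm_lt => eps eps0.
  pose K := (`|x| + e) / (e ^+ 2 + x ^+ 2) + 1.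
  have K0 : 0 < K by rewrite ltr_wpDl// divr_ge0// addr_ge0 ?sqr_ge0// ltW.
  have /cvgr0Pnorm_lt/(_ (eps / K)) := cvgr_expRM e0.
  move=> /(_ (divr_gt0 eps0 K0)); apply: filterS => t.
  rewrite ltr_pdivlMr// => /le_lt_trans; apply.
  rewrite -mulrA normrM ler_wpM2l// /K (@le_trans _ _ ((`|x| + e) / (e ^+ 2 + x ^+ 2)))//; last by rewrite lerDl.
  rewrite normrM normfV (@ger0_norm _ (e ^+ 2 + x ^+ 2)) ?addr_ge0 ?sqr_ge0//.
  rewrite ler_wpM2r// ?invr_ge0 ?addr_ge0 ?sqr_ge0// (le_trans (ler_normB _ _))// lerD// normrM.
    by rewrite ler_piMr// ler_norml sin_geN1 sin_le1.
  by rewrite (gtr0_norm e0) ler_piMr// ?(ltW e0)// ler_norml cos_geN1 cos_le1.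
have cf : continuous (fun t => expR (- (e * t)) * (1 + cos (t * x))).
  move=> t; apply: cvgM.
    apply: (@cvg_comp _ _ _ (fun t => - (e * t)) expR); last exact: continuous_expR.
    by apply: cvgN; apply: cvgM; [exact: cvg_cst|exact: cvg_id].
  apply: cvgD; first exact: cvg_cst.
  apply: (@cvg_comp _ _ _ (fun t => t * x) cos); last exact: continuous_cos.
  by apply: cvgM; [exact: cvg_id|exact: cvg_cst].
rewrite (@ge0_continuous_FTC2y _ _ F 0 0)//.
- rewrite /F !mulr0 oppr0 expR0 mul0r sin0 cos0 mulr0 sub0r -EFinB; congr EFin.
  by rewrite /cauchy_kernel; field; rewrite k0 gt_eqF.
- exact: continuous_subspaceT.
- by apply: cvg_at_right_filter; apply: differentiable_continuous; exact/derivable1_diffP.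
- by move=> t _; rewrite derive1E derive_val.
Qed.

(** An affine change of variables reduces the integral to that of 1 / (1 + y^2), which is even and
    known on the half-line. *)
Lemma integral_cauchy_kernel (e x : R) : 0 < e ->
  (\int[mu]_y (cauchy_kernel e (x - y))%:E = pi%:E)%E.
Proof.
move=> e0.
have H : (\int[mu]_y ((@oneDsqr R) y)^-1%:E = pi%:E)%E.
  rewrite ge0_symfun_integralT.
  - have := @integral0y_oneDsqr R; rewrite set_itvE /= => ->.
    by rewrite -EFinM mulrC divfK.
  - by move=> y; rewrite invr_ge0 (le_trans ler01).
  - exact: continuous_oneDsqrV.
  - by move=> y /=; rewrite /oneDsqr sqrrN.
rewrite -H.
have dF (y : R) : is_derive y 1 (fun y => (y - x) / e) e^-1.
  by apply: is_derive_eq; rewrite /GRing.scale/=; ring.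
have dFE : ((fun y : R => (y - x) / e)^`())%classic = cst e^-1.
  by apply/funext => y; rewrite derive1E derive_val.
rewrite (@increasing_ge0_integration_by_substitutionT _ (fun y => (y - x) / e) (fun y => (oneDsqr y)^-1)).
- apply: eq_integral => y _; congr EFin.
  transitivity ((oneDsqr ((y - x) / e))^-1 * e^-1); last by rewrite -[RHS]/(_ * _) dFE.
  rewrite /oneDsqr /cauchy_kernel; field.
  by rewrite gt_eqF//= gt_eqF// ltr_pwDl ?exprn_gt0 ?sqr_ge0//.
- by move=> y z yz; rewrite ltr_pM2r ?invr_gt0// ltrD2r.
- by rewrite dFE; exact: cst_continuous.
- by rewrite dFE; exact: is_cvg_cst.
- by rewrite dFE; exact: is_cvg_cst.
- by move=> y.
- by apply: gt0_cvgMlNy; [rewrite invr_gt0|exact: cvg_addrr_Ny].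
- by apply: gt0_cvgMly; [rewrite invr_gt0|exact: cvg_addrr].
- exact: continuous_oneDsqrV.
- by move=> y; rewrite invr_ge0 (le_trans ler01).
Qed.

(** The half-line is carried by an indicator, so that product measures and domination can be used on
    the whole line. *)
Definition laplace_weight (e t : R) : R := expR (- (e * t)) * \1_(`[0%R, +oo[%classic) t.

Lemma laplace_weight_ge0 e t : 0 <= laplace_weight e t.
Proof. by rewrite mulr_ge0// expR_ge0. Qed.

Lemma measurable_laplace_weight e : measurable_fun setT (laplace_weight e).
Proof.
apply: measurable_funM; last exact: measurable_indic.
apply: measurableT_comp => //; apply: measurableT_comp => //.
Qed.

Lemma laplace_weightE (e x : R) : 0 < e ->
  (\int[mu]_t (laplace_weight e t * (1 + cos (t * x)))%:E =
   (e^-1 + cauchy_kernel e x)%:E)%E.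
Proof.
move=> e0; rewrite -cauchy_kernel_laplace// [RHS]integral_mkcond.
apply: eq_integral => t _; rewrite patchE /laplace_weight indicE.
by case: ifP => _; rewrite ?mulr1// mulr0 mul0r.
Qed.

Lemma integral_laplace_weight (e : R) : 0 < e ->
  (\int[mu]_t (laplace_weight e t)%:E = e^-1%:E)%E.
Proof.
move=> e0; have := @laplace_weightE e 0 e0.
under eq_integral do rewrite mulr0 cos0 mulrC EFinM.
rewrite ge0_integralZl//; last 2 first.
- by apply/measurable_EFinP; exact: measurable_laplace_weight.
- by move=> t _; rewrite lee_fin laplace_weight_ge0.
have -> : e^-1 + cauchy_kernel e 0 = 2 * e^-1.
  by rewrite /cauchy_kernel expr0n/= addr0; field; rewrite gt_eqF.
rewrite EFinM => /eqP; rewrite -eqe_pdivrMl// muleA -EFinM mulVf//; by rewrite mul1e => /eqP ->.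
Qed.

Lemma laplace_weight_integrable (e : R) : 0 < e ->
  mu.-integrable setT (EFin \o laplace_weight e).
Proof.
move=> e0; apply/integrableP; split.
  by apply/measurable_EFinP; exact: measurable_laplace_weight.
under eq_integral do rewrite gee0_abs ?lee_fin ?laplace_weight_ge0//.
by rewrite integral_laplace_weight// ltry.
Qed.

End Kernel.

(** * Cauchy smoothing of a law and its Fourier representation *)

Section Smoothing.
Context {R : realType}.
Notation mu := (@lebesgue_measure R).
Implicit Types (nu : probability R R) (f : R -> R).

(** Convolution with the kernel, extended-real valued so that no finiteness has to be shown before
    Tonelli's theorem is applied. *)
Definition smooth (e : R) f (x : R) : \bar R :=
  (\int[mu]_y (f y * cauchy_kernel e (x - y))%:E)%E.

(** Up to the factor pi, the density at [y] of the sum of a [nu]-distributed variable and an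
    independent Cauchy variable of scale [e]. *)
Definition cauchy_density nu (e y : R) : R := \int[nu]_x cauchy_kernel e (x - y).

Lemma measurable_cauchy_kernelB (e : R) : 0 < e ->
  measurable_fun setT (fun z : R * R => cauchy_kernel e (z.1 - z.2)).
Proof.
move=> e0; apply: measurableT_comp.
  by apply: continuous_measurable_fun; exact: continuous_cauchy_kernel.
by apply: measurable_funB.
Qed.

Lemma cauchy_kernel_le (e x : R) : 0 < e -> cauchy_kernel e x <= e^-1.
Proof.
move=> e0; rewrite /cauchy_kernel ler_pdivrMr; last by rewrite ltr_pwDl ?exprn_gt0 ?sqr_ge0.
by rewrite mulrDr expr2 mulKf ?gt_eqF// lerDl mulr_ge0 ?sqr_ge0// invr_ge0 ltW.
Qed.

Lemma cauchy_kernelB_integrable nu (e y : R) : 0 < e ->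
  nu.-integrable setT (EFin \o (fun x => cauchy_kernel e (x - y))).
Proof.
move=> e0; apply: (@bounded_integrable _ _ _ _ _ e^-1).
  exact: (measurable_fun_pair1 y (measurable_cauchy_kernelB e0)).
by move=> x; rewrite ger0_norm ?cauchy_kernel_le// cauchy_kernel_ge0// ltW.
Qed.

(** Tonelli's theorem moves the smoothing from the test function to the law. *)
Lemma integral_smooth nu (e : R) f : 0 < e -> measurable_fun setT f -> (forall x, 0 <= f x) ->
  (\int[nu]_x smooth e f x = \int[mu]_y (f y * cauchy_density nu e y)%:E)%E.
Proof.
move=> e0 mf f0; rewrite /smooth.
pose g (z : R * R) := (f z.2 * cauchy_kernel e (z.1 - z.2))%:E.
rewrite (@fubini_tonelli _ _ _ _ _ nu mu g); last 2 first.
- apply/measurable_EFinP; apply: measurable_funM.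
    by apply: measurableT_comp => //.
  exact: measurable_cauchy_kernelB.
- by move=> z; rewrite lee_fin mulr_ge0// cauchy_kernel_ge0// ltW.
apply: eq_integral => y _; rewrite /g/=.
under eq_integral do rewrite EFinM.
rewrite ge0_integralZl//; last 3 first.
- by move: (cauchy_kernelB_integrable nu y e0) => /integrableP[].
- by move=> x _; rewrite lee_fin cauchy_kernel_ge0// ltW.
- by rewrite lee_fin.
by rewrite EFinM EFin_Rintegral//; exact: cauchy_kernelB_integrable.
Qed.

Lemma integrable_cos nu (t : R) : nu.-integrable setT (EFin \o (fun x : R => cos (t * x))).
Proof.
apply: (@bounded_integrable _ _ _ _ _ 1); first exact: measurableT_comp.
by move=> x; rewrite ler_norml cos_geN1 cos_le1.
Qed.

Lemma integrable_sin nu (t : R) : nu.-integrable setT (EFin \o (fun x : R => sin (t * x))).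
Proof.
apply: (@bounded_integrable _ _ _ _ _ 1); first exact: measurableT_comp.
by move=> x; rewrite ler_norml sin_geN1 sin_le1.
Qed.

(** It sees [nu] only through its characteristic function at [t]: the bracket is 1 plus the
    [nu]-mean of cos (t (x - y)). *)
Definition weighted_cf nu (e y t : R) : R := laplace_weight e t *
  (1 + (cos (t * y) * (\int[nu]_x cos (t * x)) + sin (t * y) * (\int[nu]_x sin (t * x)))).

Lemma weighted_cfE nu (e y t : R) :
  (\int[nu]_x (laplace_weight e t * (1 + cos (t * (x - y))))%:E = (weighted_cf nu e y t)%:E)%E.
Proof.
have i1 : nu.-integrable setT (EFin \o (fun x : R => cos (t * y) * cos (t * x))).
  exact: (integrableZl _ (cos (t * y)) (integrable_cos nu t)).
have i2 : nu.-integrable setT (EFin \o (fun x : R => sin (t * y) * sin (t * x))).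
  exact: (integrableZl _ (sin (t * y)) (integrable_sin nu t)).
have i3 : nu.-integrable setT (EFin \o (fun x : R => cos (t * y) * cos (t * x) + sin (t * y) * sin (t * x))).
  exact: (integrableD _ i1 i2).
have i4 : nu.-integrable setT (EFin \o (fun x : R => (1 : R))).
  by apply: (@bounded_integrable _ _ _ _ _ 1) => // x; rewrite normr1.
have i5 : nu.-integrable setT (EFin \o (fun x : R => 1 + (cos (t * y) * cos (t * x) + sin (t * y) * sin (t * x)))).
  exact: (integrableD _ i4 i3).
transitivity (\int[nu]_x (laplace_weight e t * (1 + (cos (t * y) * cos (t * x) + sin (t * y) * sin (t * x))))%:E)%E.
  by apply: eq_integral => x _; rewrite mulrBr cosB [cos (t * x) * _]mulrC [sin (t * x) * _]mulrC.
rewrite -EFin_Rintegral; last exact: (integrableZl _ (laplace_weight e t) i5).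
congr EFin; rewrite RintegralZl// RintegralD// RintegralD// Rintegral_cst1.
by rewrite !RintegralZl//; [exact: integrable_sin|exact: integrable_cos].
Qed.

Let mker (e y : R) : measurable_fun setT
  (fun z : R * R => (laplace_weight e z.2 * (1 + cos (z.2 * (z.1 - y))))%:E).
Proof.
apply/measurable_EFinP; apply: measurable_funM.
  apply: measurableT_comp => //; exact: measurable_laplace_weight.
apply: measurable_funD => //; apply: measurableT_comp => //.
by apply: measurable_funM => //; apply: measurable_funB.
Qed.

Let ker_ge0 (e y : R) (z : R * R) :
  (0 <= (laplace_weight e z.2 * (1 + cos (z.2 * (z.1 - y))))%:E)%E.
Proof. by rewrite lee_fin mulr_ge0 ?laplace_weight_ge0// -lerBlDl sub0r cos_geN1. Qed.

Lemma measurable_weighted_cf nu (e y : R) : measurable_fun setT (weighted_cf nu e y).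
Proof.
apply/measurable_EFinP.
have := @measurable_fun_fubini_tonelli_G _ _ _ _ _ nu _ (mker e y) (ker_ge0 e y).
by apply: eq_measurable_fun => t _; rewrite /= -weighted_cfE.
Qed.

(** Fourier inversion for the smoothed law: write the kernel as a Laplace transform and exchange the
    integrals in [x] and [t]. *)
Lemma cauchy_density_cf nu (e y : R) : 0 < e ->
  ((e^-1 + cauchy_density nu e y)%:E = \int[mu]_t (weighted_cf nu e y t)%:E)%E.
Proof.
move=> e0.
transitivity (\int[nu]_x (e^-1 + cauchy_kernel e (x - y))%:E)%E.
  under eq_integral do rewrite EFinD.
  rewrite integralD//; last 2 first.
  - by apply: (@bounded_integrable _ _ _ _ _ `|e^-1|) => //; exact: measurable_cst.
  - exact: cauchy_kernelB_integrable.
  rewrite integral_cst1 EFinD EFin_Rintegral//.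
  exact: cauchy_kernelB_integrable.
under eq_integral do rewrite -laplace_weightE//.
rewrite (@fubini_tonelli _ _ _ _ _ nu mu _ (mker e y) (ker_ge0 e y)).
by apply: eq_integral => t _; rewrite weighted_cfE.
Qed.

(** The bracket is made of three terms of modulus at most 1. The bound does not involve [nu], hence
    it dominates a whole sequence of laws. *)
Lemma norm_weighted_cf nu (e y t : R) : `|weighted_cf nu e y t| <= 3 * laplace_weight e t.
Proof.
rewrite /weighted_cf normrM ger0_norm ?laplace_weight_ge0// mulrC ler_wpM2r ?laplace_weight_ge0//.
rewrite (le_trans (ler_normD _ _))// normr1.
have -> : (3 : R) = 1 + (1 + 1) by ring.
rewrite lerD2l (le_trans (ler_normD _ _))// lerD// normrM -[leRHS]mulr1 ler_pM//.
- by rewrite ler_norml cos_geN1 cos_le1.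
- apply: norm_Rintegral_le; first exact: measurableT_comp.
  by move=> x; rewrite ler_norml cos_geN1 cos_le1.
- by rewrite ler_norml sin_geN1 sin_le1.
- apply: norm_Rintegral_le; first exact: measurableT_comp.
  by move=> x; rewrite ler_norml sin_geN1 sin_le1.
Qed.

Lemma cauchy_density_ge0 nu (e y : R) : 0 < e -> 0 <= cauchy_density nu e y.
Proof. by move=> e0; apply: Rintegral_ge0 => x _; rewrite cauchy_kernel_ge0// ltW. Qed.

Lemma measurable_cauchy_density nu (e : R) : 0 < e -> measurable_fun setT (cauchy_density nu e).
Proof.
move=> e0; apply/measurable_EFinP.
pose g (z : R * R) := (cauchy_kernel e (z.1 - z.2))%:E.
have mg : measurable_fun setT g by apply/measurable_EFinP; exact: measurable_cauchy_kernelB.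
have g0 z : (0 <= g z)%E by rewrite lee_fin cauchy_kernel_ge0// ltW.
have := @measurable_fun_fubini_tonelli_G _ _ _ _ _ nu _ mg g0.
apply: eq_measurable_fun => y _; rewrite /= /cauchy_density EFin_Rintegral//.
exact: cauchy_kernelB_integrable.
Qed.

(** Duality with the constant test function 1. The mass is the same for every [nu], which is what
    [scheffe] asks for. *)
Lemma integral_cauchy_density nu (e : R) : 0 < e ->
  (\int[mu]_y (cauchy_density nu e y)%:E = pi%:E)%E.
Proof.
move=> e0; have := @integral_smooth nu e (cst 1) e0 (measurable_cst _) (fun=> ler01).
rewrite /smooth; under eq_integral do under eq_integral do rewrite mul1r.
under eq_integral do rewrite integral_cauchy_kernel//.
under [X in _ = X]eq_integral do rewrite mul1r.
by rewrite integral_cst1 => <-.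
Qed.

Lemma cauchy_density_integrable nu (e : R) : 0 < e ->
  mu.-integrable setT (EFin \o cauchy_density nu e).
Proof.
move=> e0; apply/integrableP; split.
  by apply/measurable_EFinP; exact: measurable_cauchy_density.
under eq_integral do rewrite gee0_abs ?lee_fin ?cauchy_density_ge0//.
by rewrite integral_cauchy_density// ltry.
Qed.

(** An exceptional null set of [t] is harmless, since the characteristic functions enter under an
    integral in [t]. *)
Lemma cauchy_density_cvg (nu_ : nat -> probability R R) nu (e y : R) : 0 < e ->
  {ae mu, forall t, (fun n => \int[nu_ n]_x cos (t * x)) @ \oo --> \int[nu]_x cos (t * x)} ->
  {ae mu, forall t, (fun n => \int[nu_ n]_x sin (t * x)) @ \oo --> \int[nu]_x sin (t * x)} ->
  (fun n => cauchy_density (nu_ n) e y) @ \oo --> cauchy_density nu e y.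
Proof.
move=> e0 hc hs.
have i3 : mu.-integrable setT (EFin \o (fun t : measurableTypeR R => 3 * laplace_weight e t)).
  exact: (integrableZl _ 3 (laplace_weight_integrable e0)).
have cvg_cf : (fun n => \int[mu]_t weighted_cf (nu_ n) e y t) @ \oo --> \int[mu]_t weighted_cf nu e y t.
  apply: (@dominated_cvg_Rintegral _ _ (measurableTypeR R) mu _ _ _ _ _ i3).
  - by move=> n; exact: measurable_weighted_cf.
  - exact: measurable_weighted_cf.
  - by move=> n t; exact: norm_weighted_cf.
  - have F := @ae_filter_ringOfSetsType _ _ _ mu; apply: filterS2 hc hs => t ct st.
    apply: cvgM; first exact: cvg_cst.
    apply: cvgD; first exact: cvg_cst.
    by apply: cvgD; apply: cvgM => //; exact: cvg_cst.
have E nu' : \int[mu]_t weighted_cf nu' e y t = e^-1 + cauchy_density nu' e y.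
  by rewrite /Rintegral -cauchy_density_cf.
move: cvg_cf; under eq_fun do rewrite E; rewrite E => h.
suff : (fun n => e^-1 + cauchy_density (nu_ n) e y - e^-1) @ \oo --> e^-1 + cauchy_density nu e y - e^-1.
  under eq_fun do rewrite addrAC subrr add0r.
  by rewrite addrAC subrr add0r.
by apply: cvgB => //; exact: cvg_cst.
Qed.

End Smoothing.

(** * Convergence of integrals against densities of equal mass *)

Section Scheffe.
Context {R : realType} {d : measure_display} {T : measurableType d}.
Variable mu : {measure set T -> \bar R}.

(* Both densities have the same mass, so the L1 distance is twice the integral of (D - D_n)^+, which is dominated by D. *)
Lemma scheffe (D_ : nat -> T -> R) (D f : T -> R) (C : R) :
  (forall n, mu.-integrable setT (EFin \o D_ n)) -> mu.-integrable setT (EFin \o D) ->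
  (forall n x, 0 <= D_ n x) -> (forall x, 0 <= D x) ->
  (forall n, \int[mu]_x D_ n x = \int[mu]_x D x) ->
  (forall x, D_ ^~ x @ \oo --> D x) ->
  measurable_fun setT f -> (forall x, `|f x| <= C) ->
  (fun n => \int[mu]_x (f x * D_ n x)) @ \oo --> \int[mu]_x (f x * D x).
Proof.
move=> iD_ iD D_0 D0 eqI cvgD mf fC.
pose h n x := Num.max 0 (D x - D_ n x).
have mD : measurable_fun [set: T] D by move: iD => /integrableP[/measurable_EFinP].
have mD_ n : measurable_fun [set: T] (D_ n) by move: (iD_ n) => /integrableP[/measurable_EFinP].
have mh n : measurable_fun [set: T] (h n).
  by apply: measurable_maxr => //; apply: measurable_funB.
have h0 n x : 0 <= h n x by rewrite le_max lexx.
have hD n x : h n x <= D x by rewrite ge_max D0/= lerBlDr lerDl.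
have ih n : mu.-integrable setT (EFin \o h n).
  apply: (le_integrable measurableT _ _ iD); first exact/measurable_EFinP.
  by move=> x _; rewrite /= lee_fin !ger0_norm.
have ifD g : mu.-integrable setT (EFin \o g) -> mu.-integrable setT (EFin \o (fun x => f x * g x)).
  move=> ig; apply: (le_integrable measurableT _ _ (integrableZl measurableT C ig)).
    apply/measurable_EFinP; apply: measurable_funM => //.
    by move: ig => /integrableP[/measurable_EFinP].
  by move=> x _; rewrite /= lee_fin !normrM ler_wpM2r// (le_trans (fC x))// ler_norm.
have hcvg : (fun n => \int[mu]_x h n x) @ \oo --> (0 : R).
  have -> : (0 : R) = \int[mu]_x cst 0 x by rewrite /Rintegral integral0.
  apply: (dominated_cvg_Rintegral mh _ iD) => //; first by move=> n x; rewrite ger0_norm.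
  apply: aeW => x.
  apply/cvgr0Pnorm_le => eps eps0; have /cvgr_dist_le/(_ _ eps0) := cvgD x.
  apply: filterS => n hn; rewrite ger0_norm ?le_max ?lexx// ge_max (ltW eps0)/=.
  exact: le_trans (ler_norm _) hn.
(* Pointwise |D_n - D| = (D_n - D) + 2 h_n, and the first summand integrates to zero. *)
have bnd n : `|\int[mu]_x (f x * D_ n x) - \int[mu]_x (f x * D x)| <= 2 * C * \int[mu]_x h n x.
  rewrite -RintegralB//; [|exact: ifD|exact: ifD].
  have iB : mu.-integrable setT (EFin \o (fun x => f x * D_ n x - f x * D x)).
    exact: (integrableB _ (ifD _ (iD_ n)) (ifD _ iD)).
  have iBD : mu.-integrable setT (EFin \o (fun x => D_ n x - D x)).
    exact: (integrableB _ (iD_ n) iD).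
  have i2h : mu.-integrable setT (EFin \o (fun x => 2 * h n x)).
    exact: (integrableZl _ 2 (ih n)).
  have iR : mu.-integrable setT (EFin \o (fun x => D_ n x - D x + 2 * h n x)).
    exact: (integrableD _ iBD i2h).
  apply: (le_trans (le_normr_Rintegral _ iB)) => //.
  apply: (@le_trans _ _ (\int[mu]_x (C * (D_ n x - D x + 2 * h n x)))).
    apply: le_Rintegral => //; first exact: integrable_norm.
      exact: (integrableZl _ C iR).
    move=> x _; rewrite -mulrBr normrM ler_pM// /h.
    case: (leP 0 (D x - D_ n x)) => h0x.
      by rewrite distrC ger0_norm//; lra.
    by rewrite ger0_norm; lra.
  rewrite RintegralZl// RintegralD// RintegralB// eqI subrr add0r RintegralZl//.
  by rewrite mulrA [C * 2]mulrC.
apply/cvgrPdist_le => eps eps0.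
have : (fun n => 2 * C * \int[mu]_x h n x) @ \oo --> (2 * C * 0 : R).
  by apply: cvgM => //; exact: cvg_cst.
rewrite mulr0 => /cvgr0Pnorm_le/(_ eps eps0); apply: filterS => n hn.
by rewrite distrC (le_trans (bnd n))// (le_trans (ler_norm _)).
Qed.

End Scheffe.

(** * From characteristic functions to weak convergence, distribution functions and atoms *)

Section WeakConvergence.
Context {R : realType}.
Notation mu := (@lebesgue_measure R).

(** For |z| >= r one has 1 + z^2 <= (1 + r^-2) z^2 <= (1 + r^-2) (e^2 + z^2). Away from 0 the kernel
    is thus O(e) times an integrable function. *)
Lemma cauchy_kernel_tail (e r z : R) : 0 < e -> e <= 1 -> 0 < r -> r <= `|z| ->
  cauchy_kernel e z <= e * (1 + r ^- 2) * cauchy_kernel 1 z.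
Proof.
move=> e0 e1 r0 rz.
have rz2 : r ^+ 2 <= z ^+ 2.
  by rewrite -[leRHS]real_normK ?num_real// lerXn2r// ?nnegrE// ltW.
have z20 : 0 < z ^+ 2 by apply: lt_le_trans rz2; rewrite exprn_gt0.
have e2 : 0 <= e ^+ 2 by rewrite sqr_ge0.
rewrite /cauchy_kernel -mulrA ler_wpM2l ?(ltW e0)// mul1r expr1n.
rewrite ler_pdivlMr ?addr_gt0// ler_pdivrMl ?ltr_wpDl// mulrC.
rewrite mulrDl mul1r.
have : 1 <= r ^- 2 * z ^+ 2 by rewrite mulrC ler_pdivlMr ?exprn_gt0// mul1r.
have : 0 <= r ^- 2 * e ^+ 2 by rewrite mulr_ge0// invr_ge0 sqr_ge0.
lra.
Qed.

Lemma measurable_cauchy_kernelr (e x : R) : 0 < e ->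
  measurable_fun setT (fun y : R => cauchy_kernel e (x - y)).
Proof. by move=> e0; exact: (measurable_fun_pair2 x (measurable_cauchy_kernelB e0)). Qed.

(** Points closer than [r] contribute the modulus [eta], the others the tail bound. There are two
    one-sided inequalities because [smooth e f x] is an extended real. *)
Lemma smooth_bounds (e r C eta : R) (f : R -> R) (x : R) :
  0 < e -> e <= 1 -> 0 < r -> measurable_fun setT f -> (forall y, 0 <= f y <= C) -> 0 <= eta ->
  (forall y, `|x - y| < r -> `|f x - f y| <= eta) ->
  let eta' := eta + 2 * C * e * (1 + r ^- 2) in
  (smooth e f x <= ((f x + eta') * pi)%:E)%E /\ ((f x * pi)%:E <= smooth e f x + (eta' * pi)%:E)%E.
Proof.
move=> e0 e1 r0 mf fC eta0 fr eta'.
have C0 : 0 <= C by case/andP: (fC 0); exact: le_trans.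
have k0 (e' z : R) : 0 < e' -> 0 <= cauchy_kernel e' z by move=> ?; rewrite cauchy_kernel_ge0// ltW.
pose B (y : R) := eta * cauchy_kernel e (x - y) + 2 * C * e * (1 + r ^- 2) * cauchy_kernel 1 (x - y).
have c0 : 0 <= 2 * C * e * (1 + r ^- 2).
  by rewrite !mulr_ge0// ?(ltW e0)// addr_ge0// invr_ge0 sqr_ge0.
have B0 y : 0 <= B y by rewrite addr_ge0// mulr_ge0// k0.
have mk := measurable_cauchy_kernelr.
have mB : measurable_fun setT B.
  by apply: measurable_funD; apply: measurable_funM => //; exact: mk.
have fB y : `|f x - f y| * cauchy_kernel e (x - y) <= B y.
  have [xy|xy] := ltP `|x - y| r.
    rewrite /B -[leLHS]addr0 lerD ?ler_wpM2r ?k0 ?fr// mulr_ge0// k0//.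
  rewrite /B -[leLHS]add0r; apply: lerD; first by rewrite mulr_ge0// k0.
  apply: (@le_trans _ _ (2 * C * cauchy_kernel e (x - y))).
    rewrite ler_wpM2r ?k0// (le_trans (ler_normB _ _))//.
    have /andP[a1 a2] := fC x; have /andP[b1 b2] := fC y.
    by rewrite !ger0_norm//; lra.
  rewrite -[2 * C * e * _]mulrA -[2 * C * (e * _) * _]mulrA ler_wpM2l ?mulr_ge0//.
  exact: cauchy_kernel_tail.
have iB : (\int[mu]_y (B y)%:E = (eta' * pi)%:E)%E.
  rewrite /B; under eq_integral do rewrite EFinD.
  rewrite ge0_integralD//; first last.
  - by apply/measurable_EFinP; apply: measurable_funM => //; exact: mk.
  - by move=> y _; rewrite lee_fin mulr_ge0// k0.
  - by apply/measurable_EFinP; apply: measurable_funM => //; exact: mk.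
  - by move=> y _; rewrite lee_fin mulr_ge0// k0.
  under eq_integral do rewrite EFinM.
  under [X in (_ + X)%E]eq_integral do rewrite EFinM.
  rewrite !ge0_integralZl//; try by [move=> y _; rewrite lee_fin k0 | apply/measurable_EFinP; exact: mk].
  by rewrite !integral_cauchy_kernel// -!EFinM -EFinD -mulrDl.
have ifx : (\int[mu]_y (f x * cauchy_kernel e (x - y))%:E = (f x * pi)%:E)%E.
  under eq_integral do rewrite EFinM.
  rewrite ge0_integralZl//; try by [move=> y _; rewrite lee_fin k0 | apply/measurable_EFinP; exact: mk | rewrite lee_fin; case/andP: (fC x)].
  by rewrite integral_cauchy_kernel// -EFinM.
have mfk : measurable_fun setT (fun y => (f y * cauchy_kernel e (x - y))%:E).
  by apply/measurable_EFinP; apply: measurable_funM => //; exact: mk.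
have fk0 y : (0 <= (f y * cauchy_kernel e (x - y))%:E)%E.
  by rewrite lee_fin mulr_ge0 ?k0//; case/andP: (fC y).
have fxk0 y : (0 <= (f x * cauchy_kernel e (x - y))%:E)%E.
  by rewrite lee_fin mulr_ge0 ?k0//; case/andP: (fC x).
have BE0 y : (0 <= (B y)%:E)%E by rewrite lee_fin.
have mBE : measurable_fun [set: R] (fun y => (B y)%:E) by exact/measurable_EFinP.
have mfxk : measurable_fun setT (fun y : R => (f x * cauchy_kernel e (x - y))%:E).
  by apply/measurable_EFinP; apply: measurable_funM => //; exact: mk.
split.
  rewrite mulrDl EFinD -iB -ifx -ge0_integralD//.
  apply: ge0_le_integral => //.
  - exact: emeasurable_funD.
  - move=> y _; rewrite -EFinD lee_fin -lerBlDl -mulrBl (le_trans _ (fB y))// ler_wpM2r ?k0//.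
    by rewrite distrC ler_norm.
rewrite -iB -ifx /smooth -ge0_integralD//.
apply: ge0_le_integral => //.
- exact: emeasurable_funD.
- move=> y _; rewrite -EFinD lee_fin -lerBlDl -mulrBl (le_trans _ (fB y))// ler_wpM2r ?k0//.
  exact: ler_norm.
Qed.

Lemma measurable_smooth (e : R) (f : R -> R) : 0 < e -> measurable_fun setT f ->
  (forall y, 0 <= f y) -> measurable_fun setT (smooth e f).
Proof.
move=> e0 mf f0.
pose g (z : R * R) := (f z.2 * cauchy_kernel e (z.1 - z.2))%:E.
apply: (@measurable_fun_fubini_tonelli_F _ _ _ _ _ mu g).
- apply/measurable_EFinP; apply: measurable_funM.
    by apply: measurableT_comp => //.
  exact: measurable_cauchy_kernelB.
- by move=> z; rewrite lee_fin mulr_ge0// cauchy_kernel_ge0// ltW.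
Qed.

(** The error depends on [f] and [e] alone, hence is uniform over all laws [nu]. *)
Lemma integral_smooth_approx (nu : probability R R) (e r C eta : R) (f : R -> R) :
  0 < e -> e <= 1 -> 0 < r -> measurable_fun setT f -> (forall y, 0 <= f y <= C) -> 0 <= eta ->
  (forall x y, `|x - y| < r -> `|f x - f y| <= eta) ->
  `|pi * (\int[nu]_x f x) - \int[mu]_y (f y * cauchy_density nu e y)|
    <= pi * (eta + 2 * C * e * (1 + r ^- 2)).
Proof.
move=> e0 e1 r0 mf fC eta0 fr.
have f0 y : 0 <= f y by case/andP: (fC y).
have C0 : 0 <= C by case/andP: (fC 0); exact: le_trans.
have fi : nu.-integrable setT (EFin \o f).
  by apply: (@bounded_integrable _ _ _ _ _ C) => // x; rewrite ger0_norm//; case/andP: (fC x).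
have pi0 : 0 <= pi :> R by rewrite pi_ge0.
have Di : mu.-integrable setT (EFin \o (fun y => f y * cauchy_density nu e y)).
  apply: (le_integrable measurableT _ _ (integrableZl measurableT C (cauchy_density_integrable nu e0))).
    by apply/measurable_EFinP; apply: measurable_funM => //; exact: measurable_cauchy_density.
  move=> y _; rewrite /= lee_fin !normrM ler_wpM2r// ger0_norm// (le_trans _ (ler_norm _))//.
  by case/andP: (fC y).
have sE : (\int[nu]_x smooth e f x = (\int[mu]_y (f y * cauchy_density nu e y))%:E)%E.
  by rewrite integral_smooth// /Rintegral fineK// integrable_fin_num.
set eta' := eta + _.
have c0 : 0 <= eta' by rewrite addr_ge0// !mulr_ge0// ?(ltW e0)// addr_ge0// invr_ge0 sqr_ge0.
have sm0 x : (0 <= smooth e f x)%E.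
  by apply: integral_ge0 => y _; rewrite lee_fin mulr_ge0// cauchy_kernel_ge0// ltW.
have fpi : nu.-integrable setT (EFin \o (fun x => f x * pi)).
  exact: (integrableZr _ pi fi).
have ci : nu.-integrable setT (EFin \o cst (eta' * pi)).
  by apply: (@bounded_integrable _ _ _ _ _ `|eta' * pi|) => //; exact: measurable_cst.
have mfpi : measurable_fun setT (fun x => (f x * pi)%:E).
  by apply/measurable_EFinP; exact: measurable_funM.
have H1 : ((\int[mu]_y (f y * cauchy_density nu e y))%:E <= (pi * (\int[nu]_x f x) + pi * eta')%:E)%E.
  rewrite -sE.
  apply: (@le_trans _ _ (\int[nu]_x ((f x + eta') * pi)%:E)%E).
    apply: ge0_le_integral => //; first exact: measurable_smooth.
      by apply/measurable_EFinP; apply: measurable_funM => //; exact: measurable_funD.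
    move=> x _; by have [] := @smooth_bounds e r C eta f x e0 e1 r0 mf fC eta0 (fr x).
  under eq_integral do rewrite mulrDl EFinD.
  rewrite integralD// -!EFin_Rintegral// -EFinD lee_fin Rintegral_cst1 RintegralZr//.
  by rewrite mulrC [eta' * _]mulrC.
have H2 : ((pi * (\int[nu]_x f x))%:E <= (\int[mu]_y (f y * cauchy_density nu e y) + pi * eta')%:E)%E.
  rewrite EFinD -sE.
  apply: (@le_trans _ _ (\int[nu]_x (f x * pi)%:E)%E).
    by rewrite -EFin_Rintegral// lee_fin RintegralZr// mulrC.
  have -> : ((pi * eta')%:E = \int[nu]_x (eta' * pi)%:E)%E by rewrite integral_cst1 mulrC.
  rewrite -ge0_integralD//; first last.
  - by move=> x _; rewrite lee_fin mulr_ge0.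
  - exact: measurable_smooth.
  apply: ge0_le_integral => //.
  - by move=> x _; rewrite lee_fin mulr_ge0.
  - apply: emeasurable_funD; [exact: measurable_smooth|exact: measurable_cst].
  - by move=> x _; have [] := @smooth_bounds e r C eta f x e0 e1 r0 mf fC eta0 (fr x).
by move: H1 H2; rewrite !lee_fin; exact: le_distD2.
Qed.

(** Almost every [t] is all that Fubini's theorem delivers for the log-empirical measures. *)
Definition cf_cvg (nu_ : nat -> probability R R) (nu : probability R R) :=
  {ae mu, forall t, (fun n => \int[nu_ n]_x cos (t * x)) @ \oo --> \int[nu]_x cos (t * x)} /\
  {ae mu, forall t, (fun n => \int[nu_ n]_x sin (t * x)) @ \oo --> \int[nu]_x sin (t * x)}.

(** At a fixed scale [e] the smoothed integrals converge by [scheffe], and the smoothing error is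
    uniform in the law. *)
Lemma cf_cvg_unif0 nu_ nu (C : R) (f : R -> R) : cf_cvg nu_ nu ->
  measurable_fun setT f -> (forall y, 0 <= f y <= C) ->
  (forall eta : R, 0 < eta -> exists2 r : R, 0 < r & forall x y, `|x - y| < r -> `|f x - f y| <= eta) ->
  (fun n => \int[nu_ n]_x f x) @ \oo --> \int[nu]_x f x.
Proof.
move=> [hc hs] mf fC fr.
have C0 : 0 <= C by case/andP: (fC 0); exact: le_trans.
have pi0 : 0 < pi :> R by rewrite pi_gt0.
apply/cvgrPdist_le => eps eps0.
have [r r0 {}fr] := fr (eps / 8) (divr_gt0 eps0 (ltr0n _ 8)).
(* The budget is eps / 8 for the modulus of continuity and eps / 8 for the tail, as
   [e * K <= eps / 8]. The 1 keeps [K] positive when [C = 0]. *)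
pose K := 2 * C * (1 + r ^- 2) + 1.
have K0 : 0 < K by rewrite ltr_wpDl// !mulr_ge0// addr_ge0// invr_ge0 sqr_ge0.
pose e := Num.min 1 (eps / 8 / K).
have e0 : 0 < e by rewrite lt_min ltr01/= !divr_gt0.
have e1 : e <= 1 by rewrite ge_min lexx.
have eK : 2 * C * e * (1 + r ^- 2) <= eps / 8.
  have : e <= eps / 8 / K by rewrite ge_min lexx orbT.
  rewrite ler_pdivlMr//; apply: le_trans.
  have -> : e * K = 2 * C * e * (1 + r ^- 2) + e by rewrite /K; ring.
  by rewrite lerDl ltW.
have A (nu' : probability R R) : `|\int[nu']_x f x - pi^-1 * \int[mu]_y (f y * cauchy_density nu' e y)| <= eps / 4.
  have := @integral_smooth_approx nu' e r C (eps / 8) f e0 e1 r0 mf fC (ltW (divr_gt0 eps0 (ltr0n _ 8))) fr.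
  move: (\int[nu']_x f x) (\int[mu]_y _) => a b h.
  have -> : a - pi^-1 * b = (pi * a - b) / pi by rewrite mulrBl mulrAC mulfV ?gt_eqF// mul1r [_ / pi]mulrC.
  rewrite normrM (@gtr0_norm _ pi^-1) ?invr_gt0// ler_pdivrMr// [leRHS]mulrC (le_trans h)// ler_pM2l//.
  by rewrite split4 lerD2l.
have : (fun n => \int[mu]_y (f y * cauchy_density (nu_ n) e y)) @ \oo --> \int[mu]_y (f y * cauchy_density nu e y).
  apply: (@scheffe _ _ _ _ _ _ _ C).
  - by move=> n; exact: cauchy_density_integrable.
  - exact: cauchy_density_integrable.
  - by move=> n x; exact: cauchy_density_ge0.
  - by move=> x; exact: cauchy_density_ge0.
  - by move=> n; rewrite /Rintegral !integral_cauchy_density.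
  - by move=> x; exact: cauchy_density_cvg.
  - by [].
  - by move=> x; rewrite ger0_norm//; case/andP: (fC x).
move=> /cvgr_dist_le/(_ (pi * (eps / 2))) h.
have /h {h} : 0 < pi * (eps / 2) by rewrite mulr_gt0// divr_gt0.
apply: filterS => n.
rewrite -ler_pdivrMl// => h0.
have h : `|pi^-1 * \int[mu]_y (f y * cauchy_density nu e y) -
    pi^-1 * \int[mu]_y (f y * cauchy_density (nu_ n) e y)| <= eps / 2.
  by rewrite -mulrBr normrM (@gtr0_norm _ pi^-1) ?invr_gt0.
exact: le_dist3 (A nu) (A (nu_ n)) h.
Qed.

Lemma cf_cvg_unif nu_ nu (C : R) (f : R -> R) : cf_cvg nu_ nu ->
  measurable_fun setT f -> (forall y, `|f y| <= C) ->
  (forall eta : R, 0 < eta -> exists2 r : R, 0 < r & forall x y, `|x - y| < r -> `|f x - f y| <= eta) ->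
  (fun n => \int[nu_ n]_x f x) @ \oo --> \int[nu]_x f x.
Proof.
move=> h mf fC fr.
have S (nu' : probability R R) : \int[nu']_x (f x + C) = \int[nu']_x f x + C.
  rewrite RintegralD//.
  - by rewrite Rintegral_cst1.
  - exact: bounded_integrable mf fC.
  - by apply: (@bounded_integrable _ _ _ _ _ `|C|) => //; exact: measurable_cst.
have : (fun n => \int[nu_ n]_x (f x + C)) @ \oo --> \int[nu]_x (f x + C).
  apply: (@cf_cvg_unif0 _ _ (C + C) _ h).
  - by apply: measurable_funD.
  - by move=> y; have := fC y; rewrite ler_norml -lerBlDr sub0r => /andP[-> /=]; rewrite lerD2r.
  - move=> eta /fr[r r0 H]; exists r => // x y /H.
    by rewrite opprD addrACA subrr addr0.
rewrite S; under eq_fun do rewrite S.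
move=> H; suff : (fun n => \int[nu_ n]_x f x + C - C) @ \oo --> \int[nu]_x f x + C - C.
  by under eq_fun do rewrite addrK; rewrite addrK.
by apply: cvgB => //; exact: cvg_cst.
Qed.

(** Only [x] is confined to the compact interval: the truncation argument of [cf_cvg_weak] compares
    it with a [y] that may lie outside. *)
Lemma heine_itv (f : R -> R) (K eta : R) : continuous f -> 0 < eta ->
  exists2 r : R, 0 < r & forall x y, `|x| <= K -> `|x - y| < r -> `|f x - f y| <= eta.
Proof.
move=> cf eta0.
have /compact_near_coveringP := @segment_compact R (- K) K.
move=> /(_ _ (0 : R)^'+ (fun r x => forall y, `|x - y| < r -> `|f x - f y| <= eta) _) h.
have H : \forall r \near (0 : R)^'+, `[- K, K]%classic `<=` (fun x => forall y, `|x - y| < r -> `|f x - f y| <= eta).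
  apply: h => x _.
  have /cvgrPdist_le/(_ (eta / 2)) := cf x.
  move=> /(_ (divr_gt0 eta0 (ltr0n _ 2))) /nbhs_ballP[s /= s0 sf].
  have s20 : 0 < s / 2 by rewrite divr_gt0.
  exists (ball x (s / 2), [set r | r < s / 2]) => /=.
    by split; [exact: nbhsx_ballx|exact: nbhs_right_lt].
  move=> [x' r] [/= x'x rs] y x'y.
  have a1 : `|f x - f x'| <= eta / 2.
    by apply: sf; apply: le_ball x'x; rewrite ler_pdivrMr// ler_peMr ?ler1n// ltW.
  have a2 : `|f x - f y| <= eta / 2.
    apply: sf; rewrite /ball/= (splitr s).
    by rewrite (le_lt_trans (ler_distD x' _ _))// ltrD// (lt_trans x'y).
  by rewrite (le_trans (ler_distD (f x) _ _))// [leRHS](splitr eta) lerD// distrC.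
have [r [Hr r0]] := filter_ex (filterI H (nbhs_right_gt (0 : R))).
exists r => // x y xK; apply: Hr => /=.
by rewrite in_itv/= -ler_norml.
Qed.

Definition clamp (s : R) : R := Num.max 0 (Num.min 1 s).

Lemma clamp_ge0 s : 0 <= clamp s.
Proof. by rewrite le_max lexx. Qed.

Lemma clamp_le1 s : clamp s <= 1.
Proof. by rewrite ge_max ler01/= ge_min lexx. Qed.

Lemma clamp0 s : s <= 0 -> clamp s = 0.
Proof. by move=> s0; apply/max_idPl; rewrite ge_min s0 orbT. Qed.

Lemma clamp1 s : 1 <= s -> clamp s = 1.
Proof. by move=> s1; rewrite /clamp (min_idPl s1); apply/max_idPr; exact: ler01. Qed.

Lemma clamp_lipschitz a b : `|clamp a - clamp b| <= `|a - b|.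
Proof.
have h1 := ler_norm (a - b); have := ler_norm (b - a); rewrite distrC => h2.
by rewrite /clamp !maxEle !minEle ler_norml; repeat case: ifPn; rewrite -?ltNge; lra.
Qed.

Lemma measurable_clamp : measurable_fun [set: R] clamp.
Proof. by apply: measurable_maxr => //; apply: measurable_minr. Qed.

(** A continuous function becomes uniformly continuous once multiplied by a Lipschitz cutoff. The
    mass beyond the cutoff is small for [nu], and then for [nu_ n] with [n] large because the
    integrals of the cutoff converge; this is the tightness. *)
Theorem cf_cvg_weak nu_ nu (C : R) (f : R -> R) : cf_cvg nu_ nu ->
  continuous f -> (forall y, `|f y| <= C) ->
  (fun n => \int[nu_ n]_x f x) @ \oo --> \int[nu]_x f x.
Proof.
move=> h cf fC.
have C0 : 0 <= C := le_trans (normr_ge0 _) (fC 0).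
have mf : measurable_fun setT f by exact: continuous_measurable_fun.
pose chi (k : nat) (x : R) := clamp (k%:R + 1 - `|x|).
have chi_lip k x y : `|chi k x - chi k y| <= `|x - y|.
  rewrite /chi (le_trans (clamp_lipschitz _ _))//.
  rewrite (_ : _ - _ - _ = `|y| - `|x|); last by ring.
  by rewrite (le_trans (ler_dist_dist _ _))// distrC.
have mchi k : measurable_fun setT (chi k).
  apply: measurableT_comp; first exact: measurable_clamp.
  by apply: measurable_funB => //; exact: measurableT_comp.
have chi01 k x : `|chi k x| <= 1 by rewrite ger0_norm ?clamp_le1 ?clamp_ge0.
have ichi k (nu' : probability R R) : nu'.-integrable setT (EFin \o chi k).
  exact: bounded_integrable (mchi k) (chi01 k).
have mfchi k : measurable_fun setT (fun x => f x * chi k x) by apply: measurable_funM.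
have fchiC k x : `|f x * chi k x| <= C.
  by rewrite normrM -[leRHS]mulr1 ler_pM.
have A k (nu' : probability R R) : `|\int[nu']_x f x - \int[nu']_x (f x * chi k x)| <= C * (1 - \int[nu']_x chi k x).
  have i1 : nu'.-integrable setT (EFin \o (fun x => f x * chi k x)) := bounded_integrable nu' (mfchi k) (fchiC k).
  have i0 : nu'.-integrable setT (EFin \o cst (1 : R)).
    by apply: (@bounded_integrable _ _ _ _ _ 1) => // x; rewrite normr1.
  have ifi : nu'.-integrable setT (EFin \o f) := bounded_integrable nu' mf fC.
  have i2 : nu'.-integrable setT (EFin \o (fun x => 1 - chi k x)) := integrableB measurableT i0 (ichi k nu').
  have i3 : nu'.-integrable setT (EFin \o (fun x => C * (1 - chi k x))) := integrableZl measurableT C i2.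
  have i4 : nu'.-integrable setT (EFin \o (fun x => f x - f x * chi k x)) := integrableB measurableT ifi i1.
  have E : \int[nu']_x (1 - chi k x) = 1 - \int[nu']_x chi k x.
    by rewrite (RintegralB measurableT i0 (ichi k nu')); congr (_ - _); exact: Rintegral_cst1.
  rewrite -RintegralB// -E -RintegralZl//.
  apply: (le_trans (le_normr_Rintegral _ i4)) => //; apply: le_Rintegral => //.
    exact: integrable_norm.
  move=> x _; rewrite -{1}[f x]mulr1 -mulrBr normrM (@ger0_norm _ (1 - _)) ?ler_wpM2r// subr_ge0 clamp_le1//.
have cvg_chi k : (fun n => \int[nu_ n]_x chi k x) @ \oo --> \int[nu]_x chi k x.
  apply: (cf_cvg_unif h (mchi k) (chi01 k)) => eta eta0; exists eta => // x y /ltW.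
  exact: le_trans.
have cvg_fchi k : (fun n => \int[nu_ n]_x (f x * chi k x)) @ \oo --> \int[nu]_x (f x * chi k x).
  apply: (cf_cvg_unif h (mfchi k) (fchiC k)) => eta eta0.
  (* The cutoff vanishes beyond k + 1. With the radius k + 2 and |x - y| < 1, a point [x] outside
     forces both values to be zero. *)
  have [r r0 fr] := @heine_itv f (k%:R + 2) (eta / 2) cf (divr_gt0 eta0 (ltr0n _ 2)).
  exists (Num.min 1 (Num.min r (eta / 2 / (C + 1)))).
    by rewrite !lt_min ltr01 r0/= !divr_gt0// ltr_wpDl.
  move=> x y; rewrite !lt_min => /and3P[xy1 xyr xye].
  have [xk|xk] := leP `|x| (k%:R + 2).
    have -> : f x * chi k x - f y * chi k y = f x * (chi k x - chi k y) + (f x - f y) * chi k y by ring.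
    rewrite (le_trans (ler_normD _ _))// [leRHS](splitr eta) lerD// normrM.
      apply: (@le_trans _ _ ((C + 1) * `|x - y|)).
        by rewrite ler_pM// ?chi_lip// (le_trans (fC x))// lerDl.
      by rewrite mulrC -ler_pdivlMr ?ltr_wpDl// ltW.
    by rewrite -[leRHS]mulr1 ler_pM// fr.
  have yk : k%:R + 1 <= `|y|.
    have := ler_distD 0 x y; rewrite subr0 sub0r normrN => _.
    have : `|x| - `|y| <= `|x - y| by exact: lerB_dist.
    move: xk xy1; lra.
  rewrite /chi !clamp0 ?mulr0 ?subrr ?normr0 ?(ltW eta0)//; first by rewrite subr_le0.
  by rewrite subr_le0; move: xk; lra.
have chi1 : (fun k => \int[nu]_x chi k x) @ \oo --> (1 : R).
  rewrite -(Rintegral_cst1 nu 1).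
  apply: (bounded_cvg_Rintegral mchi (measurable_cst (1 : R)) chi01).
  apply: aeW => x; apply: cvg_near_cst.
  apply: filterS (nbhs_infty_ger `|x|) => k xk; rewrite /chi clamp1//.
  by rewrite addrAC lerDr subr_ge0.
apply/cvgrPdist_le => eps eps0.
have C1 : 0 < C + 1 by rewrite ltr_wpDl.
have [k hk] : exists k, 1 - \int[nu]_x chi k x <= eps / 8 / (C + 1).
  move/cvgrPdist_le : chi1 => /(_ (eps / 8 / (C + 1))) H.
  have /H/filter_ex[k Hk] : 0 < eps / 8 / (C + 1) by rewrite !divr_gt0.
  by exists k; rewrite (le_trans (ler_norm _)).
have hn : \forall n \near \oo, 1 - \int[nu_ n]_x chi k x <= eps / 4 / (C + 1).
  move/cvgrPdist_le : (cvg_chi k) => /(_ (eps / 8 / (C + 1))) H.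
  have /H : 0 < eps / 8 / (C + 1) by rewrite !divr_gt0.
  apply: filterS => n Hn.
  have -> : eps / 4 / (C + 1) = eps / 8 / (C + 1) + eps / 8 / (C + 1) by field; rewrite gt_eqF.
  rewrite (le_trans _ (lerD hk (le_trans (ler_norm _) Hn)))//.
  by rewrite addrA subrK.
have hf : \forall n \near \oo, `|\int[nu]_x (f x * chi k x) - \int[nu_ n]_x (f x * chi k x)| <= eps / 2.
  by move/cvgrPdist_le : (cvg_fchi k); apply; rewrite divr_gt0.
have bnd (z : R) : z <= eps / 4 / (C + 1) -> C * z <= eps / 4.
  move=> /(ler_wpM2l C0)/le_trans; apply.
  rewrite mulrC mulrAC ler_pdivrMr// ler_wpM2l// ?lerDl//.
  by rewrite divr_ge0// ltW.
apply: filterS2 hn hf => n hn hf.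
apply: le_dist3 hf.
- apply: (le_trans (A k nu)); apply: bnd; apply: (le_trans hk).
  by rewrite ler_wpM2r ?invr_ge0 ?(ltW C1)// ler_pM2l// lef_pV2 ?posrE// ler_nat.
- by apply: (le_trans (A k (nu_ n))); exact: bnd.
Qed.

(** The indicator of the half-line lies between two ramps of slope [k], one on each side of [x].
    Both tend to the indicator away from [x], a point of [nu]-measure zero. *)
Theorem cf_cvg_cdf nu_ (nu : probability R R) (x : R) : cf_cvg nu_ nu -> nu [set x] = 0%E ->
  (fun n => fine (nu_ n `]-oo, x]%classic)) @ \oo --> fine (nu `]-oo, x]%classic).
Proof.
move=> h nux.
pose u (k : nat) (z : R) := clamp (1 + k%:R * (x - z)).
pose l (k : nat) (z : R) := clamp (k%:R * (x - z)).
pose i (z : R) := \1_(`]-oo, x]%classic) z : R.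
have iP z : i z = (z <= x)%R%:R.
  rewrite /i indicE; suff -> : (z \in `]-oo, x]%classic) = (z <= x) by [].
  by apply/idP/idP; rewrite inE/= in_itv/=.
have mi : measurable_fun setT i by exact: measurable_indic.
have mu_ k : measurable_fun setT (u k).
  apply: measurableT_comp; first exact: measurable_clamp.
  by apply: measurable_funD => //; apply: measurable_funM => //; exact: measurable_funB.
have ml_ k : measurable_fun setT (l k).
  apply: measurableT_comp; first exact: measurable_clamp.
  by apply: measurable_funM => //; exact: measurable_funB.
have c1 s : `|clamp s| <= 1 by rewrite ger0_norm ?clamp_le1 ?clamp_ge0.
have i1 z : `|i z| <= 1 by rewrite /i indicE; case: (_ \in _); rewrite ?normr1 ?normr0.
have iE (nu' : probability R R) : fine (nu' `]-oo, x]%classic) = \int[nu']_z i z.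
  by rewrite /Rintegral /i integral_indic// setIT.
have lip k s z z' : `|clamp (s + k%:R * (x - z)) - clamp (s + k%:R * (x - z'))| <= k%:R * `|z - z'|.
  rewrite (le_trans (clamp_lipschitz _ _))//.
  rewrite (_ : _ - _ = - (k%:R * (z - z'))); last by ring.
  by rewrite normrN normrM ger0_norm.
have unif (k : nat) (f : R -> R) : (forall z z', `|f z - f z'| <= k%:R * `|z - z'|) ->
  (forall eta : R, 0 < eta -> exists2 r : R, 0 < r & forall x y, `|x - y| < r -> `|f x - f y| <= eta).
  move=> fk eta eta0; exists (eta / (k%:R + 1)); first by rewrite divr_gt0// ltr_wpDl.
  move=> a b; rewrite ltr_pdivlMr ?ltr_wpDl// => /ltW; apply: le_trans.
  by rewrite (le_trans (fk a b))// mulrC ler_wpM2l// lerDl.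
have cu k : (fun n => \int[nu_ n]_z u k z) @ \oo --> \int[nu]_z u k z.
  by apply: (cf_cvg_unif h (mu_ k) (fun z => c1 _)); apply: (unif k) => z z'; exact: lip.
have cl k : (fun n => \int[nu_ n]_z l k z) @ \oo --> \int[nu]_z l k z.
  apply: (cf_cvg_unif h (ml_ k) (fun z => c1 _)); apply: (unif k) => z z'.
  by have := lip k 0 z z'; rewrite !add0r.
have il k z : l k z <= i z.
  rewrite /i indicE; case: (boolP (z \in _)) => [_|]; first exact: clamp_le1.
  rewrite notin_setE/= in_itv/= => /negP; rewrite -ltNge => xz.
  by rewrite /l clamp0// mulr_ge0_le0// subr_le0 ltW.
have iu k z : i z <= u k z.
  rewrite /i indicE; case: (boolP (z \in _)) => [|_]; last exact: clamp_ge0.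
  rewrite inE/= in_itv/= => xz.
  by rewrite /u clamp1// lerDl mulr_ge0// subr_ge0.
have aex : {ae nu, forall z, z <> x}.
  exists [set x]; split => //.
  by move=> z /= /contrapT.
have lim_u : (fun k => \int[nu]_z u k z) @ \oo --> \int[nu]_z i z.
  apply: (bounded_cvg_Rintegral mu_ mi (fun k z => c1 _)).
  apply: filterS aex => z zx; apply: cvg_near_cst.
  have [zx'|xz|//] := ltgtP z x.
    apply: nearW => k; rewrite iP ltW//.
    by rewrite /u clamp1// lerDl mulr_ge0// subr_ge0 ltW.
  apply: filterS (nbhs_infty_ger (z - x)^-1) => k.
  rewrite -div1r ler_pdivrMr ?subr_gt0// => hk.
  rewrite iP leNgt xz/=.
  by rewrite /u clamp0// -opprB mulrN subr_le0.
have lim_l : (fun k => \int[nu]_z l k z) @ \oo --> \int[nu]_z i z.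
  apply: (bounded_cvg_Rintegral ml_ mi (fun k z => c1 _)).
  apply: filterS aex => z zx; apply: cvg_near_cst.
  have [zx'|xz|//] := ltgtP z x.
    apply: filterS (nbhs_infty_ger (x - z)^-1) => k.
    rewrite -div1r ler_pdivrMr ?subr_gt0// => hk.
    rewrite iP ltW//.
    by rewrite /l clamp1.
  apply: nearW => k.
  rewrite iP leNgt xz/=.
  by rewrite /l clamp0// mulr_ge0_le0// subr_le0 ltW.
rewrite iE; under eq_fun do rewrite iE.
have Ii (nu' : probability R R) := @bounded_integrable _ _ _ nu' _ _ mi i1.
have Iu (nu' : probability R R) k := @bounded_integrable _ _ _ nu' _ _ (mu_ k) (fun z => c1 _).
have Il (nu' : probability R R) k := @bounded_integrable _ _ _ nu' _ _ (ml_ k) (fun z => c1 _).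
apply/cvgrPdist_le => eps eps0.
have e2 : 0 < eps / 2 by rewrite divr_gt0.
move/cvgrPdist_le : lim_u => /(_ _ e2)/filter_ex[k hk].
move/cvgrPdist_le : lim_l => /(_ _ e2)/filter_ex[j hj].
move/cvgrPdist_le : (cu k) => /(_ _ e2) h1.
move/cvgrPdist_le : (cl j) => /(_ _ e2).
apply: filterS2 h1 => n h1 h2.
have a1 : \int[nu_ n]_z i z <= \int[nu_ n]_z u k z by apply: (le_Rintegral measurableT (Ii _) (Iu _ k)) => z _; exact: iu.
have a2 : \int[nu_ n]_z l j z <= \int[nu_ n]_z i z by apply: (le_Rintegral measurableT (Il _ j) (Ii _)) => z _; exact: il.
move: hk hj h1 h2 a1 a2; rewrite !ler_norml.
move: (\int[nu]_z i z) (\int[nu_ n]_z i z) (\int[nu]_z u k z) (\int[nu_ n]_z u k z) (\int[nu]_z l j z) (\int[nu_ n]_z l j z).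
clear -eps; move=> a b c d e f; lra.
Qed.

(** Since [e * cauchy_kernel e 0 = 1], the atom is at most [e * cauchy_density nu e x]. By the
    Fourier representation this is an average of the characteristic function under the weight
    [e * laplace_weight e], whose unit mass escapes to infinity as [e] tends to 0. *)
Lemma cf_vanishing_no_atom (nu : probability R R) (x : R) :
  (forall delta : R, 0 < delta -> exists T0 : R, forall t, T0 <= t ->
     `|\int[nu]_z cos (t * z)| <= delta /\ `|\int[nu]_z sin (t * z)| <= delta) ->
  nu [set x] = 0%E.
Proof.
move=> H.
have nuE : (fine (nu [set x]))%:E = nu [set x] by rewrite fineK// fin_num_measure.
have nu0 : 0 <= fine (nu [set x]) by rewrite fine_ge0.
rewrite -nuE; congr EFin; apply/eqP; rewrite eq_le nu0 andbT.
have atom_le (e : R) : 0 < e -> fine (nu [set x]) <= e * cauchy_density nu e x.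
  move=> e0.
  have -> : fine (nu [set x]) = \int[nu]_z \1_[set x] z.
    by rewrite /Rintegral integral_indic// setIT.
  rewrite /cauchy_density -RintegralZl//; last exact: cauchy_kernelB_integrable.
  apply: le_Rintegral => //.
  - apply: (@bounded_integrable _ _ _ _ _ 1) => // z.
    by rewrite indicE; case: (_ \in _); rewrite ?normr1 ?normr0.
  - exact: (integrableZl _ e (cauchy_kernelB_integrable nu x e0)).
  - move=> z _; rewrite indicE; case: (boolP (z \in _)) => [|_].
      rewrite inE => ->; rewrite subrr /cauchy_kernel expr0n/= addr0 mulrA -expr2.
      by rewrite mulfV// gt_eqF// exprn_gt0.
    by rewrite mulr_ge0 ?(ltW e0)// cauchy_kernel_ge0// ltW.
(* The term [2 * delta] comes from [t] beyond [T0], the term [2 * (e * T0)] from [0, T0], where the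
   weight is at most 1. *)
have key (delta : R) : 0 < delta -> exists2 T0 : R, 0 <= T0 &
    forall e : R, 0 < e -> e * cauchy_density nu e x <= 2 * delta + 2 * (e * T0).
  move=> d0; have [T1 HT] := H _ d0; pose T0 := Num.max 0 T1.
  have T00 : 0 <= T0 by rewrite le_max lexx.
  exists T0 => // e e0.
  suff : ((e^-1 + cauchy_density nu e x)%:E <= ((1 + 2 * delta) * e^-1 + 2 * T0)%:E)%E.
    rewrite lee_fin mulrDl mul1r -addrA lerD2l -(ler_pM2l e0).
    by rewrite mulrDr mulrCA mulfV ?gt_eqF// mulr1 [e * (2 * _)]mulrCA.
  have c0 : 0 <= 1 + 2 * delta by rewrite addr_ge0// mulr_ge0// ltW.
  have w0 t : (0 <= ((1 + 2 * delta) * laplace_weight e t)%:E)%E.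
    by rewrite lee_fin mulr_ge0// laplace_weight_ge0.
  have mw : measurable_fun setT (fun t : R => ((1 + 2 * delta) * laplace_weight e t)%:E).
    by apply/measurable_EFinP; apply: measurable_funM => //; exact: measurable_laplace_weight.
  have mi : measurable_fun setT (fun t : R => (2 * \1_(`[0%R, T0]%classic) t : R)%:E).
    by apply/measurable_EFinP; apply: measurable_funM => //; exact: measurable_indic.
  have -> : (((1 + 2 * delta) * e^-1 + 2 * T0)%:E =
      \int[mu]_t (((1 + 2 * delta) * laplace_weight e t)%:E + (2 * \1_(`[0%R, T0]%classic) t : R)%:E))%E.
    rewrite ge0_integralD//; under eq_integral do rewrite EFinM.
    under [X in (_ + X)%E]eq_integral do rewrite EFinM.
    rewrite !ge0_integralZl//; try by [move=> t _; rewrite lee_fin ?laplace_weight_ge0 | apply/measurable_EFinP; exact: measurable_laplace_weight | apply/measurable_EFinP; exact: measurable_indic].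
    rewrite integral_laplace_weight// integral_indic// setIT.
    have L : lebesgue_measure (`[0%R, T0]%classic : set R) = T0%:E.
      rewrite lebesgue_measure_itv/= lte_fin; case: ltP => T0'; rewrite ?oppr0 ?adde0//.
      by have -> : T0 = 0 by apply/eqP; rewrite eq_le T0' T00.
    by rewrite [X in _ = (_ + _ * X)%E]L.
  rewrite cauchy_density_cf//.
  apply: ge0_le_integral => //.
  - move=> t _; rewrite lee_fin -lee_fin -weighted_cfE; apply: integral_ge0 => z _.
    by rewrite lee_fin mulr_ge0 ?laplace_weight_ge0// -lerBlDl sub0r cos_geN1.
  - by apply/measurable_EFinP; exact: measurable_weighted_cf.
  - exact: emeasurable_funD.
  - move=> t _; rewrite -EFinD lee_fin /weighted_cf.
    set pc := \int[nu]_z cos _; set ps := \int[nu]_z sin _.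
    have pc1 : `|pc| <= 1.
      apply: norm_Rintegral_le; first exact: measurableT_comp.
      by move=> z; rewrite ler_norml cos_geN1 cos_le1.
    have ps1 : `|ps| <= 1.
      apply: norm_Rintegral_le; first exact: measurableT_comp.
      by move=> z; rewrite ler_norml sin_geN1 sin_le1.
    have cs (b : R) : `|pc| <= b -> `|ps| <= b -> cos (t * x) * pc + sin (t * x) * ps <= 2 * b.
      move=> pb sb; rewrite mulr2n mulrDl mul1r lerD// (le_trans (ler_norm _))// normrM -[leRHS]mul1r ler_pM//.
        by rewrite ler_norml cos_geN1 cos_le1.
      by rewrite ler_norml sin_geN1 sin_le1.
    have [tT|tT] := leP T0 t.
      have T1t : T1 <= t by rewrite (le_trans _ tT)// le_max lexx orbT.
      have [pd sd] := HT t T1t.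
      apply: ler_wpDr; first by rewrite mulr_ge0.
      by rewrite mulrC ler_wpM2r ?laplace_weight_ge0// lerD2l cs.
    have [t0|t0] := leP 0 t.
      have -> : \1_(`[0%R, T0]%classic) t = 1 :> R by rewrite indicE mem_set//= in_itv/= t0 ltW.
      have w1 : laplace_weight e t <= 1.
        rewrite /laplace_weight -[leRHS]mulr1; apply: ler_pM; rewrite ?expR_ge0//.
          by rewrite -expR0 ler_expR oppr_le0 mulr_ge0// ltW.
      rewrite mulrDr mulrDl; apply: lerD.
        by rewrite mulr1 mul1r ler_wpDr// !mulr_ge0 ?laplace_weight_ge0// ltW.
      apply: (@le_trans _ _ (laplace_weight e t * (2 * 1))).
        by rewrite ler_wpM2l ?laplace_weight_ge0// cs.
      by rewrite -[leRHS]mul1r ler_wpM2r ?mulr1.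
    rewrite /laplace_weight !indicE memNset ?mulr0 ?mul0r ?add0r ?mulr_ge0//=.
    by rewrite in_itv/= andbT leNgt t0.
apply/ler_addgt0Pl => eps eps0; rewrite addr0.
have e4 : 0 < eps / 4 by rewrite divr_gt0.
have [T0 T00 hT] := key _ e4.
(* With [delta = eps / 4] and this scale, each of the two terms of [key] is at most eps / 2. *)
have e0 : 0 < eps / 4 / (T0 + 1) by rewrite divr_gt0// ltr_wpDl.
apply: (le_trans (atom_le _ e0)); apply: (le_trans (hT _ e0)).
have h : eps / 4 / (T0 + 1) * T0 <= eps / 4.
  by rewrite mulrAC ler_pdivrMr ?ltr_wpDl// ler_pM2l// lerDl.
move: h; set A := _ * T0; move: A; clear; move=> A h; lra.
Qed.

End WeakConvergence.

(** * Birkhoff's ergodic theorem *)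

Section Law.
Context {R : realType} {d d' : measure_display} {T : measurableType d} {T' : measurableType d'}.
Variables (P : probability T R) (X : T -> T') (mX : measurable_fun setT X).

Let Xm : {mfun T >-> T'} := HB.pack X (isMeasurableFun.Build _ _ _ _ X mX).

Definition law : probability T' R := distribution P Xm.

Lemma lawE A : law A = P (X @^-1` A).
Proof. by []. Qed.

Lemma ge0_integral_law (f : T' -> \bar R) : measurable_fun setT f -> (forall y, 0 <= f y)%E ->
  (\int[law]_y f y = \int[P]_x f (X x))%E.
Proof.
by move=> mf f0; rewrite (@ge0_integral_pushforward _ _ _ _ _ X mX P setT f) ?preimage_setT.
Qed.

Lemma integrable_law (f : T' -> R) : measurable_fun setT f ->
  P.-integrable setT (EFin \o (f \o X)) -> law.-integrable setT (EFin \o f).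
Proof.
move=> mf /integrableP[_ fi]; apply/integrableP; split; first exact/measurable_EFinP.
rewrite ge0_integral_law//; apply: measurableT_comp => //; exact/measurable_EFinP.
Qed.

Lemma Rintegral_law (f : T' -> R) : measurable_fun setT f ->
  P.-integrable setT (EFin \o (f \o X)) -> \int[law]_y f y = \int[P]_x f (X x).
Proof.
move=> mf fi; rewrite /Rintegral; congr fine.
by rewrite (@integral_pushforward _ _ _ _ _ X mX P setT (EFin \o f))//; exact/measurable_EFinP.
Qed.

End Law.

#[local] Lemma le_add_of_bound {R : realFieldType} (a b c e : R) : a + b + 1 <= c -> - e < b -> a <= e + c.
Proof. lra. Qed.

#[local] Lemma le_of_add_bound {R : realFieldType} (a b c e : R) : 0 <= a -> 0 <= b ->
  (a + b + 1 <= 0) || (a + b + 1 <= e + c) -> e < b -> a <= c.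
Proof. move=> a0 b0 /orP[]; lra. Qed.

#[local] Lemma norm_max_le {R : realDomainType} (a b : R) : 0 <= a -> `|Num.max (- a) b| <= `|b|.
Proof.
move=> a0; have h1 := ler_norm b; have h2 := ler_norm (- b); rewrite normrN in h2.
by rewrite ler_norml maxEle; case: ifPn; rewrite -?ltNge; move: (`|b|) h1 h2 => c; lra.
Qed.

Section Birkhoff.
Context {R : realType} {d : measure_display} {T : measurableType d}.
Variables (P : probability T R) (tau : T -> T).
Hypothesis mtau : measurable_fun setT tau.
Hypothesis tau_inv : forall A, measurable A -> P (tau @^-1` A) = P A.
Hypothesis tau_erg : forall A, measurable A -> tau @^-1` A = A -> P A = 0%E \/ P A = 1%E.

Lemma integral_comp_invariant (f : T -> \bar R) : measurable_fun setT f ->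
  (forall x, 0 <= f x)%E -> (\int[P]_x f (tau x) = \int[P]_x f x)%E.
Proof.
move=> mf f0; rewrite -(ge0_integral_law P mtau)//.
by apply: eq_measure_integral => A mA _; exact: tau_inv.
Qed.

Lemma integrable_comp_invariant (f : T -> R) : P.-integrable setT (EFin \o f) ->
  P.-integrable setT (EFin \o (f \o tau)).
Proof.
move=> /integrableP[/measurable_EFinP mf fi]; apply/integrableP; split.
  by apply/measurable_EFinP; exact: measurableT_comp.
rewrite (@integral_comp_invariant (fun x => `|(f x)%:E|)%E)//.
by apply: measurableT_comp => //; exact/measurable_EFinP.
Qed.

Lemma Rintegral_comp_invariant (f : T -> R) : P.-integrable setT (EFin \o f) ->
  \int[P]_x f (tau x) = \int[P]_x f x.
Proof.
move=> fi; have mf : measurable_fun setT f by move/integrableP: fi => [/measurable_EFinP].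
rewrite -(Rintegral_law mtau mf (integrable_comp_invariant fi)) /Rintegral.
by congr fine; apply: eq_measure_integral => A mA _; exact: tau_inv.
Qed.

(* [orbit_max f n x] is the maximum of the Birkhoff sums of [f] along the orbit of [x], over lengths 0, ..., n. *)
Fixpoint orbit_max (f : T -> R) (n : nat) (x : T) : R :=
  if n is m.+1 then Num.max 0 (f x + orbit_max f m (tau x)) else 0.

Lemma orbit_maxS f n x : orbit_max f n.+1 x = Num.max 0 (f x + orbit_max f n (tau x)).
Proof. by []. Qed.

Lemma orbit_max_ge0 f n x : 0 <= orbit_max f n x.
Proof. by case: n => [|n] /=; rewrite ?le_max ?lexx. Qed.

Lemma orbit_max_nd f n x : orbit_max f n x <= orbit_max f n.+1 x.
Proof.
elim: n x => [|n IH] x; first by rewrite orbit_max_ge0.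
rewrite [leLHS]/= [leRHS]/= le_max2//.
by rewrite lerD2l; exact: IH.
Qed.

Lemma birkhoff_sumS (f : T -> R) n x :
  \sum_(i < n.+1) f (iter i tau x) = f x + \sum_(i < n) f (iter i tau (tau x)).
Proof. by rewrite big_ord_recl /=; congr (_ + _); apply: eq_bigr => i _; rewrite -iterSr. Qed.

Lemma birkhoff_sum_le_orbit_max (f : T -> R) n x : \sum_(i < n) f (iter i tau x) <= orbit_max f n x.
Proof.
elim: n x => [|n IH] x; first by rewrite big_ord0.
by rewrite birkhoff_sumS /= le_max lerD2l IH orbT.
Qed.

Lemma measurable_orbit_max f n : measurable_fun setT f -> measurable_fun setT (orbit_max f n).
Proof.
move=> mf; elim: n => [|n IH] /=; first exact: measurable_cst.
apply: measurable_maxr => //; apply: measurable_funD => //.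
exact: measurableT_comp.
Qed.

Lemma integrable_orbit_max f n : P.-integrable setT (EFin \o f) ->
  P.-integrable setT (EFin \o orbit_max f n).
Proof.
move=> fi; have mf : measurable_fun setT f by move/integrableP: fi => [/measurable_EFinP].
elim: n => [|n IH]; first exact: integrable0.
have i1 : P.-integrable setT (EFin \o (fun x => f x + orbit_max f n (tau x))).
  exact: (integrableD measurableT fi (integrable_comp_invariant IH)).
apply: (le_integrable measurableT _ _ i1).
  by apply/measurable_EFinP; exact: (@measurable_orbit_max f n.+1).
move=> x _ /=; rewrite lee_fin ger0_norm ?le_max ?lexx//.
by rewrite ge_max normr_ge0/= ler_norm.
Qed.

(** The increment equals [f x] as soon as [orbit_max f n (tau x) >= - f x], and its modulus never
    exceeds |f x|, which provides the dominating function. *)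
Lemma orbit_max_cocycle f n x :
  orbit_max f n.+1 x - orbit_max f n (tau x) = Num.max (- orbit_max f n (tau x)) (f x).
Proof. by rewrite /= addr_maxl sub0r addrK. Qed.

(* If the Birkhoff sums of f were unbounded with positive, hence full, probability, then the cocycle
   [F_(n+1) - F_n \o tau], which has nonnegative mean and is eventually equal to f, would force the mean of f to be nonnegative. *)
Lemma negative_mean_bounded_sums f : P.-integrable setT (EFin \o f) -> \int[P]_x f x < 0 ->
  {ae P, forall x, exists M : R, forall n, \sum_(i < n) f (iter i tau x) <= M}.
Proof.
move=> fi fneg; have mf : measurable_fun setT f by move/integrableP: fi => [/measurable_EFinP].
pose F := orbit_max f.
have fB x : `|f x| < (Num.bound `|f x|)%:R by exact: archi_boundP.
have fB1 x := le_lt_trans (ler_norm _) (fB x).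
have fB2 x : - f x < (Num.bound `|f x|)%:R by rewrite (le_lt_trans (ler_norm _))// normrN.
have Fnd x : nondecreasing_seq (F ^~ x) by apply/nondecreasing_seqP => n; exact: orbit_max_nd.
pose E := \bigcap_(M in [set: nat]) \bigcup_(n in [set: nat]) [set x | M%:R <= F n x].
have mE : measurable E.
  apply: bigcapT_measurable => M; apply: bigcupT_measurable => n.
  rewrite -[X in measurable X]setTI.
  have -> : [set x | M%:R <= F n x] = F n @^-1` `[M%:R, +oo[.
    by apply/seteqP; split => x /=; rewrite in_itv/= andbT.
  exact: measurable_orbit_max.
(* Apart from the truncation at 0, [F n.+1 x] and [F n (tau x)] differ by [f x], so [x] and [tau x]
   have unbounded maxima together. Hence the thresholds shifted by a bound of |f x|. *)
have invE : tau @^-1` E = E.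
  apply/seteqP; split => x Ex M _ /=.
    have [n _ /= hn] := Ex (M + Num.bound `|f x|).+1%N I.
    exists n.+1 => //; rewrite /mkset /F orbit_maxS le_max; apply/orP; right.
    by apply: le_add_of_bound (fB2 x); move: hn; rewrite -addn1 !natrD.
  have [n _ /= hn] := Ex (M + Num.bound `|f x|).+1%N I.
  exists n => //=.
  have := le_trans hn (orbit_max_nd f n x); rewrite orbit_maxS le_max -addn1 !natrD => h.
  by apply: le_of_add_bound h (fB1 x).
have [E0|E1] := tau_erg mE invE.
  exists E; split => // x /= unb M _; apply: contrapT => h; apply: unb.
  exists M%:R => n; rewrite (le_trans (birkhoff_sum_le_orbit_max _ _ _))// leNgt.
  by apply/negP => /ltW hn; apply: h; exists n.
exfalso; move: fneg; apply/negP; rewrite -leNgt.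
pose D n x := F n.+1 x - F n (tau x).
have iD n : P.-integrable setT (EFin \o D n).
  exact: (integrableB measurableT (integrable_orbit_max n.+1 fi) (integrable_comp_invariant (integrable_orbit_max n fi))).
(* [tau] preserves integrals and the maxima increase with the length. *)
have D0 n : 0 <= \int[P]_x D n x.
  rewrite RintegralB//; [|exact: integrable_orbit_max|exact: integrable_comp_invariant (integrable_orbit_max n fi)].
  rewrite (Rintegral_comp_invariant (integrable_orbit_max n fi)) subr_ge0.
  by apply: le_Rintegral; [| exact: integrable_orbit_max.. | move=> x _; exact: orbit_max_nd].
have ifn : P.-integrable setT (EFin \o (fun x => `|f x|)) by exact: integrable_norm.
have cD : (fun n => \int[P]_x D n x) @ \oo --> \int[P]_x f x.
  apply: (dominated_cvg_Rintegral _ mf ifn).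
  - by move=> n; move/integrableP: (iD n) => [/measurable_EFinP].
  - move=> n x; rewrite /D orbit_max_cocycle.
    exact: norm_max_le (orbit_max_ge0 _ _ _).
  - exists (~` E); split; [exact: measurableC| |].
      by apply: etrans (probability_setC P mE) _; rewrite E1 subee.
    apply: subsetC => x Ex; apply: cvg_near_cst.
    rewrite -invE in Ex; have [n0 _ /= hn0] := Ex (Num.bound `|f x|) I.
    exists n0 => // n /= n0n; rewrite /D orbit_max_cocycle; apply/max_idPr.
    rewrite lerNl (le_trans (ltW (fB2 x)))// (le_trans hn0)//.
    exact: Fnd.
by apply: (cvgr_to_ge cD); apply: nearW => n; exact: D0.
Qed.

(** [negative_mean_bounded_sums] is applied to [f] and to [- f], each shifted to have mean
    [- k.+1%:R^-1]. This bounds the sums on both sides up to a constant and an error n / (k + 1). *)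
Theorem birkhoff f : P.-integrable setT (EFin \o f) ->
  {ae P, forall x, (fun n => n%:R^-1 * \sum_(i < n) f (iter i tau x)) @ \oo --> \int[P]_x f x}.
Proof.
move=> fi; set m := \int[P]_x f x.
have upper g : P.-integrable setT (EFin \o g) ->
  {ae P, forall x, forall k : nat, exists M : R, forall n,
     \sum_(i < n) g (iter i tau x) <= M + n%:R * (\int[P]_x g x + k.+1%:R^-1)}.
  move=> gi; apply/ae_foralln => k.
  pose c := \int[P]_x g x + k.+1%:R^-1.
  have ci : P.-integrable setT (EFin \o cst c).
    by apply: (@bounded_integrable _ _ _ _ _ `|c|) => //; exact: measurable_cst.
  have gci : P.-integrable setT (EFin \o (fun x => g x - c)) := integrableB measurableT gi ci.
  have neg : \int[P]_x (g x - c) < 0.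
    rewrite (RintegralB measurableT gi ci) Rintegral_cst1 /c opprD addNKr.
    by rewrite oppr_lt0 invr_gt0.
  have := negative_mean_bounded_sums gci neg; apply: filterS => x [M hM].
  exists M => n; have := hM n; rewrite sumrB sumr_const card_ord -[c *+ n]mulr_natl.
  by rewrite lerBlDr.
have fNi : P.-integrable setT (EFin \o (fun x => - f x)) := integrableN fi.
have := upper _ fi; have := upper _ fNi.
have -> : \int[P]_x (- f x) = - m.
  under eq_Rintegral do rewrite -mulN1r.
  by rewrite RintegralZl// mulN1r.
apply: filterS2 => x hN h.
apply/cvgrPdist_le => eps eps0.
have [k hk] : exists k : nat, k.+1%:R^-1 <= eps / 2.
  exists (Num.bound (eps / 2)^-1).
  rewrite invf_ple ?posrE ?divr_gt0//.
  rewrite ltW// (lt_le_trans (archi_boundP _))// ?invr_ge0 ?divr_ge0 ?ltW// ?ltr_nat//.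
have [M hM] := h k; have [M' hM'] := hN k.
near=> n.
have n0 : 0 < n%:R :> R by rewrite ltr0n; near: n; exact: nbhs_infty_gt.
(* The orbit-dependent constants [M] and [M'] are absorbed by half of [n%:R * eps]. *)
have nM : 2 * (`|M| + `|M'|) <= n%:R * eps.
  rewrite -ler_pdivrMr//; near: n; exact: nbhs_infty_ger.
have := hM n; have := hM' n; rewrite sumrN.
move: (\sum_(i < n) _) => S h1 h2.
have nk : n%:R * k.+1%:R^-1 <= n%:R * (eps / 2) by rewrite ler_pM2l.
have -> : m - n%:R^-1 * S = (n%:R * m - S) / n%:R.
  by rewrite mulrBl mulrAC mulfV ?gt_eqF// mul1r [S / _]mulrC.
rewrite normrM normfV (gtr0_norm n0) ler_pdivrMr//.
have a1 := ler_norm M; have a2 := ler_norm M'.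
move: h1 h2; rewrite !mulrDr mulrN -/m => h1 h2.
have a3 := normr_ge0 M; have a4 := normr_ge0 M'.
rewrite ler_norml [eps * _]mulrC; move: a1 a2 a3 a4 h1 h2 nk nM.
have -> : n%:R * (eps / 2) = n%:R * eps / 2 by rewrite mulrA.
move: (n%:R * eps) (n%:R / k.+1%:R) (n%:R * m) (`|M|) (`|M'|) => A B C D E; clear.
lra.
Unshelve. all: by end_near.
Qed.

End Birkhoff.

(** * Logarithmic averages of weakly correlated variables *)

Section Harmonic.
Context {R : realType}.

Definition harm (N : nat) : R := \sum_(i < N) i.+1%:R^-1.

Lemma harm0 : harm 0 = 0.
Proof. by rewrite /harm big_ord0. Qed.

Lemma harmS N : harm N.+1 = harm N + N.+1%:R^-1.
Proof. by rewrite /harm big_ord_recr. Qed.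

Lemma harm_nd : {homo harm : m n / (m <= n)%N >-> m <= n}.
Proof.
by apply/nondecreasing_seqP => n; rewrite harmS lerDl invr_ge0.
Qed.

Lemma harm_ge0 N : 0 <= harm N.
Proof. by rewrite -harm0 harm_nd. Qed.

Lemma harmS_le N : harm N.+1 <= harm N + 1.
Proof. by rewrite harmS lerD2l invf_le1 ?ler1n. Qed.

Lemma harm_unbounded (A : R) : exists N, A <= harm N.
Proof.
apply: contrapT => h; apply: (@dvg_harmonic R).
apply: nondecreasing_is_cvgn.
  apply/nondecreasing_seqP => n; rewrite /series/= big_nat_recr//= lerDl.
  exact: harmonic_ge0.
exists A => _ [n _ <-]; apply/ltW; rewrite ltNge; apply/negP => An; apply: h.
by exists n; rewrite /harm /series/= big_mkord in An *.
Qed.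

End Harmonic.

(** * From summable second moments to almost everywhere convergence *)

Section SquareSummable.
Context {R : realType} {d : measure_display} {T : measurableType d}.
Variable P : {measure set T -> \bar R}.

(** By monotone convergence the sum of the squares has a finite integral, hence is finite almost
    everywhere, and the terms of a convergent series tend to 0. *)
Lemma sum_sq_ae_cvg0 (u : nat -> T -> R) (B : R) :
  (forall k, measurable_fun setT (u k)) ->
  (forall K, (\sum_(k < K) \int[P]_x ((u k x) ^+ 2)%:E <= B%:E)%E) ->
  {ae P, forall x, u ^~ x @ \oo --> (0 : R)}.
Proof.
move=> mu uB.
pose f (k : nat) x := ((u k x) ^+ 2)%:E.
have mf k : measurable_fun setT (f k).
  by apply/measurable_EFinP; apply: measurable_funX.
have f0 k x : (0 <= f k x)%E by rewrite lee_fin sqr_ge0.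
pose g x := (\sum_(0 <= k <oo) f k x)%E.
have mg : measurable_fun setT g by apply: ge0_emeasurable_sum.
have g0 x : (0 <= g x)%E by apply: nneseries_ge0.
have ig : P.-integrable setT g.
  apply/integrableP; split => //.
  under eq_integral do rewrite gee0_abs//.
  rewrite /g integral_nneseries//.
  apply: (@le_lt_trans _ _ B%:E); last by rewrite ltry.
  apply: lime_le; first by apply: is_cvg_nneseries => n _ _; exact: integral_ge0.
  by apply: nearW => K; rewrite big_mkord.
have := integrable_ae measurableT ig; apply: filterS => x /(_ I) gfin.
have c2 : (fun k => (u k x) ^+ 2) @ \oo --> (0 : R).
  apply: cvg_series_cvg_0; apply: nondecreasing_is_cvgn.
    by apply/nondecreasing_seqP => n; rewrite /series/= big_nat_recr//= lerDl sqr_ge0.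
  exists (fine (g x)) => _ [n _ <-].
  rewrite -lee_fin fineK// /series/= -sumEFin.
  exact: (@nneseries_lim_ge _ (fun k => f k x) xpredT 0%N n (fun k _ _ => f0 k x)).
apply/cvgr0Pnorm_lt => eps eps0.
move/cvgr0Pnorm_lt : c2 => /(_ (eps ^+ 2)) H.
have /H : 0 < eps ^+ 2 by rewrite exprn_gt0.
by apply: filterS => k; rewrite normrX ltr_pXn2r ?nnegrE// ltW.
Qed.

End SquareSummable.

(** Used with [A = harm N], [a = k], [B] the value of [harm] at the k-th block start and [w] the
    modulus of the sum there. One has A - B <= 2 a + 1 <= 3 a, and 6 a <= a^2 e / 2 because a e >=
    12. *)
#[local] Lemma block_bound {R : realFieldType} (A B w a e : R) : 0 < e -> 1 <= a ->
  a ^+ 2 <= A -> A < (a + 1) ^+ 2 -> a ^+ 2 <= B -> w <= a ^+ 2 * (e / 2) -> 12 <= a * e ->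
  w + 2 * (A - B) <= A * e.
Proof.
move=> e0 a1 aA Aa aB wa ae.
nra.
Qed.

(** * Second moments and almost sure convergence of logarithmic averages *)

Section LogAverage.
Context {R : realType} {d : measure_display} {T : measurableType d}.
Variable P : probability T R.
Variables (D : nat -> T -> R) (C : R).
Hypothesis mD : forall n, measurable_fun setT (D n).
Hypothesis D2 : forall n x, `|D n x| <= 2.
Hypothesis covD : forall m n, (m <= n)%N ->
  \int[P]_x (D m x * D n x) <= C * (Num.sqrt m.+1%:R / Num.sqrt n.+1%:R).

Let W N x : R := \sum_(i < N) i.+1%:R^-1 * D i x.

Let mW N : measurable_fun setT (W N).
Proof. by apply: measurable_sum => i; apply: measurable_funM. Qed.

Let W_bounded N x : `|W N x| <= 2 * harm N.
Proof.
rewrite /W /harm mulr_sumr (le_trans (ler_norm_sum _ _ _))//; apply: ler_sum => i _.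
by rewrite normrM ger0_norm// mulrC ler_wpM2r.
Qed.

Let W_diff m n x : (m <= n)%N -> `|W n x - W m x| <= 2 * (harm n - harm m).
Proof.
move=> mn; rewrite -(subnK mn); elim: (n - m)%N => [|k IH]; first by rewrite add0n !subrr normr0 mulr0.
rewrite addSn harmS /W big_ord_recr/= -/(W _ x) addrAC [harm _ + _ - _]addrAC mulrDr.
rewrite (le_trans (ler_normD _ _))// lerD// normrM ger0_norm// mulrC ler_wpM2r//.
Qed.

(** Telescoping, from 1 / sqrt (N + 1) <= 2 (sqrt (N + 1) - sqrt N). *)
Let sqrt_sum (N : nat) : \sum_(i < N) (Num.sqrt i.+1%:R)^-1 <= 2 * Num.sqrt N%:R :> R.
Proof.
elim: N => [|N IH]; first by rewrite big_ord0 sqrtr0 mulr0.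
rewrite big_ord_recr/= (le_trans (lerD IH (lexx _)))//.
have s1 : 0 < Num.sqrt (N.+1%:R : R) by rewrite sqrtr_gt0.
have s0 : 0 <= Num.sqrt (N%:R : R) by rewrite sqrtr_ge0.
have e1 : Num.sqrt (N.+1%:R : R) ^+ 2 = N%:R + 1 by rewrite sqr_sqrtr// natr1.
have e0 : Num.sqrt (N%:R : R) ^+ 2 = N%:R by rewrite sqr_sqrtr.
rewrite -lerBrDl -mulrBr -[leLHS]mul1r ler_pdivrMr//.
move: (Num.sqrt _) (Num.sqrt _) s1 s0 e1 e0 => a b a0 b0 ha hb.
nra.
Qed.

Let intM (f g : T -> R) (B B' : R) : measurable_fun setT f -> measurable_fun setT g ->
  (forall x, `|f x| <= B) -> (forall x, `|g x| <= B') -> P.-integrable setT (EFin \o (fun x => f x * g x)).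
Proof.
move=> mf mg fB gB; apply: (@bounded_integrable _ _ _ _ _ (B * B')); first exact: measurable_funM.
by move=> x; rewrite normrM ler_pM.
Qed.

Let C0 : 0 <= C.
Proof.
have := covD (leqnn 0); rewrite sqrtr1 divr1 mulr1; apply: le_trans.
by apply: Rintegral_ge0 => x _; rewrite -expr2 sqr_ge0.
Qed.

(** The weight 1 / (i + 1) turns the correlation bound into C / (sqrt (i + 1) sqrt (N + 1)), and
    summing the first root over i < N compensates the second. *)
Let cross N : \int[P]_x (D N x * W N x) <= 2 * C.
Proof.
have -> : \int[P]_x (D N x * W N x) = \sum_(i < N) i.+1%:R^-1 * \int[P]_x (D i x * D N x).
  suff H M : \int[P]_x (D N x * W M x) = \sum_(i < M) i.+1%:R^-1 * \int[P]_x (D i x * D N x) by [].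
  rewrite /W; elim: M => [|k IH].
    by rewrite big_ord0; under eq_Rintegral do rewrite big_ord0 mulr0; rewrite Rintegral_cst1.
  rewrite big_ord_recr/= -IH -RintegralZl//; last exact: intM (mD k) (mD N) (D2 k) (D2 N).
  rewrite -RintegralD//; last 2 first.
  - exact: intM (mD N) (mW k) (D2 N) (W_bounded k).
  - exact: (integrableZl measurableT k.+1%:R^-1 (intM (mD k) (mD N) (D2 k) (D2 N))).
  by apply: eq_Rintegral => x _; rewrite big_ord_recr/= mulrDr; congr (_ + _); ring.
apply: (@le_trans _ _ (\sum_(i < N) C / Num.sqrt N.+1%:R * (Num.sqrt i.+1%:R)^-1)).
  apply: ler_sum => i _.
  rewrite (le_trans (ler_wpM2l _ (covD (ltnW (ltn_ord i)))))//.
  have s0 : Num.sqrt (i.+1%:R : R) != 0 by rewrite gt_eqF// sqrtr_gt0.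
  have sN : Num.sqrt (N.+1%:R : R) != 0 by rewrite gt_eqF// sqrtr_gt0.
  have e : (i.+1%:R : R) = Num.sqrt i.+1%:R * Num.sqrt i.+1%:R by rewrite -expr2 sqr_sqrtr.
  rewrite {1}e.
  by rewrite le_eqVlt; apply/orP; left; apply/eqP; field; rewrite s0.
rewrite -mulr_sumr (le_trans (ler_wpM2l _ (sqrt_sum N)))//; first by rewrite divr_ge0.
have -> : C / Num.sqrt N.+1%:R * (2 * Num.sqrt N%:R) = 2 * C * (Num.sqrt N%:R / Num.sqrt N.+1%:R) by ring.
rewrite ler_piMr ?mulr_ge0// ler_pdivrMr ?sqrtr_gt0// mul1r.
by rewrite ler_wsqrtr// ler_nat.
Qed.

(** Passing from N to N + 1 adds at most 2 (2 C) from the cross term and C from the square, both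
    over N + 1: hence the 5. *)
Let second_moment N : \int[P]_x (W N x ^+ 2) <= 5 * C * harm N.
Proof.
elim: N => [|N IH].
  rewrite harm0 mulr0; under eq_Rintegral do rewrite /W big_ord0 expr0n/=.
  by rewrite Rintegral_cst1.
have i1 := intM (mW N) (mW N) (W_bounded N) (W_bounded N).
have i2 := intM (mD N) (mW N) (D2 N) (W_bounded N).
have i3 := intM (mD N) (mD N) (D2 N) (D2 N).
have i2' := integrableZl measurableT (2 * N.+1%:R^-1) i2.
have i3' := integrableZl measurableT (N.+1%:R^-1 ^+ 2) i3.
have -> : \int[P]_x (W N.+1 x ^+ 2) = \int[P]_x (W N x * W N x) +
   (2 * N.+1%:R^-1 * \int[P]_x (D N x * W N x) + N.+1%:R^-1 ^+ 2 * \int[P]_x (D N x * D N x)).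
  rewrite -!RintegralZl// -RintegralD// -RintegralD//; last exact: (integrableD measurableT i2' i3').
  by apply: eq_Rintegral => x _; rewrite {1}/W big_ord_recr/= -/(W N x); ring.
rewrite harmS mulrDr lerD//.
have n1 : (N.+1%:R^-1 : R) <= 1 by rewrite invf_le1 ?ler1n.
have h2 : \int[P]_x (D N x * D N x) <= C.
  by have := covD (leqnn N); rewrite divff ?mulr1// gt_eqF// sqrtr_gt0.
have -> : 5 * C * N.+1%:R^-1 = 2 * N.+1%:R^-1 * (2 * C) + N.+1%:R^-1 * C by ring.
rewrite lerD//; first by rewrite ler_wpM2l// mulr_ge0// ltW.
apply: (@le_trans _ _ (N.+1%:R^-1 ^+ 2 * C)); first by rewrite ler_wpM2l// sqr_ge0.
by rewrite ler_wpM2r// expr2 ler_piMl// ltW.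
Qed.

(** At indices where [harm] is about k^2 the averages have second moments of order k^-2, which is
    summable. Between two such indices [W] moves by at most twice the growth of [harm], of order k,
    negligible against k^2. *)
Theorem log_average_cvg0 : {ae P, forall x, (fun N => (harm N)^-1 * W N x) @ \oo --> (0 : R)}.
Proof.
have ex k : exists N, (k%:R ^+ 2 : R) <= (harm N : R) by exact: harm_unbounded.
(* The first index at which [harm] reaches k^2. The overshoot is at most 1, the largest increment of
   [harm]. *)
pose Nk k := ex_minn (ex k).
have Nk_ge k : k%:R ^+ 2 <= (harm (Nk k) : R) by rewrite /Nk; case: ex_minnP => m mP _; exact: mP.
have Nk_le k N : k%:R ^+ 2 <= (harm N : R) -> (Nk k <= N)%N by move=> h; rewrite /Nk; case: ex_minnP => m _ mmin; exact: mmin.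
have Nk_lt k : (harm (Nk k) : R) <= k%:R ^+ 2 + 1.
  case E : (Nk k) => [|N]; first by rewrite harm0 addr_ge0// sqr_ge0.
  rewrite (le_trans (harmS_le N))// lerD2r leNgt; apply/negP => /ltW/Nk_le.
  by rewrite E ltnn.
pose u k x := (k.+1%:R ^+ 2)^-1 * W (Nk k.+1) x.
have mu k : measurable_fun setT (u k) by apply: measurable_funM.
have tele K : \sum_(k < K) (k.+1%:R ^+ 2)^-1 <= 2 - 2 * K.+1%:R^-1 :> R.
  elim: K => [|K IH]; first by rewrite big_ord0 invr1; lra.
  rewrite big_ord_recr/= (le_trans (lerD IH (lexx _)))//.
  have k1 : 1 <= (K.+1%:R : R) by rewrite ler1n.
  rewrite -[K.+2%:R]natr1; move: (K.+1%:R) k1 => a a1.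
  have a0 : 0 < a by apply: lt_le_trans a1.
  rewrite -subr_ge0.
  have -> : 2 - 2 / (a + 1) - (2 - 2 / a + (a ^+ 2)^-1) = (a - 1) / (a ^+ 2 * (a + 1)).
    by field; rewrite !gt_eqF// addr_gt0.
  by rewrite divr_ge0 ?subr_ge0// mulr_ge0 ?sqr_ge0// addr_ge0// ltW.
(* [second_moment] and the overshoot give 5 C ((k + 1)^2 + 1) <= 10 C (k + 1)^2, and the inverse
   squares sum to at most 2. *)
have uB K : (\sum_(k < K) \int[P]_x ((u k x) ^+ 2)%:E <= (20 * C)%:E)%E.
  have ik k := intM (mW (Nk k.+1)) (mW (Nk k.+1)) (W_bounded (Nk k.+1)) (W_bounded (Nk k.+1)).
  have e k : (\int[P]_x ((u k x) ^+ 2)%:E = ((k.+1%:R ^+ 2)^-1 ^+ 2 * \int[P]_x (W (Nk k.+1) x ^+ 2))%:E)%E.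
    have -> : \int[P]_x (W (Nk k.+1) x ^+ 2) = \int[P]_x (W (Nk k.+1) x * W (Nk k.+1) x) by [].
    rewrite -(RintegralZl _ measurableT (ik k)) EFin_Rintegral.
      by apply: eq_integral => x _; rewrite /u exprMn.
    exact: (integrableZl measurableT _ (ik k)).
  under eq_bigr do rewrite e; rewrite sumEFin lee_fin.
  apply: (@le_trans _ _ (\sum_(k < K) 10 * C * (k.+1%:R ^+ 2)^-1)).
    apply: ler_sum => k _; rewrite expr2 -mulrA [10 * C * _]mulrC ler_wpM2l ?invr_ge0 ?sqr_ge0//.
    rewrite ler_pdivrMl ?exprn_gt0// (le_trans (second_moment _))//.
    have -> : k.+1%:R ^+ 2 * (10 * C) = 5 * C * (k.+1%:R ^+ 2 + k.+1%:R ^+ 2) by ring.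
    rewrite ler_wpM2l ?mulr_ge0// (le_trans (Nk_lt _))// lerD2l.
    by rewrite exprn_ege1// ler1n.
  rewrite -mulr_sumr (le_trans (ler_wpM2l _ (tele K)))// ?mulr_ge0//.
  have -> : 20 * C = 10 * C * 2 by ring.
  by rewrite ler_wpM2l ?mulr_ge0// lerBlDr lerDl mulr_ge0// invr_ge0.
have := sum_sq_ae_cvg0 mu uB; apply: filterS => x ux.
apply/cvgr0Pnorm_le => eps eps0.
have e2 : 0 < eps / 2 by rewrite divr_gt0.
move/cvgr0Pnorm_le : ux => /(_ _ e2)[K0 _ hK0].
(* Beyond [K0] the subsequence is within eps / 2; beyond 12 / eps the condition [12 <= a * e] of
   [block_bound] holds. *)
pose K1 := (K0 + Num.bound (12 / eps)).+1.
have [N0 hN0] := harm_unbounded (K1%:R ^+ 2 : R).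
exists N0 => // N /= N0N.
have HN : (K1%:R ^+ 2 : R) <= harm N by rewrite (le_trans hN0)// harm_nd.
have exk : exists k : nat, harm N < (k.+1%:R ^+ 2 : R).
  exists (Num.bound (harm N : R)); rewrite (lt_le_trans (archi_boundP (harm_ge0 N)))//.
  by rewrite -natrX ler_nat expnS expn1 (leq_trans (leqnSn _))// leq_pmulr.
have [k hk1 hk2] : exists2 k : nat, k%:R ^+ 2 <= (harm N : R) & harm N < (k.+1%:R ^+ 2 : R).
  case: (ex_minnP exk) => k hk kmin; exists k => //.
  case: k hk kmin => [|k] hk kmin; first by rewrite expr0n harm_ge0.
  by rewrite leNgt; apply/negP => /kmin; rewrite ltnn.
have K1k : (K1 <= k)%N.
  have := le_lt_trans HN hk2; rewrite -!natrX ltr_nat ltn_sqr.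
  by [].
have k0 : (0 < k)%N by apply: leq_trans K1k.
have ke : 12 <= k%:R * eps.
  rewrite -ler_pdivrMr//; apply: (le_trans (ltW (archi_boundP _))); first by rewrite divr_ge0// ltW.
  by rewrite ler_nat (leq_trans _ K1k)// /K1 ltnW// ltnS leq_addl.
have kR : 0 < (k%:R : R) by rewrite ltr0n.
have uk : `|W (Nk k) x| <= k%:R ^+ 2 * (eps / 2).
  have := hK0 k.-1; rewrite /= /u prednK//.
  rewrite normrM ger0_norm ?invr_ge0 ?sqr_ge0// ler_pdivrMl ?exprn_gt0//; apply.
  by rewrite -ltnS prednK// (leq_trans _ K1k)// /K1 ltnS leq_addr.
have H0 : 0 < (harm N : R) by rewrite (lt_le_trans _ hk1)// exprn_gt0.
rewrite normrM ger0_norm ?invr_ge0 ?harm_ge0// ler_pdivrMl//.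
have d1 : `|W N x| <= `|W (Nk k) x| + 2 * (harm N - harm (Nk k)).
  rewrite -[W N x](subrK (W (Nk k) x)) addrC (le_trans (ler_normD _ _))// lerD2l.
  exact: W_diff (Nk_le _ _ hk1).
rewrite (le_trans d1)//.
have hk3 : harm N < (k%:R + 1 : R) ^+ 2 by rewrite natr1.
have k1 : 1 <= (k%:R : R) by rewrite ler1n.
by apply: (block_bound eps0 k1 hk1 hk3 (Nk_ge k) uk).
Qed.

End LogAverage.

(** * The quantile transform *)

Lemma eq_probability_cdf {R : realType} (m1 m2 : probability R R) :
  (forall x : R, m1 `]-oo, x]%classic = m2 `]-oo, x]%classic) ->
  forall A, measurable A -> m1 A = m2 A.
Proof.
move=> m12 A mA.
have GI : setI_closed (@RGenOInfty.G R).
  move=> _ _ [x ->] [y ->]; exists (Num.max x y); apply/seteqP; split => z /=; rewrite !in_itv/= !andbT gt_max.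
    by move=> [-> ->].
  by move=> /andP[].
have cov : \bigcup_(k in [set: nat]) `](- (k%:R : R)), +oo[%classic = [set: R].
  apply/seteqP; split => // x _; exists (Num.bound `|x|) => //=.
  by rewrite in_itv/= andbT ltrNl (le_lt_trans (ler_norm _))// normrN archi_boundP.
refine (@measure_unique _ R _ (@RGenOInfty.G R) (fun k : nat => `](- (k%:R : R)), +oo[%classic) _ GI _ cov m1 m2 _ _ A mA).
- exact: RGenOInfty.measurableE.
- by move=> k; exists (- k%:R).
- move=> _ [x ->]; rewrite -setCitvl.
  apply: etrans (probability_setC m1 _) _ => //; apply: etrans _ (esym (probability_setC m2 _)) => //.
  by rewrite m12.
- by move=> k; apply: (le_lt_trans (probability_le1 m1 _)); rewrite ?ltry.
Qed.

Lemma cdf_gt {R : realType} {d} {T : measurableType d} {P : probability T R} (X : {RV P >-> R}) (u : R) :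
  u < 1 -> exists x, u < fine (cdf X x).
Proof. by move=> u1; have /fine_cvg/= /cvgr_gt h := cvg_cdfy1 X; have /filter_ex := h _ u1. Qed.

Lemma cdf_lt {R : realType} {d} {T : measurableType d} {P : probability T R} (X : {RV P >-> R}) (u : R) :
  0 < u -> exists x, fine (cdf X x) < u.
Proof. by move=> u0; have /fine_cvg/= /cvgr_lt h := cvg_cdfNy0 X; have /filter_ex := h _ u0. Qed.

Section Quantile.
Context {R : realType} {d : measure_display} {T : measurableType d}.
Notation mu := (@lebesgue_measure R).
Variables (P : probability T R) (X : T -> R).
Hypothesis mX : measurable_fun setT X.
Let F (x : R) : R := fine (P [set w | X w <= x]).
Hypothesis cF : continuous F.

Let mle x : measurable [set w | X w <= x].
Proof.
have -> : [set w | X w <= x] = setT `&` X @^-1` `]-oo, x].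
  by rewrite setTI; apply/seteqP; split => w /=; rewrite in_itv.
exact: mX.
Qed.

Let FE x : P [set w | X w <= x] = (F x)%:E.
Proof. by rewrite /F fineK// fin_num_measure. Qed.

Let F01 x : 0 <= F x <= 1.
Proof. by rewrite -!lee_fin -FE measure_ge0 probability_le1. Qed.

Let F_nd x y : x <= y -> F x <= F y.
Proof.
move=> xy; rewrite -lee_fin -!FE; apply: le_measure; rewrite ?inE//.
by move=> w /= /le_trans; apply.
Qed.

Let Xm : {RV P >-> R} := HB.pack X (isMeasurableFun.Build _ _ _ _ X mX).

Let cdfE x : fine (cdf Xm x) = F x.
Proof. by rewrite /F; congr (fine (P _)); apply/seteqP; split => w /=; rewrite in_itv. Qed.

Let F_lt1 u : u < 1 -> exists x, u <= F x.
Proof. by move=> /(cdf_gt Xm)[x]; rewrite cdfE => /ltW ux; exists x. Qed.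

Let F_gt0 u : 0 < u -> exists x, F x < u.
Proof. by move=> /(cdf_lt Xm)[x]; rewrite cdfE => ux; exists x. Qed.

Lemma quantile_le u x : 0 < u -> u < 1 -> (quantile F u <= x) = (u <= F x).
Proof.
move=> u0 u1; have [x1 ux1] := F_lt1 u1; have [x0 ux0] := F_gt0 u0.
have lb : has_lbound [set x | u <= F x].
  exists x0 => y /= uy; rewrite leNgt; apply/negP => /ltW/F_nd yx0.
  by move: (le_lt_trans (le_trans uy yx0) ux0); rewrite ltxx.
have hi : has_inf [set x | u <= F x] by split => //; exists x1.
apply/idP/idP => [qx|ux]; last by apply: ge_inf.
(* It remains to see that the infimum belongs to the set: points of the set approach [q] from above
   and [F] is continuous. *)
apply: (le_trans _ (F_nd qx)); set q := quantile F u.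
apply/ler_addgt0Pl => e e0.
have /cvgrPdist_le/(_ _ e0)/nbhs_ballP[r /= r0 hr] := cF (x := q).
have [y uy yq] := inf_adherent r0 hi.
have qy : q <= y by apply: ge_inf.
have := hr y; rewrite /ball/= distrC ger0_norm ?subr_ge0//.
rewrite ltrBlDl => /(_ yq); rewrite distrC => /(le_trans (ler_norm _)).
by rewrite lerBlDr; exact: le_trans.
Qed.

(** [quantile F] is controlled on ]0, 1[ only, where [quantile_le] applies; the value 0 elsewhere
    makes [Q] measurable on the whole line. *)
Let Q (u : R) : R := if (0 < u) && (u < 1) then quantile F u else 0.

Let mQ : measurable_fun setT (Q : measurableTypeR R -> R).
Proof.
move=> mD; apply: (measurability _ (RGenOInfty.measurableE R)) => // _ [_ [x ->] <-].
rewrite setTI.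
have -> : Q @^-1` `]x, +oo[ = (`]0, 1[ `&` `]F x, +oo[) `|` (~` `]0, 1[ `&` [set _ | x < 0]).
  apply/seteqP; split => u /=; rewrite /Q !in_itv/= !andbT.
    case: ifPn => [/andP[u0 u1] xq|u01 x0]; [left|right; split => //].
      by split => //; rewrite ltNge -quantile_le// -ltNge.
  case => [[/andP[u0 u1]]|[/negP/negbTE -> //]].
  by rewrite u0 u1/= ltNge -quantile_le// -ltNge.
apply: measurableU; first exact: measurableI.
apply: measurableI; first exact: measurableC.
have -> : [set _ : R | x < 0] = if x < 0 then setT else set0.
  by case: ifP => _; apply/seteqP; split.
by case: ifP.
Qed.

Let U : probability (measurableTypeR R) R := uniform_prob (@ltr01 R).

Let UE (g : R -> \bar R) : measurable_fun setT g -> (forall x, 0 <= g x)%E ->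
  (\int[U]_x g x = \int[mu]_(x in `[0%R, 1%R]) g x)%E.
Proof.
move=> mg g0; rewrite /U integral_uniform//.
by rewrite subr0 invr1 mul1e.
Qed.

Let law_quantile A : measurable A -> law U mQ A = law P mX A.
Proof.
apply: (@eq_probability_cdf _ (law U mQ) (law P mX)) => x.
rewrite -[LHS]/(U (Q @^-1` `]-oo, x])) -[RHS]/(P (X @^-1` `]-oo, x])).
have -> : P (X @^-1` `]-oo, x]) = (F x)%:E.
  by rewrite -FE; congr (P _); apply/seteqP; split => w /=; rewrite in_itv.
have mQx : measurable (Q @^-1` `]-oo, x]) by rewrite -[X in measurable X]setTI; exact: mQ.
have -> : U (Q @^-1` `]-oo, x]) = (\int[U]_u (\1_(Q @^-1` `]-oo, x]) u)%:E)%E.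
  by rewrite integral_indic// setIT.
rewrite UE//; last first.
  by apply/measurable_EFinP; exact: measurable_indic.
rewrite integral_itv_bndoo; last first.
  by apply/measurable_EFinP; apply: measurable_funTS; exact: measurable_indic.
have /andP[F0 F1] := F01 x.
transitivity (\int[mu]_(u in `]0%R, 1%R[) (\1_(`]-oo, F x]%classic : set R) u)%:E)%E.
  apply: eq_integral => u; rewrite inE/= in_itv/= => /andP[u0 u1].
  congr EFin; rewrite !indicE; congr (_%:R).
  have -> : (u \in Q @^-1` `]-oo, x]) = (Q u <= x) by apply/idP/idP; rewrite inE/= in_itv.
  have -> : (u \in `]-oo, F x]%classic) = (u <= F x) by apply/idP/idP; rewrite inE/= in_itv.
  by rewrite /Q u0 u1/= quantile_le.
rewrite integral_indic//.
(* The intersection with ]0, 1[ is closed on the right exactly when F x < 1. *)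
have [Fx1|Fx1] := ltP (F x) 1.
  have -> : `]-oo, F x] `&` `]0, 1[ = `]0, F x]%classic :> set R.
    apply/seteqP; split => u /=; rewrite !in_itv/=.
      by move=> [-> /andP[->]].
    by move=> /andP[-> uF]; rewrite uF (le_lt_trans uF).
  apply: etrans (lebesgue_measure_itv _) _; rewrite /= lte_fin; case: ltP => [_|F0']; first by rewrite sube0.
  by congr EFin; apply/eqP; rewrite eq_le F0 F0'.
have -> : `]-oo, F x] `&` `]0, 1[ = `]0, 1[%classic :> set R.
  apply/setIidPr => u /=; rewrite !in_itv/= => /andP[_ /ltW u1].
  exact: le_trans Fx1.
apply: etrans (lebesgue_measure_itv _) _; rewrite /= lte01 sube0.
by congr EFin; apply/eqP; rewrite eq_le F1 Fx1.
Qed.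

(** A uniform variable sent through the quantile function has the law of [X]. The endpoints 0 and 1
    are null. *)
Lemma integral_quantile (g : R -> R) : measurable_fun setT g -> (forall x, 0 <= g x) ->
  (\int[mu]_(u in `[0%R, 1%R]) (g (quantile F u))%:E = \int[P]_w (g (X w))%:E)%E.
Proof.
move=> mg g0.
have mgE : measurable_fun setT (EFin \o g : R -> \bar R) by exact/measurable_EFinP.
have gE0 x : (0 <= (EFin \o g) x)%E by rewrite lee_fin.
rewrite -(ge0_integral_law P mX mgE gE0).
have -> : (\int[law P mX]_y (EFin \o g) y = \int[law U mQ]_y (EFin \o g) y)%E.
  by apply: eq_measure_integral => A mA _; exact/esym/law_quantile.
rewrite ge0_integral_law// UE//; last by apply: measurableT_comp.
have e : {in `]0, 1[%classic : set R, (fun u => (g (quantile F u))%:E) =1 (fun u => (g (Q u))%:E)}.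
  by move=> u; rewrite inE/= in_itv/= /Q => ->.
transitivity (\int[mu]_(u in `]0%R, 1%R[) (g (quantile F u))%:E)%E.
  apply: integral_itv_bndoo.
  apply: (eq_measurable_fun (fun u => (g (Q u))%:E)); first by move=> u /e.
  by apply/measurable_EFinP; apply: measurable_funTS; exact: measurableT_comp.
transitivity (\int[mu]_(u in `]0%R, 1%R[) (g (Q u))%:E)%E.
  by apply: eq_integral => u hu; exact: e.
apply/esym; apply: integral_itv_bndoo.
by apply/measurable_EFinP; apply: measurable_funTS; exact: measurableT_comp.
Qed.

End Quantile.

(** * Mixtures of stable laws *)

Section SubSigma.
Context {R : realType} {d : measure_display} {T : measurableType d}.

Lemma sub_generated_measurable (G : set (set T)) : G `<=` measurable ->
  <<s G >> `<=` @measurable _ T.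
Proof. by move=> Gm; apply: smallest_sub => //; exact: sigma_algebra_measurable. Qed.

(** The identity seen as a map to a coarser sigma-algebra; its law is the restriction of the
    probability to that sigma-algebra. *)
Lemma measurable_id_generated (G : set (set T)) : G `<=` measurable ->
  measurable_fun [set: T] (id : T -> g_sigma_algebraType G).
Proof. by move=> Gm _ A mA; rewrite setTI; exact: sub_generated_measurable mA. Qed.

Lemma measurable_fun_generated_sub d' (U : measurableType d') (G G' : set (set T)) (f : T -> U) :
  G `<=` G' -> measurable_fun [set: g_sigma_algebraType G] f ->
  measurable_fun [set: g_sigma_algebraType G'] f.
Proof. by move=> GG' mf _ A mA; exact: (sub_sigma_algebra2 GG' (mf measurableT A mA)). Qed.

Lemma measurable_fun_generated d' (U : measurableType d') (G : set (set T)) (f : T -> U) :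
  G `<=` measurable -> measurable_fun [set: g_sigma_algebraType G] f -> measurable_fun [set: T] f.
Proof. by move=> Gm mf _ A mA; exact: (sub_generated_measurable Gm (mf measurableT A mA)). Qed.

End SubSigma.

(** * Integrating out one independent stable variable *)

Section IndependentStep.
Context {R : realType} {d : measure_display} {T : measurableType d}.
Variables (P : probability T R) (G : set (set T)) (V : T -> R).
Hypothesis Gm : G `<=` measurable.
Hypothesis GI : setI_closed G.
Hypothesis GT : G setT.
Hypothesis mV : measurable_fun setT V.
Hypothesis indGV : forall A B, G A -> measurable B -> P (A `&` V @^-1` B) = (P A * P (V @^-1` B))%E.

Let TG := g_sigma_algebraType G.

Let mVB B : measurable B -> measurable (V @^-1` B).
Proof. by move=> mB; rewrite -[X in measurable X]setTI; exact: mV. Qed.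

(** Both sides are finite measures in [A], the right one being a multiple of [P], and they agree on
    the pi-system [G]. *)
Lemma indep_generated A B : <<s G >> A -> measurable B ->
  P (A `&` V @^-1` B) = (P A * P (V @^-1` B))%E.
Proof.
move=> sA mB.
have c0 : 0 <= fine (P (V @^-1` B)) by rewrite fine_ge0.
pose m2 := mscale (NngNum c0) P.
have m2E A' : m2 A' = (P A' * P (V @^-1` B))%E.
  have f1 : P (V @^-1` B) \is a fin_num by apply: fin_num_measure; exact: mVB.
  by rewrite -[LHS]/((fine (P (V @^-1` B)))%:E * P A')%E fineK// muleC.
rewrite -m2E.
apply: (@g_sigma_algebra_measure_unique _ R T G Gm (fun=> setT) (fun=> GT) _ (mrestr P (mVB mB)) m2 GI) => //.
- by rewrite bigcup_const.
- by move=> A' GA'; apply: etrans (esym (m2E A')); exact: indGV.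
- by move=> k; exact: fin_num_fun_lty.
Qed.

Let mJ : measurable_fun [set: T] (fun w => (w, V w) : TG * R).
Proof. apply: measurable_fun_pair => //; exact: measurable_id_generated. Qed.

Let PG : probability TG R := law P (measurable_id_generated Gm).
Let PV : probability R R := law P mV.

(** With the sigma-algebra generated by [G] on the first factor, the joint law of [w] and [V w] is a
    product measure; Fubini's theorem then integrates [V] with [w] frozen. *)
Lemma Rintegral_indep (f : TG * R -> R) (C : R) : measurable_fun setT f -> (forall z, `|f z| <= C) ->
  \int[P]_w f (w, V w) = \int[P]_w \int[P]_v f (w, V v).
Proof.
move=> mf fC.
have mfJ : measurable_fun setT (fun w : T => f (w, V w)) by exact: measurableT_comp mf mJ.
have iJ : P.-integrable setT (EFin \o (fun w : T => f (w, V w))) by exact: bounded_integrable mfJ (fun w => fC _).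
rewrite -(Rintegral_law mJ mf iJ).
have lawJ A : measurable A -> law P mJ A = (PG \x PV)%E A.
  move=> mA; apply/esym/product_measure_unique => // A1 A2 mA1 mA2.
  exact: (indep_generated mA1 mA2).
have intf : (PG \x PV)%E.-integrable setT (EFin \o f).
  have := integrable_law mJ mf iJ => /integrableP[mfE fi]; apply/integrableP; split => //.
  rewrite (_ : (\int[PG \x PV]_x _)%E = (\int[law P mJ]_x `|(EFin \o f) x|)%E)//.
  by apply: eq_measure_integral => A mA _; exact/esym/lawJ.
have -> : \int[law P mJ]_y f y = fine (\int[PG \x PV]_y (f y)%:E)%E.
  by rewrite /Rintegral; congr fine; apply: eq_measure_integral => A mA _; exact: lawJ.
rewrite -integral12_prod_meas1//.
have mfx (x : TG) : measurable_fun setT (fun y : R => f (x, y)) := measurable_fun_pair2 x mf.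
pose g (x : TG) : R := \int[P]_v f (x, V v).
have gE (x : TG) : (\int[PV]_y (f (x, y))%:E = (g x)%:E)%E.
  have iV : P.-integrable setT (EFin \o ((fun y => f (x, y)) \o V)).
    by apply: (bounded_integrable P _ (fun w => fC _)); exact: measurableT_comp (mfx x) mV.
  rewrite /g -(Rintegral_law mV (mfx x) iV) EFin_Rintegral//.
  exact: integrable_law (mfx x) iV.
transitivity (fine (\int[PG]_x (g x)%:E)%E).
  by congr fine; apply: eq_integral => x _; exact: gE.
have mg : measurable_fun setT g.
  apply/measurable_EFinP; have := measurable_fubini_F intf.
  by apply: eq_measurable_fun => x _; rewrite /fubini_F /= gE.
have gC x : `|g x| <= C.
  by apply: norm_Rintegral_le => //; exact: measurableT_comp (mfx x) mV.
have mgT : measurable_fun [set: T] (g : T -> R) := measurable_fun_generated Gm mg.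
have ig : P.-integrable setT (EFin \o (g \o (id : T -> TG))) := bounded_integrable P mgT gC.
by rewrite -[LHS]/(\int[PG]_x g x) (Rintegral_law (measurable_id_generated Gm) mg ig).
Qed.

Variable p : R.
Hypothesis cosV : forall t, \int[P]_w cos (t * V w) = expR (- (`|t| `^ p)).
Hypothesis sinV : forall t, \int[P]_w sin (t * V w) = 0.

Lemma integrate_out_stable (U A c : TG -> R) (C : R) : measurable_fun setT U -> measurable_fun setT A ->
  measurable_fun setT c -> (forall w, `|U w| <= C) ->
  \int[P]_w (U w * cos (A w + c w * V w)) = \int[P]_w (U w * expR (- (`|c w| `^ p)) * cos (A w)).
Proof.
move=> mU mA mc UC.
rewrite (@Rintegral_indep (fun z => U z.1 * cos (A z.1 + c z.1 * z.2)) C).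
- apply: eq_Rintegral => w _ /=.
  have mcos : measurable_fun setT (fun v => cos (c w * V v)).
    by apply: measurableT_comp => //; exact: measurable_funM.
  have msin : measurable_fun setT (fun v => sin (c w * V v)).
    by apply: measurableT_comp => //; exact: measurable_funM.
  have icos : P.-integrable setT (EFin \o (fun v => cos (c w * V v))).
    by apply: (bounded_integrable P mcos (C := 1)) => v; rewrite ler_norml cos_geN1 cos_le1.
  have isin : P.-integrable setT (EFin \o (fun v => sin (c w * V v))).
    by apply: (bounded_integrable P msin (C := 1)) => v; rewrite ler_norml sin_geN1 sin_le1.
  have i1 : P.-integrable setT (EFin \o (fun v => U w * cos (A w) * cos (c w * V v))) := integrableZl measurableT _ icos.
  have i2 : P.-integrable setT (EFin \o (fun v => U w * sin (A w) * sin (c w * V v))) := integrableZl measurableT _ isin.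
  transitivity (\int[P]_v (U w * cos (A w) * cos (c w * V v) - U w * sin (A w) * sin (c w * V v))).
    by apply: eq_Rintegral => v _; rewrite cosD; ring.
  rewrite RintegralB// !RintegralZl// cosV sinV; ring.
- apply: measurable_funM; first exact: measurableT_comp.
  apply: measurableT_comp => //; apply: measurable_funD; first exact: measurableT_comp.
  by apply: measurable_funM => //; exact: measurableT_comp.
- move=> z; rewrite normrM -[leRHS]mulr1 ler_pM//.
  by rewrite ler_norml cos_geN1 cos_le1.
Qed.

End IndependentStep.

(** * Conditioning a randomly weighted stable sum on the weights *)

Section Mixture.
Context {R : realType} {d : measure_display} {T : measurableType d}.
Variables (P : probability T R) (X : int -> T -> R) (Y : nat -> T -> R) (p : R).
Hypothesis mX : forall i, measurable_fun setT (X i).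
Hypothesis mY : forall n, measurable_fun setT (Y n).
Hypothesis indY : mutually_indep P Y.
Hypothesis indXY : indep_families P X Y.
Hypothesis cosY : forall n t, \int[P]_w cos (t * Y n w) = expR (- (`|t| `^ p)).
Hypothesis sinY : forall n t, \int[P]_w sin (t * Y n w) = 0.

Let CX (s : seq int) (A : int -> set R) := \big[setI/setT]_(i <- s) (X i @^-1` A i).
Let CY (k : nat) (B : nat -> set R) := \big[setI/setT]_(j <- iota 0 k) (Y j @^-1` B j).

(** Cylinder events on the coordinates in [s]: a family closed under intersection that generates the
    sigma-algebra of these coordinates. *)
Definition gen_X (s : seq int) : set (set T) :=
  [set C | exists A : int -> set R, (forall i, measurable (A i)) /\ C = CX s A].

(** What is known before [Y k]: the coordinates of [X] in [s] and the first [k] variables of [Y]. *)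
Let gen_XY (s : seq int) (k : nat) : set (set T) :=
  [set C | exists (A : int -> set R) (B : nat -> set R),
     [/\ forall i, measurable (A i), forall j, measurable (B j) & C = CX s A `&` CY k B]].

Let mpre d' (U : measurableType d') (f : T -> U) A : measurable_fun setT f -> measurable A -> measurable (f @^-1` A).
Proof. by move=> mf mA; rewrite -[X in measurable X]setTI; exact: mf. Qed.

Let mCX s A : (forall i, measurable (A i)) -> measurable (CX s A).
Proof. by move=> mA; apply: bigsetI_measurable => i _; exact: mpre. Qed.

Let mCY k B : (forall i, measurable (B i)) -> measurable (CY k B).
Proof. by move=> mB; apply: bigsetI_measurable => i _; exact: mpre. Qed.

Lemma gen_X_measurable s : gen_X s `<=` measurable.
Proof. by move=> _ [A [mA ->]]; exact: mCX. Qed.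

Let gen_XY_measurable s k : gen_XY s k `<=` measurable.
Proof. by move=> _ [A [B [mA mB ->]]]; apply: measurableI; [exact: mCX|exact: mCY]. Qed.

Let CXT s : CX s (fun=> setT) = setT.
Proof. by rewrite /CX big1// => i _; rewrite preimage_setT. Qed.

Let CYT k : CY k (fun=> setT) = setT.
Proof. by rewrite /CY big1// => i _; rewrite preimage_setT. Qed.

Let gen_XYI s k : setI_closed (gen_XY s k).
Proof.
move=> _ _ [A [B [mA mB ->]]] [A' [B' [mA' mB' ->]]].
exists (fun i => A i `&` A' i), (fun i => B i `&` B' i); split.
- by move=> i; exact: measurableI.
- by move=> i; exact: measurableI.
- rewrite setIACA; congr (_ `&` _).
    by rewrite /CX -big_split/=; apply: eq_bigr => i _; rewrite preimage_setI.
  by rewrite /CY -big_split/=; apply: eq_bigr => i _; rewrite preimage_setI.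
Qed.

Let gen_XYT s k : gen_XY s k setT.
Proof. by exists (fun=> setT), (fun=> setT); split => //; rewrite CXT CYT setIT. Qed.

Let gen_X_sub s k : gen_X s `<=` gen_XY s k.
Proof. by move=> _ [A [mA ->]]; exists A, (fun=> setT); split => //; rewrite CYT setIT. Qed.

Lemma measurable_gen_X s i : i \in s -> measurable_fun [set: g_sigma_algebraType (gen_X s)] (X i).
Proof.
move=> si _ B mB; rewrite setTI; apply: sub_sigma_algebra.
exists (fun j => if j == i then B else setT); split; first by move=> j; case: ifP.
apply/seteqP; split => w /=.
  move=> Bw; rewrite /CX; elim/big_ind: _ => // j _; case: ifP => [/eqP ->|] //=.
by rewrite /CX (big_rem i)//= eqxx => -[].
Qed.

Let measurable_gen_Y s k j : (j < k)%N -> measurable_fun [set: g_sigma_algebraType (gen_XY s k)] (Y j).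
Proof.
move=> jk _ B mB; rewrite setTI; apply: sub_sigma_algebra.
exists (fun=> setT), (fun i => if i == j then B else setT); split => //; first by move=> i; case: ifP.
rewrite CXT setTI; apply/seteqP; split => w /=.
  move=> Bw; rewrite /CY; elim/big_ind: _ => // i _; case: ifP => [/eqP ->|] //=.
by rewrite /CY (big_rem j) ?mem_iota//= eqxx => -[].
Qed.

(** The event on [Y k] is absorbed as one more factor of the product event on [Y], after which
    [indXY] and [indY] apply. *)
Let indep_next s k A B : gen_XY s k A -> measurable B ->
  P (A `&` Y k @^-1` B) = (P A * P (Y k @^-1` B))%E.
Proof.
move=> [A1 [B1 [mA1 mB1 ->]]] mB.
pose B2 j := if j == k then B else B1 j.
have mB2 j : measurable (B2 j) by rewrite /B2; case: ifP.
have B2k j : j \in iota 0 k -> B2 j = B1 j.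
  by rewrite mem_iota add0n /= /B2 => jk; rewrite ltn_eqF.
have B2kk : B2 k = B by rewrite /B2 eqxx.
have E : CY k B1 `&` Y k @^-1` B = CY k.+1 B2.
  rewrite /CY -addn1 iotaD big_cat/= big_seq1 add0n B2kk; congr (_ `&` _).
  by apply: eq_big_seq => j /B2k ->.
rewrite -setIA E /CX /CY !indXY// !indY ?iota_uniq// -muleA; congr (_ * _)%E.
rewrite -addn1 iotaD big_cat/= big_seq1 add0n B2kk; congr (_ * _)%E.
by apply: eq_big_seq => j /B2k ->.
Qed.

(* The constant phase [phi] covers the sine as well: [phi = - pi / 2]. *)
Theorem cos_mixture (N : nat) (s : seq int) (W : T -> R) (c : nat -> T -> R) (C phi : R) :
  measurable_fun [set: g_sigma_algebraType (gen_X s)] W ->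
  (forall i, measurable_fun [set: g_sigma_algebraType (gen_X s)] (c i)) ->
  (forall w, `|W w| <= C) ->
  \int[P]_w (W w * cos (phi + \sum_(i < N) c i w * Y i w)) =
  \int[P]_w (W w * expR (- \sum_(i < N) `|c i w| `^ p) * cos phi).
Proof.
move=> mW mc WC.
(* An interpolation: the [Y i] with i >= k are already integrated out, the others are still in the
   phase. [E N] is the left side and [E 0] the right side. *)
pose E k := \int[P]_w (W w * expR (- \sum_(k <= i < N) `|c i w| `^ p) * cos (phi + \sum_(0 <= i < k) c i w * Y i w)).
have step k : (k < N)%N -> E k.+1 = E k.
  move=> kN.
  have mG (f : T -> R) : measurable_fun [set: g_sigma_algebraType (gen_X s)] f ->
    measurable_fun [set: g_sigma_algebraType (gen_XY s k)] f by apply: measurable_fun_generated_sub; exact: gen_X_sub.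
  pose U w := W w * expR (- \sum_(k.+1 <= i < N) `|c i w| `^ p).
  pose A w := phi + \sum_(0 <= i < k) c i w * Y i w.
  have mU : measurable_fun [set: g_sigma_algebraType (gen_XY s k)] U.
    apply: measurable_funM; first exact: mG.
    apply: measurableT_comp => //; apply: measurableT_comp => //.
    apply: measurable_sum => i; apply: (measurableT_comp (measurable_powR p)).
    by apply: measurableT_comp => //; exact: mG.
  have mA : measurable_fun [set: g_sigma_algebraType (gen_XY s k)] A.
    rewrite /A (_ : (fun w => _) = (fun w => phi + \sum_(i < k) c i w * Y i w)); last by apply/funext => w; rewrite big_mkord.
    by apply: measurable_funD => //; apply: measurable_sum => i; apply: measurable_funM; [exact: mG|exact: measurable_gen_Y].
  have UC w : `|U w| <= C.
    rewrite /U normrM -[leRHS]mulr1 ler_pM// ger0_norm ?expR_ge0// -expR0 ler_expR oppr_le0.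
    by apply: sumr_ge0 => i _; exact: powR_ge0.
  have := @integrate_out_stable _ _ _ P (gen_XY s k) (Y k) (@gen_XY_measurable s k) (@gen_XYI s k) (@gen_XYT s k)
    (mY k) (fun A B => @indep_next s k A B) p (cosY k) (sinY k) U A (c k) C mU mA (mG _ (mc k)) UC.
  rewrite /E => H; transitivity (\int[P]_w (U w * cos (A w + c k w * Y k w))).
    by apply: eq_Rintegral => w _; rewrite /U /A big_nat_recr//= addrA.
  rewrite H; apply: eq_Rintegral => w _; rewrite [in RHS]big_ltn// opprD expRD /U.
  by rewrite -!mulrA; congr (_ * _); rewrite mulrCA.
have EN k : (k <= N)%N -> E k = E 0%N.
  by elim: k => // k IH kN; rewrite step// IH// ltnW.
transitivity (E N).
  by apply: eq_Rintegral => w _; rewrite [X in expR (- X)]big_geq// oppr0 expR0 mulr1 big_mkord.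
rewrite EN//; apply: eq_Rintegral => w _.
by rewrite [X in cos (_ + X)]big_geq// addr0 big_mkord.
Qed.

End Mixture.

(** * Stable integrals *)

Section LayerCake.
Context {R : realType}.

(** The sum is the integer part of [x]. The induction carries an alternative: either the count is
    within 1 of [x], or all the integers so far have been counted. *)
Lemma layer_count (x : R) (m : nat) : 0 <= x -> x <= m%:R ->
  x - 1 <= \sum_(j < m) (j.+1%:R <= x)%R%:R <= x.
Proof.
move=> x0; suff H k : [/\ \sum_(j < k) (j.+1%:R <= x)%R%:R <= x,
    \sum_(j < k) (j.+1%:R <= x)%R%:R <= (k%:R : R) &
    (x - 1 <= \sum_(j < k) (j.+1%:R <= x)%R%:R) || (k%:R <= \sum_(j < k) (j.+1%:R <= x)%R%:R :> R)].
  by move=> xm; have [h1 h2 /orP[->//|h3]] := H m; rewrite h1 andbT; lra.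
elim: k => [|k [h1 h2 h3]]; first by rewrite big_ord0 lexx orbT.
rewrite big_ord_recr/=; move: (\sum_(j < k) _) h1 h2 h3 => S h1 h2 h3.
rewrite -natr1; case: (leP (k%:R + 1) x) => kx /=; split; try lra; try (by move: h3 => /orP[]; lra).
all: apply/orP; move: h3 => /orP[] h3; try (by left; lra); by right; lra.
Qed.

End LayerCake.

(** * Pulling a bounded factor out of a conditional mean *)

Section ConditionalMean.
Context {R : realType} {d : measure_display} {T : measurableType d}.
Variables (P : probability T R) (G : set (set T)) (g : T -> R) (k : R).
Hypothesis sG : sigma_algebra setT G.
Hypothesis Gm : G `<=` measurable.
Hypothesis mg : measurable_fun setT g.
Hypothesis g1 : forall w, `|g w| <= 1.
Hypothesis condg : forall A, G A -> (\int[P]_(w in A) (g w)%:E = P A * k%:E)%E.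

Let ind (A : set T) w : R := \1_A w.

Let mind A : G A -> measurable_fun setT (ind A).
Proof. by move=> /Gm mA; exact: measurable_indic. Qed.

Let ind1 A w : `|ind A w| <= 1.
Proof. by rewrite /ind indicE; case: (_ \in _); rewrite ?normr1 ?normr0. Qed.

Let int_ind A : G A -> \int[P]_w (ind A w * g w) = k * \int[P]_w ind A w.
Proof.
move=> GA; have mA := Gm GA.
have -> : \int[P]_w ind A w = fine (P A) by rewrite /Rintegral integral_indic// setIT.
have -> : \int[P]_w (ind A w * g w) = fine (\int[P]_(w in A) (g w)%:E)%E.
  rewrite /Rintegral [in RHS]integral_mkcond; congr fine; apply: eq_integral => w _.
  by rewrite patchE /ind indicE; case: ifP => _; rewrite ?mul1r ?mul0r.
rewrite condg// -[P A]fineK ?fin_num_measure//= mulrC//.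
Qed.

Let GTT : G setT.
Proof. by case: sG => G0 GC _; rewrite -(setD0 setT); exact: GC. Qed.

Let bint (f : T -> R) C := @bounded_integrable _ _ _ P f C.

(** [condg] says that [g] has the constant conditional mean [k] given [G]. Linear combinations of
    indicators of level sets approximate [W] uniformly and carry this from events to bounded
    functions. *)
Lemma conditional_mean_pull_out (W : T -> R) :
  measurable_fun [set: g_sigma_algebraType G] W -> (forall w, `|W w| <= 1) ->
  \int[P]_w (W w * g w) = k * \int[P]_w W w.
Proof.
move=> mW W1.
have mWT : measurable_fun setT W := measurable_fun_generated Gm mW.
(* [W + 1] takes values in [0, 2] and is cut in slices of height 1 / (n + 1), hence 2 (n + 1) levels
   below. *)
pose A (n j : nat) := [set w | j.+1%:R <= n.+1%:R * (W w + 1)].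
have GA n j : G (A n j).
  have -> : A n j = (fun w : g_sigma_algebraType G => n.+1%:R * (W w + 1)) @^-1` `[j.+1%:R, +oo[.
    by apply/seteqP; split => w /=; rewrite in_itv/= andbT.
  rewrite -(sigma_algebra_id sG) -[X in <<s _ >> X]setTI.
  have : measurable_fun [set: g_sigma_algebraType G] (fun w => n.+1%:R * (W w + 1)).
    by apply: measurable_funM => //; exact: measurable_funD.
  by move=> /(_ measurableT `[j.+1%:R, +oo[%classic); apply.
pose V n w : R := n.+1%:R^-1 * \sum_(j < 2 * n.+1) ind (A n j) w - 1.
have VW n w : `|W w - V n w| <= n.+1%:R^-1.
  have := W1 w; rewrite ler_norml => /andP[w1 w2].
  have x0 : 0 <= n.+1%:R * (W w + 1) by rewrite mulr_ge0// -lerBlDr sub0r.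
  have xm : n.+1%:R * (W w + 1) <= (2 * n.+1)%:R.
    by rewrite natrM mulrC ler_pM2r//; lra.
  have := layer_count x0 xm.
  have -> : \sum_(j < 2 * n.+1) (j.+1%:R <= n.+1%:R * (W w + 1))%R%:R = \sum_(j < 2 * n.+1) ind (A n j) w.
    apply: eq_bigr => j _; rewrite /ind indicE /A.
    suff -> : (w \in [set w | j.+1%:R <= n.+1%:R * (W w + 1)]) = (j.+1%:R <= n.+1%:R * (W w + 1)) by [].
    by apply/idP/idP; rewrite inE.
  rewrite /V; move: (\sum_(j < _) _) => S /andP[h1 h2].
  have -> : W w - (n.+1%:R^-1 * S - 1) = (n.+1%:R * (W w + 1) - S) / n.+1%:R by field.
  by rewrite normrM normfV ger0_norm ?subr_ge0// ger0_norm// ler_piMl ?invr_ge0//; lra.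
have mV n : measurable_fun setT (V n).
  apply: measurable_funB => //; apply: measurable_funM => //.
  by apply: measurable_sum => j; exact: mind.
have ig : P.-integrable setT (EFin \o g) := bint mg g1.
have VE n : \int[P]_w (V n w * g w) = k * \int[P]_w V n w.
  pose c : R := n.+1%:R^-1.
  have H m : P.-integrable setT (EFin \o (fun w => \sum_(j < m) ind (A n j) w)) /\
      P.-integrable setT (EFin \o (fun w => \sum_(j < m) ind (A n j) w * g w)) /\
      \int[P]_w (\sum_(j < m) ind (A n j) w * g w) = k * \int[P]_w (\sum_(j < m) ind (A n j) w).
    elim: m => [|m [i1 [i2 IH]]].
      have z : (fun w : T => \sum_(j < 0) ind (A n j) w) = cst 0 by apply/funext => w; rewrite big_ord0.
      have z' : (fun w : T => \sum_(j < 0) ind (A n j) w * g w) = cst 0 by apply/funext => w; rewrite big_ord0.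
      rewrite z z'; split; last split; try exact: integrable0.
      by rewrite !Rintegral_cst1 mulr0.
    have z : (fun w : T => \sum_(j < m.+1) ind (A n j) w) = (fun w => \sum_(j < m) ind (A n j) w + ind (A n m) w).
      by apply/funext => w; rewrite big_ord_recr.
    have z' : (fun w : T => \sum_(j < m.+1) ind (A n j) w * g w) = (fun w => \sum_(j < m) ind (A n j) w * g w + ind (A n m) w * g w).
      by apply/funext => w; rewrite big_ord_recr.
    have j1 : P.-integrable setT (EFin \o ind (A n m)) := bint (mind (GA n m)) (@ind1 _).
    have j2 : P.-integrable setT (EFin \o (fun w => ind (A n m) w * g w)).
      apply: (@bint _ 1); first by apply: measurable_funM => //; exact: mind.
      by move=> w; rewrite normrM -[leRHS]mulr1 ler_pM.
    rewrite z z'; split; first exact: (integrableD measurableT i1 j1).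
    split; first exact: (integrableD measurableT i2 j2).
    by rewrite !RintegralD// IH int_ind// mulrDr.
  have [i1 [i2 e]] := H (2 * n.+1)%N.
  have -> : \int[P]_w (V n w * g w) = c * \int[P]_w (\sum_(j < 2 * n.+1) ind (A n j) w * g w) - \int[P]_w g w.
    rewrite -RintegralZl// -RintegralB//; last exact: (integrableZl measurableT c i2).
    by apply: eq_Rintegral => w _; rewrite /V mulrBl mul1r -mulrA mulr_suml.
  have -> : \int[P]_w V n w = c * \int[P]_w (\sum_(j < 2 * n.+1) ind (A n j) w) - 1.
    rewrite -RintegralZl// -[X in _ = _ - X](Rintegral_cst1 P) -RintegralB//.
      exact: (integrableZl measurableT c i1).
    by apply: (@bint _ 1) => // w; rewrite normr1.
  have eg : \int[P]_w g w = k.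
    transitivity (\int[P]_w (ind setT w * g w)).
      by apply: eq_Rintegral => w _; rewrite /ind indicT mul1r.
    rewrite int_ind// -[RHS]mulr1 -[X in _ = k * X](Rintegral_cst1 P); congr (k * _).
    by apply: eq_Rintegral => w _; rewrite /ind indicT.
  by rewrite e eg; ring.
have k1 n : `|\int[P]_w (W w * g w) - k * \int[P]_w W w| <= (1 + `|k|) * n.+1%:R^-1.
  have iV : P.-integrable setT (EFin \o V n).
    apply: (@bint _ (1 + n.+1%:R^-1)) => // w.
    rewrite -[V n w](subKr (W w)) (le_trans (ler_normB _ _))// lerD//.
  have iW : P.-integrable setT (EFin \o W) := bint mWT W1.
  have iWg : P.-integrable setT (EFin \o (fun w => W w * g w)).
    apply: (@bint _ 1); first by apply: measurable_funM.
    by move=> w; rewrite normrM -[leRHS]mulr1 ler_pM.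
  have iVg : P.-integrable setT (EFin \o (fun w => V n w * g w)).
    apply: (@bint _ (1 + n.+1%:R^-1)); first by apply: measurable_funM.
    move=> w; rewrite normrM -[leRHS]mulr1 ler_pM//.
    rewrite -[V n w](subKr (W w)) (le_trans (ler_normB _ _))// lerD//.
  have -> : \int[P]_w (W w * g w) - k * \int[P]_w W w =
    \int[P]_w ((W w - V n w) * g w) - k * \int[P]_w (W w - V n w).
    under [X in _ = X - _]eq_Rintegral do rewrite mulrBl.
    by rewrite (RintegralB measurableT iWg iVg) (RintegralB measurableT iW iV) VE; ring.
  rewrite (le_trans (ler_normB _ _))// mulrDl mul1r lerD//.
    apply: norm_Rintegral_le; first by apply: measurable_funM => //; exact: measurable_funB.
    by move=> w; rewrite normrM -[leRHS]mulr1 ler_pM.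
  rewrite normrM ler_wpM2l//; apply: norm_Rintegral_le => //; exact: measurable_funB.
apply/eqP; rewrite -subr_eq0 -normr_eq0 eq_le normr_ge0 andbT.
apply/ler_addgt0Pl => e e0; rewrite addr0.
apply: (le_trans (k1 (Num.bound ((1 + `|k|) / e)))).
rewrite ler_pdivrMr// -ler_pdivrMl// mulrC.
rewrite (le_trans (ltW (archi_boundP _)))// ?divr_ge0 ?(ltW e0)// ler_nat//.
Qed.

End ConditionalMean.

Section CosSinLipschitz.
Context {R : realType}.

Let lip (f df : R -> R) (a b : R) : (forall x : R, is_derive x 1 f (df x)) -> (forall x, `|df x| <= 1) ->
  `|f a - f b| <= `|a - b|.
Proof.
move=> Df d1; wlog ab : a b / a <= b.
  by move=> H; case: (leP a b) => [|/ltW] ab; [exact: H|rewrite distrC [leRHS]distrC; exact: H].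
have cf : {within `[a, b], continuous f}.
  by apply: continuous_subspaceT => x; apply: differentiable_continuous; apply/derivable1_diffP; case: (Df x).
have [c _ fE] := MVT_segment ab (fun x _ => Df x) cf.
by rewrite distrC fE normrM distrC ler_piMl.
Qed.

Lemma cos_lipschitz (a b : R) : `|cos a - cos b| <= `|a - b|.
Proof. by apply: (@lip _ (fun x => - sin x)) => x; rewrite normrN sin_max. Qed.

Lemma sin_lipschitz (a b : R) : `|sin a - sin b| <= `|a - b|.
Proof. by apply: (@lip _ cos) => x; exact: cos_max. Qed.

End CosSinLipschitz.

(** * Characteristic functions and p-th powers of step integrals *)

Section StableMotion.
Context {R : realType} {d : measure_display} {T : measurableType d}.
Variables (P : probability T R) (p : R) (F : R -> set (set T)) (M : R -> T -> R).
Hypothesis sM : stable_motion P p F M.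
Hypothesis p0 : 0 < p.

Let mM t : 0 <= t -> measurable_fun setT (M t).
Proof. by move=> t0 _ B mB; rewrite setTI; apply: (filt_sub sM t0); apply: (sm_adapted sM). Qed.

Let adM s t : 0 <= s -> s <= t -> measurable_fun [set: g_sigma_algebraType (F t)] (M s).
Proof.
move=> s0 st _ B mB; rewrite setTI; apply: sub_sigma_algebra.
by apply: (filt_incr sM s0 st); apply: (sm_adapted sM).
Qed.

Variables (n : nat) (t c : nat -> R).
Hypothesis t0 : t 0%N = 0.
Hypothesis t_incr : forall k, (k < n)%N -> t k < t k.+1.

Let t_le j k : (j <= k)%N -> (k <= n)%N -> t j <= t k.
Proof.
elim: k => [|k IH]; first by rewrite leqn0 => /eqP ->.
rewrite leq_eqVlt => /orP[/eqP -> //|]; rewrite ltnS => jk kn.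
by apply: (le_trans (IH jk (ltnW kn))); exact/ltW/t_incr.
Qed.

Let t_ge0 k : (k <= n)%N -> 0 <= t k.
Proof. by move=> kn; rewrite -t0; exact: t_le. Qed.

Lemma measurable_step_int : measurable_fun setT (step_int n t c M).
Proof.
apply: measurable_sum => k; case: (ltnP k n) => kn; last by have := ltn_ord k; rewrite ltnNge kn.
by apply: measurable_funM => //; apply: measurable_funB; apply: mM; apply: t_ge0 => //; exact: ltnW.
Qed.

(** Induction on the number of steps: the partial sum is known at time [t k], so the next increment
    factors out. The addition formulas force cosine and sine to be treated together. *)
Lemma step_int_cf (y : R) :
  \int[P]_w cos (y * step_int n t c M w) =
    expR (- (`|y| `^ p * \sum_(k < n) `|c k| `^ p * (t k.+1 - t k))) /\
  \int[P]_w sin (y * step_int n t c M w) = 0.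
Proof.
pose S k w := y * \sum_(j < k) c j * (M (t j.+1) w - M (t j) w).
suff H k : (k <= n)%N ->
   \int[P]_w cos (S k w) = expR (- (`|y| `^ p * \sum_(j < k) `|c j| `^ p * (t j.+1 - t j))) /\
   \int[P]_w sin (S k w) = 0 by exact: H.
elim: k => [_|k IH kn].
  rewrite /S big_ord0 mulr0 oppr0 expR0.
  under eq_Rintegral do rewrite big_ord0 mulr0 cos0.
  under [X in _ /\ X = _]eq_Rintegral do rewrite big_ord0 mulr0 sin0.
  by rewrite !Rintegral_cst1.
have [IHc IHs] := IH (ltnW kn).
have tk0 := t_ge0 (ltnW kn); have tk1 := t_incr kn.
pose D w := y * c k * (M (t k.+1) w - M (t k) w).
have SE w : S k.+1 w = S k w + D w by rewrite /S /D big_ord_recr/= mulrDr mulrA.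
have mD : measurable_fun setT D.
  by apply: measurable_funM => //; apply: measurable_funB; apply: mM => //; exact: t_ge0.
have mS : measurable_fun [set: g_sigma_algebraType (F (t k))] (S k).
  apply: measurable_funM => //; apply: measurable_sum => j.
  apply: measurable_funM => //; have jk := ltn_ord j.
  apply: measurable_funB; apply: adM.
  - by apply: t_ge0; rewrite (leq_trans jk)// ltnW.
  - by apply: t_le => //; exact: ltnW.
  - by apply: t_ge0; rewrite ltnW// (leq_trans jk)// ltnW.
  - by apply: t_le; exact: ltnW.
have sF := filt_sigma sM tk0; have Fm := filt_sub sM tk0.
set q := - ((t k.+1 - t k) * `|y * c k| `^ p).
have cosD1 w : `|cos (D w)| <= 1 by exact: cos_max.
have sinD1 w : `|sin (D w)| <= 1 by exact: sin_max.
have mcosD : measurable_fun setT (fun w => cos (D w)) by exact: measurableT_comp.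
have msinD : measurable_fun setT (fun w => sin (D w)) by exact: measurableT_comp.
have mcosS : measurable_fun [set: g_sigma_algebraType (F (t k))] (fun w => cos (S k w)) by exact: measurableT_comp.
have msinS : measurable_fun [set: g_sigma_algebraType (F (t k))] (fun w => sin (S k w)) by exact: measurableT_comp.
have hc A : F (t k) A -> (\int[P]_(w in A) (cos (D w))%:E = P A * (expR q)%:E)%E.
  by move=> FA; rewrite -(sm_cf_re sM _ tk0 tk1 FA).
have hs A : F (t k) A -> (\int[P]_(w in A) (sin (D w))%:E = P A * 0%:E)%E.
  by move=> FA; rewrite mule0 -(sm_cf_im sM (y * c k) tk0 tk1 FA).
have cmc W mW W1 := @conditional_mean_pull_out _ _ _ P _ _ _ sF Fm mcosD cosD1 hc W mW W1.
have cms W mW W1 := @conditional_mean_pull_out _ _ _ P _ _ _ sF Fm msinD sinD1 hs W mW W1.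
have mT (f : T -> R) : measurable_fun [set: g_sigma_algebraType (F (t k))] f -> measurable_fun [set: T] f.
  exact: measurable_fun_generated.
have i1 (f g : T -> R) : measurable_fun setT f -> measurable_fun setT g ->
   (forall w, `|f w| <= 1) -> (forall w, `|g w| <= 1) -> P.-integrable setT (EFin \o (fun w => f w * g w)).
  move=> mf mg f1 g1; apply: (@bounded_integrable _ _ _ _ _ 1); first exact: measurable_funM.
  by move=> w; rewrite normrM -[leRHS]mulr1 ler_pM.
have cosS1 w : `|cos (S k w)| <= 1 by exact: cos_max.
have sinS1 w : `|sin (S k w)| <= 1 by exact: sin_max.
have qE : expR (- (`|y| `^ p * \sum_(j < k.+1) `|c j| `^ p * (t j.+1 - t j))) =
   expR q * expR (- (`|y| `^ p * \sum_(j < k) `|c j| `^ p * (t j.+1 - t j))).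
  rewrite -expRD big_ord_recr/= /q normrM powRM//; congr expR; ring.
split.
  under eq_Rintegral do rewrite SE cosD.
  rewrite RintegralB//; [|exact: i1 (mT _ mcosS) mcosD cosS1 cosD1|exact: i1 (mT _ msinS) msinD sinS1 sinD1].
  by rewrite (cmc _ mcosS cosS1) (cms _ msinS sinS1) mul0r subr0 IHc qE.
under eq_Rintegral do rewrite SE sinD.
rewrite RintegralD//; [|exact: i1 (mT _ msinS) mcosD sinS1 cosD1|exact: i1 (mT _ mcosS) msinD cosS1 sinD1].
by rewrite (cmc _ msinS sinS1) (cms _ mcosS cosS1) mul0r addr0 IHs mulr0.
Qed.

Hypothesis t1 : t n = 1.

(** The intervals are disjoint, so at most one term is nonzero and the power passes through the sum;
    off all intervals both sides are 0 since [0 < p]. *)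
Let step_fun_pow (u : R) : `|step_fun n t c u| `^ p = \sum_(k < n) `|c k| `^ p * \1_(`]t k, t k.+1]%classic) u.
Proof.
have [[j uj]|nj] := pselect (exists j : 'I_n, `]t j, t j.+1]%classic u).
  have oth (k : 'I_n) : k != j -> (u \in `]t k, t k.+1]%classic) = false.
    move=> kj; apply/negbTE; rewrite notin_setE/= in_itv/= => /andP[h1 h2].
    move: uj; rewrite /= in_itv/= => /andP[h3 h4].
    have [kj'|jk|/val_inj e] := ltngtP k j.
    - have := t_le kj' (ltnW (ltn_ord j)); move: h2 h3; lra.
    - have := t_le jk (ltnW (ltn_ord k)); move: h1 h4; lra.
    - by rewrite e eqxx in kj.
  rewrite /step_fun (bigD1 j)//= big1 => [|k kj]; last by rewrite indicE oth// mulr0.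
  rewrite [RHS](bigD1 j)//= [X in _ = _ + X]big1 => [|k kj]; last by rewrite indicE oth// mulr0.
  by rewrite !addr0 !indicE mem_set// !mulr1.
rewrite /step_fun !big1 ?normr0 ?powR0 ?gt_eqF// => k _.
  rewrite indicE memNset ?mulr0// => h; apply: nj; by exists k.
rewrite indicE memNset ?mulr0// => h; apply: nj; by exists k.
Qed.

Lemma integral_step_fun_pow :
  (\int[lebesgue_measure]_(u in `[0%R, 1%R]) (`|step_fun n t c u| `^ p)%:E =
   (\sum_(k < n) `|c k| `^ p * (t k.+1 - t k))%:E)%E.
Proof.
under eq_integral do rewrite step_fun_pow -sumEFin.
have mI (k : 'I_n) : measurable_fun (`[0%R, 1%R] : set R) (fun u : R => `|c k| `^ p * \1_(`]t k, t k.+1]%classic) u).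
  by apply: measurable_funTS; apply: measurable_funM => //; exact: measurable_indic.
rewrite ge0_integral_sum//; last first.
  by move=> k; apply/measurable_EFinP; exact: mI.
rewrite -sumEFin; apply: eq_bigr => k _.
under eq_integral do rewrite EFinM.
rewrite ge0_integralZl//; last first.
  by apply/measurable_EFinP; apply: measurable_funTS; exact: measurable_indic.
rewrite EFinM; congr (_ * _)%E; rewrite integral_indic//.
have -> : `]t k, t k.+1] `&` `[0, 1] = `]t k, t k.+1]%classic :> set R.
  apply/setIidPl => u /=; rewrite !in_itv/= => /andP[h1 h2].
  have k0 := t_ge0 (ltnW (ltn_ord k)); have k1 : t k.+1 <= 1 by rewrite -t1; exact: t_le.
  by apply/andP; split; move: h1 h2 k0 k1; lra.
by apply: etrans (lebesgue_measure_itv _) _; rewrite /= lte_fin t_incr.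
Qed.



End StableMotion.

(** * Passing from step functions to general integrands *)

Section PowerPerturbation.
Context {R : realType}.
Variable p : R.
Hypothesis p12 : 1 <= p <= 2.

(** Convexity of the power with weights 1 - s and s at the points |x| / (1 - s) and |z| / s. It
    yields the factors (1 - s)^(1 - p) and s^(1 - p), bounded by the inverses because [p <= 2]. For
    small [s] this does the work of Minkowski's inequality. *)
Lemma powR_addr_le (x z s : R) : 0 < s < 1 ->
  `|x + z| `^ p <= (1 - s)^-1 * `|x| `^ p + s^-1 * `|z| `^ p.
Proof.
move=> /andP[s0 s1]; have [p1 p2] := andP p12.
have p0 : 0 <= p by exact: le_trans p1.
have s1' : 0 < 1 - s by rewrite subr_gt0.
pose u := `|x| / (1 - s); pose v := `|z| / s.
have u0 : 0 <= u by rewrite divr_ge0// ltW.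
have v0 : 0 <= v by rewrite divr_ge0// ltW.
have e1 : (1 - s) * u = `|x| by rewrite /u; field; rewrite gt_eqF.
have e2 : s * v = `|z| by rewrite /v; field; rewrite gt_eqF.
have B (a : R) (w : R) : 0 < a -> a <= 1 -> 0 <= w -> a * (w / a) `^ p <= a^-1 * w `^ p.
  move=> a0 a1 w0; have ai0 : 0 <= a^-1 by rewrite invr_ge0 ltW.
  rewrite powRM// mulrCA [a^-1 * _]mulrC.
  apply: ler_wpM2l; first exact: powR_ge0.
  rewrite -ler_pdivlMl// -expr2 -powR_mulrn//.
  by apply: ler_powR => //; rewrite invf_ge1.
have b2 := B _ _ s0 (ltW s1) (normr_ge0 z).
have b1 : (1 - s) * u `^ p <= (1 - s)^-1 * `|x| `^ p.
  by apply: B => //; rewrite lerBlDr lerDl ltW.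
apply: le_trans (lerD b1 b2).
have := @convex_powR R p p1 (Itv01 (ltW s0) (ltW s1)) v u.
rewrite !convRE/= !inE/= !in_itv/= !andbT => /(_ v0 u0) cv.
apply: (@le_trans _ _ (((1 - s) * u + s * v) `^ p)).
  apply: ge0_ler_powR => //; rewrite ?nnegrE//.
    by apply: addr_ge0; apply: mulr_ge0 => //; exact: ltW.
  by rewrite e1 e2 ler_normD.
by rewrite addrC [leRHS]addrC; exact: cv.
Qed.

End PowerPerturbation.

(** First [s] is small relative to [b], so that [(1 - s)^-1] costs little; then [eta] is small
    relative to [s], to absorb the factor [s^-1]. *)
#[local] Lemma squeeze_tolerance {R : realFieldType} (b e : R) : 0 <= b -> 0 < e ->
  exists s eta : R, [/\ 0 < s < 1, 0 < eta &
    forall x E : R, 0 <= x -> E <= eta -> x <= (1 - s)^-1 * b + s^-1 * E ->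
      b <= (1 - s)^-1 * x + s^-1 * E -> `|b - x| <= e].
Proof.
move=> b0 e0; pose q := 4 * (2 * b + 2 + e); pose s := e / q.
have q0 : 0 < q by rewrite /q; lra.
have s0 : 0 < s by rewrite divr_gt0.
have se : s * q = e by rewrite /s; field; rewrite gt_eqF.
have s14 : s <= 1 / 4 by rewrite /s ler_pdivrMr// /q; lra.
exists s, (s * (e / 4)); split; [by move: s0 s14; lra|by rewrite mulr_gt0// divr_gt0|].
move=> x E x0 Ee u1 u2.
have sE : s^-1 * E <= e / 4 by rewrite ler_pdivrMl.
have is0 : (1 - s)^-1 <= 1 + 2 * s.
  by rewrite -[leLHS]mul1r ler_pdivrMr//; move: s0 s14; clear; nra.
have t1 : (1 - s)^-1 * b <= (1 + 2 * s) * b by rewrite ler_wpM2r.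
have t2 : (1 - s)^-1 * x <= (1 + 2 * s) * x by rewrite ler_wpM2r.
have sb : s * b <= e / 8 by move: se s0 e0 b0; rewrite /q; clear; nra.
have v1 : x <= b + e / 2 by move: u1 t1 sb sE; clear; lra.
have sx : s * x <= e / 4.
  apply: (@le_trans _ _ (s * (b + e / 2))); first by rewrite ler_wpM2l// ltW.
  by move: sb s14 s0 e0; clear; nra.
have v2 : b <= x + e by move: u2 t2 sx sE e0; clear; lra.
by rewrite ler_norml; apply/andP; split; move: v1 v2 e0; clear; lra.
Qed.

Section StableIntegral.
Context {R : realType} {d : measure_display} {T : measurableType d}.
Variables (P : probability T R) (p : R) (F : R -> set (set T)) (M : R -> T -> R).
Variables (g : R -> R) (Z : T -> R).
Hypothesis sM : stable_motion P p F M.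
Hypothesis sZ : stable_integral P p M g Z.
Hypothesis p12 : 1 <= p <= 2.
Hypothesis mg : measurable_fun (`[0%R, 1%R]%classic : set R) g.
Variable b : R.
Hypothesis gb : (\int[lebesgue_measure]_(u in `[0%R, 1%R]%classic) (`|g u| `^ p)%:E = b%:E)%E.

(** [powR_addr_le] is applied to f = g + (f - g) and to g = f + (g - f). *)
Lemma cvg_powR_integral (f : nat -> R -> R) (a : nat -> R) :
  (forall m, measurable_fun (`[0%R, 1%R]%classic : set R) (f m)) ->
  (forall m, \int[lebesgue_measure]_(u in `[0%R, 1%R]%classic) (`|f m u| `^ p)%:E = (a m)%:E)%E ->
  (fun m => (\int[lebesgue_measure]_(u in `[0%R, 1%R]%classic) (`|f m u - g u| `^ p)%:E)%E) @ \oo --> 0%E ->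
  a @ \oo --> b.
Proof.
move=> mf af fg; have mI : measurable (`[0%R, 1%R]%classic : set R) by [].
have mp (k : R -> R) : measurable_fun (`[0%R, 1%R]%classic : set R) k ->
    measurable_fun (`[0%R, 1%R]%classic : set R) (fun u : R => (`|k u| `^ p)%:E).
  move=> mk; apply/measurable_EFinP.
  by apply: measurableT_comp (measurable_powR p) _; exact: measurableT_comp.
have b0 : 0 <= b by rewrite -lee_fin -gb; apply: integral_ge0 => u _; rewrite lee_fin powR_ge0.
have a0 m : 0 <= a m by rewrite -lee_fin -af; apply: integral_ge0 => u _; rewrite lee_fin powR_ge0.
have main (k1 k2 : R -> R) (A E : R) (s : R) : 0 < s < 1 ->
    measurable_fun (`[0%R, 1%R]%classic : set R) k1 -> measurable_fun (`[0%R, 1%R]%classic : set R) k2 ->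
    (\int[lebesgue_measure]_(u in `[0%R, 1%R]%classic) (`|k1 u| `^ p)%:E = A%:E)%E ->
    (\int[lebesgue_measure]_(u in `[0%R, 1%R]%classic) (`|k2 u| `^ p)%:E = E%:E)%E ->
    (\int[lebesgue_measure]_(u in `[0%R, 1%R]%classic) (`|k1 u + k2 u| `^ p)%:E <= ((1 - s)^-1 * A + s^-1 * E)%:E)%E.
  move=> /andP[s0 s1] m1 m2 A1 E2; rewrite EFinD !EFinM -A1 -E2.
  have s1' : 0 <= (1 - s)^-1 by rewrite invr_ge0 subr_ge0 ltW.
  have s0' : 0 <= s^-1 by rewrite invr_ge0 ltW.
  rewrite -ge0_integralZl//; last exact: mp.
  rewrite -ge0_integralZl//; last exact: mp.
  rewrite -ge0_integralD//.
  - apply: ge0_le_integral => //.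
    + by apply: mp; exact: measurable_funD.
    + by apply: emeasurable_funD; apply: emeasurable_funM => //; exact: mp.
    + by move=> u _; rewrite -!EFinM -EFinD lee_fin; apply: powR_addr_le => //; exact/andP.
  - by move=> u _; rewrite mule_ge0 ?lee_fin ?powR_ge0.
  - by apply: emeasurable_funM => //; exact: mp.
  - by move=> u _; rewrite mule_ge0 ?lee_fin ?powR_ge0.
  - by apply: emeasurable_funM => //; exact: mp.
have /fine_cvgP[finE cvE] := fg.
pose E m := fine (\int[lebesgue_measure]_(u in `[0%R, 1%R]%classic) (`|f m u - g u| `^ p)%:E)%E.
have up (s : R) : 0 < s < 1 -> \forall m \near \oo,
    a m <= (1 - s)^-1 * b + s^-1 * E m /\ b <= (1 - s)^-1 * a m + s^-1 * E m.
  move=> s01; apply: filterS finE => m fm.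
  have Em : (\int[lebesgue_measure]_(u in `[0%R, 1%R]%classic) (`|f m u - g u| `^ p)%:E)%E = (E m)%:E.
    by rewrite fineK.
  have mfg : measurable_fun (`[0%R, 1%R]%classic : set R) (fun u => f m u - g u) by exact: measurable_funB.
  have mgf : measurable_fun (`[0%R, 1%R]%classic : set R) (fun u => g u - f m u) by exact: measurable_funB.
  split.
    have := main _ _ _ _ _ s01 mg mfg gb Em.
    by under eq_integral do rewrite addrC subrK; rewrite af lee_fin.
  have Em' : (\int[lebesgue_measure]_(u in `[0%R, 1%R]%classic) (`|g u - f m u| `^ p)%:E)%E = (E m)%:E.
    by rewrite -Em; apply: eq_integral => u _; rewrite distrC.
  have := main _ _ _ _ _ s01 (mf m) mgf (af m) Em'.
  by under eq_integral do rewrite addrC subrK; rewrite gb lee_fin.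
apply/cvgrPdist_le => e e0.
have [s [eta [s01 eta0 H]]] := squeeze_tolerance b0 e0.
have Enear : \forall m \near \oo, `|0 - E m| <= eta by move/cvgrPdist_le : cvE => /(_ _ eta0).
near=> m.
have [u1 u2] : a m <= (1 - s)^-1 * b + s^-1 * E m /\ b <= (1 - s)^-1 * a m + s^-1 * E m.
  by near: m; exact: up.
apply: H (a0 m) _ u1 u2.
have : `|0 - E m| <= eta by near: m.
by rewrite sub0r normrN => /(le_trans (ler_norm _)).
Unshelve. all: by end_near.
Qed.

(** The step integrals have explicit characteristic functions and tend to [Z] in probability, which
    suffices for means of bounded Lipschitz functions. *)
Lemma stable_integral_cf (y : R) :
  \int[P]_w cos (y * Z w) = expR (- (`|y| `^ p * b)) /\ \int[P]_w sin (y * Z w) = 0.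
Proof.
have [mZ [n [t [c [ht [hint hprob]]]]]] := sZ.
have p0 : 0 < p by move: p12 => /andP[+ _]; exact: lt_le_trans.
have t0 m : t m 0%N = 0 by have [] := ht m.
have t1 m : t m (n m) = 1 by have [_ []] := ht m.
have ti m k : (k < n m)%N -> t m k < t m k.+1 by have [_ [_ +]] := ht m; exact.
pose a m := \sum_(k < n m) `|c m k| `^ p * (t m k.+1 - t m k).
pose S m := step_int (n m) (t m) (c m) M.
have mS m : measurable_fun setT (S m) := measurable_step_int sM (c m) (t0 m) (@ti m).
have ab : a @ \oo --> b.
  apply: (@cvg_powR_integral (fun m => step_fun (n m) (t m) (c m)) a _ _ hint) => m.
    2: exact: (integral_step_fun_pow p0 (c m) (t0 m) (@ti m) (t1 m)).
  apply: measurable_funTS; apply: measurable_sum => k.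
  by apply: measurable_funM => //; exact: measurable_indic.
have key (f : R -> R) : (forall u, `|f u| <= 1) -> (forall u v, `|f u - f v| <= `|u - v|) ->
    measurable_fun setT f -> (fun m => \int[P]_w f (y * S m w)) @ \oo --> \int[P]_w f (y * Z w).
  move=> f1 fl mf.
  have mfS m : measurable_fun setT (fun w => f (y * S m w)).
    by apply: measurableT_comp => //; exact: measurable_funM.
  have mfZ : measurable_fun setT (fun w => f (y * Z w)).
    by apply: measurableT_comp => //; exact: measurable_funM.
  have if1 (k : T -> R) : measurable_fun setT k -> (forall w, `|k w| <= 1) -> P.-integrable setT (EFin \o k).
    by move=> mk k1; exact: (bounded_integrable P mk k1).
  apply/cvgrPdist_le => e e0.
  (* Off [A m] the Lipschitz bound gives |y| eps <= e / 2; on [A m] the difference is at most 2, and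
     P (A m) is eventually at most e / 4. *)
  pose eps := e / (2 * (`|y| + 1)).
  have eps0 : 0 < eps by rewrite divr_gt0// mulr_gt0.
  pose A m := [set w | eps < `|S m w - Z w|].
  have mA m : measurable (A m).
    rewrite /A -[X in measurable X]setTI.
    have mh : measurable_fun setT (fun w => `|S m w - Z w|).
      by apply: measurableT_comp => //; exact: measurable_funB.
    have := mh measurableT `]eps, +oo[%classic (measurable_itv _).
    by congr measurable; congr (_ `&` _); apply/seteqP; split => w /=; rewrite in_itv/= andbT.
  have /fine_cvgP[_ /cvgrPdist_le/(_ (e / 4) ltac:(by rewrite divr_gt0))] := hprob _ eps0.
  apply: filterS => m /=; rewrite sub0r normrN => PA.
  rewrite -(RintegralB measurableT (if1 _ mfZ (fun w => f1 _)) (if1 _ (mfS m) (fun w => f1 _))).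
  have mD : measurable_fun setT (fun w => f (y * Z w) - f (y * S m w)) by exact: measurable_funB.
  have iD : P.-integrable setT (EFin \o (fun w => f (y * Z w) - f (y * S m w))).
    apply: (@bounded_integrable _ _ _ P _ 2 mD) => w.
    by rewrite (le_trans (ler_normB _ _))// -[leRHS]/(1 + 1) lerD.
  have mB : measurable_fun setT (fun w => e / 2 + 2 * \1_(A m) w : R).
    by apply: measurable_funD => //; apply: measurable_funM => //; exact: measurable_indic.
  have iB : P.-integrable setT (EFin \o (fun w => e / 2 + 2 * \1_(A m) w : R)).
    apply: (@bounded_integrable _ _ _ P _ (e/2 + 2) mB) => w.
    rewrite ger0_norm ?addr_ge0 ?divr_ge0 ?mulr_ge0 ?(ltW e0)// lerD2l.
    by rewrite indicE; case: (_ \in _); rewrite ?mulr1 ?mulr0.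
  have h : `|\int[P]_w (f (y * Z w) - f (y * S m w))| <= \int[P]_w (e / 2 + 2 * \1_(A m) w).
    apply: le_trans (le_normr_Rintegral measurableT iD) _.
    apply: le_Rintegral => //; first exact: (integrable_norm iD).
    move=> w _; have [wA|wA] := boolP (w \in A m); rewrite indicE.
      rewrite wA mulr1 (le_trans (ler_normB _ _))// (le_trans (lerD (f1 _) (f1 _)))//.
      by rewrite -[leLHS]/(1 + 1) -[X in _ <= _ + X]/(1 + 1) lerDr divr_ge0// ltW.
    rewrite (negbTE wA) mulr0 addr0 (le_trans (fl _ _))// -mulrBr normrM distrC.
    move: wA; rewrite notin_setE/= => /negP; rewrite -leNgt => wA.
    apply: (@le_trans _ _ (`|y| * eps)); first exact: ler_wpM2l.
    rewrite /eps mulrA ler_pdivrMr ?mulr_gt0//.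
    have ->: e / 2 * (2 * (`|y| + 1)) = e * (`|y| + 1) by field.
    by rewrite mulrC ler_wpM2l ?(ltW e0)// lerDl.
  apply: (le_trans h).
  have i1 : P.-integrable setT (EFin \o (fun=> e / 2 : R)).
    by apply: (@bounded_integrable _ _ _ P _ `|e / 2|).
  have i2 : P.-integrable setT (EFin \o (fun w => \1_(A m) w : R)).
    apply: (@bounded_integrable _ _ _ P _ 1); first exact: measurable_indic.
    by move=> w; rewrite indicE; case: (_ \in _); rewrite ?normr1 ?normr0.
  have i3 : P.-integrable setT (EFin \o (fun w => 2 * \1_(A m) w : R)).
    exact: (integrableZl measurableT 2 i2).
  rewrite (RintegralD measurableT i1 i3) (RintegralZl 2 measurableT i2) Rintegral_cst1.
  have -> : \int[P]_w \1_(A m) w = fine (P (A m)) by rewrite /Rintegral integral_indic// setIT.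
  have := le_trans (ler_norm _) PA; rewrite -/(A m).
  by clear; move: (fine _) => q; lra.
have cSm m : \int[P]_w cos (y * S m w) = expR (- (`|y| `^ p * a m)).
  by have [] := step_int_cf sM (c m) (t0 m) (@ti m) y.
have sSm m : \int[P]_w sin (y * S m w) = 0.
  by have [] := step_int_cf sM (c m) (t0 m) (@ti m) y.
split.
  have h1 := key cos (@cos_max R) (@cos_lipschitz R) (@measurable_cos R).
  rewrite (funext cSm) in h1.
  apply: (cvg_unique _ h1); first exact: Rhausdorff.
  apply: continuous_cvg; first exact: continuous_expR.
  by apply: cvgN; apply: cvgM => //; exact: cvg_cst.
have h1 := key sin (@sin_max R) (@sin_lipschitz R) (@measurable_sin R).
rewrite (funext sSm) in h1.
by apply: (cvg_unique _ h1); [exact: Rhausdorff|exact: cvg_cst].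
Qed.

End StableIntegral.

(** * Correlations of the normalised sums *)

Section PowerBounds.
Context {R : realType}.
Variable p : R.
Hypothesis p12 : 1 < p < 2.

Lemma powR_le_id (x : R) : 0 <= x <= 1 -> x `^ p <= x.
Proof.
move=> /andP[x0 x1]; have [p1 p2] := andP p12.
have [->|xn0] := eqVneq x 0; first by rewrite powR0// gt_eqF// (lt_trans _ p1).
rewrite -[leRHS]powRr1//; apply: ger_powR; last exact: ltW.
by rewrite x1 andbT lt_neqAle eq_sym xn0.
Qed.

(** The power lies between 1 and (1 + x)^2 <= 1 + 3 x, and 0 <= x^p <= x. *)
Lemma powR_1Dx_dist (x : R) : 0 <= x <= 1 -> `|(1 + x) `^ p - (1 + x `^ p)| <= 3 * x.
Proof.
move=> x01; have [x0 x1] := andP x01; have [p1 p2] := andP p12.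
have h1 := powR_le_id x01; have h2 := powR_ge0 x p.
have h3 : (1 + x) `^ p <= (1 + x) ^+ 2.
  by rewrite -powR_mulrn ?addr_ge0//; apply: ler_powR; [rewrite lerDl|exact: ltW].
have h4 : 1 <= (1 + x) `^ p.
  by rewrite -[leLHS](powRr0 (1 + x)); apply: ler_powR; [rewrite lerDl|exact/ltW/(lt_trans _ p1)].
by rewrite ler_norml; apply/andP; split; move: h1 h2 h3 h4 x0 x1; clear; nra.
Qed.

Lemma powR_1Bx_dist (x : R) : 0 <= x <= 1 -> `|(1 - x) `^ p - (1 + x `^ p)| <= 3 * x.
Proof.
move=> x01; have [x0 x1] := andP x01; have [p1 p2] := andP p12.
have h1 := powR_le_id x01; have h2 := powR_ge0 x p.
have y01 : 0 <= 1 - x <= 1 by rewrite subr_ge0 x1 lerBlDr lerDl.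
have h3 := powR_le_id y01.
have h4 : (1 - x) ^+ 2 <= (1 - x) `^ p.
  have [->|xn1] := eqVneq x 1.
    by rewrite subrr expr2 mulr0 powR_ge0.
  have [y0 y1] := andP y01.
  rewrite -powR_mulrn//; apply: ger_powR; last exact: ltW.
  by rewrite y1 andbT lt_neqAle y0 andbT eq_sym subr_eq0 eq_sym.
by rewrite ler_norml; apply/andP; split; move: h1 h2 h3 h4 x0 x1; clear; nra.
Qed.

Lemma expRN_lipschitz (a b : R) : 0 <= a -> 0 <= b -> expR (- a) - expR (- b) <= `|a - b|.
Proof.
move=> a0 b0; case: (leP b a) => ab.
  apply: (@le_trans _ _ 0); last exact: normr_ge0.
  by rewrite subr_le0 ler_expR lerN2.
rewrite distrC ger0_norm ?subr_ge0 ?(ltW ab)//.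
have -> : expR (- b) = expR (- a) * expR (a - b) by rewrite -expRD; congr expR; ring.
have h1 := expR_ge1Dx (a - b).
have h2 : expR (- a) <= 1 by rewrite -expR0 ler_expR oppr_le0.
have h3 := expR_ge0 (- a).
move: (expR (a - b)) h1 => u h1; move: (expR (- a)) h2 h3 => v h2 h3.
by move: ab h1 h2 h3; clear; nra.
Qed.

End PowerBounds.

#[local] Lemma half_sum_le {R : realFieldType} (u v q k : R) : v - q <= k -> u - q <= k ->
  2^-1 * (u + v) - (q + q - q) <= k.
Proof. lra. Qed.

#[local] Lemma half_sub_le {R : realFieldType} (u v q k : R) : - k <= v - q -> v - q <= k ->
  - k <= u - q -> u - q <= k -> 2^-1 * (v - u) <= k.
Proof. lra. Qed.

(** * Conditional laws and covariances of the normalised sums *)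

Section Randomized.
Context {R : realType} {d : measure_display} {T : measurableType d}.
Variables (P : probability T R) (X : int -> T -> R) (Y : nat -> T -> R) (p : R).
Hypothesis mX : forall i, measurable_fun setT (X i).
Hypothesis mY : forall n, measurable_fun setT (Y n).
Hypothesis indY : mutually_indep P Y.
Hypothesis indXY : indep_families P X Y.
Hypothesis p12 : 1 < p < 2.
Hypothesis cosY : forall n t, \int[P]_w cos (t * Y n w) = expR (- (`|t| `^ p)).
Hypothesis sinY : forall n t, \int[P]_w sin (t * Y n w) = 0.
Variable h : R -> R.
Hypothesis mh : measurable_fun setT h.

Let p0 : 0 < p. Proof. by move: p12 => /andP[/(lt_trans ltr01)]. Qed.

Let H (i : nat) w := h (X (Posz i.+1) w).
Let gen N := gen_X X [seq Posz i.+1 | i <- iota 0 N].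

Definition randomized_sum (n : nat) (w : T) : R :=
  (n%:R `^ p^-1)^-1 * \sum_(i < n) H i w * Y i w.

Definition power_mean (n : nat) (w : T) : R := n%:R^-1 * \sum_(i < n) `|H i w| `^ p.

Let I := randomized_sum.
Let a := power_mean.

Let mH i N : (i < N)%N -> measurable_fun [set: g_sigma_algebraType (gen N)] (H i).
Proof.
move=> iN; apply: measurableT_comp => //; apply: measurable_gen_X.
by apply/mapP; exists i => //; rewrite mem_iota.
Qed.

Let ma n N : (n <= N)%N -> measurable_fun [set: g_sigma_algebraType (gen N)] (a n).
Proof.
move=> nN; apply: measurable_funM => //; apply: measurable_sum => i.
apply: (measurableT_comp (measurable_powR p)); apply: measurableT_comp => //.
by apply: mH; rewrite (leq_trans (ltn_ord i)).
Qed.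

Let genT N (f : T -> R) : measurable_fun [set: g_sigma_algebraType (gen N)] f -> measurable_fun setT f.
Proof. by apply: measurable_fun_generated; exact: gen_X_measurable. Qed.

Lemma measurable_power_mean n : measurable_fun setT (a n).
Proof. exact: (genT (ma (leqnn n))). Qed.

Lemma measurable_randomized_sum n : measurable_fun setT (I n).
Proof.
apply: measurable_funM => //; apply: measurable_sum => i; apply: measurable_funM => //.
by apply: (genT (@mH _ i.+1 _)).
Qed.

Lemma power_mean_ge0 n w : 0 <= a n w.
Proof. by rewrite mulr_ge0// ?invr_ge0// sumr_ge0// => i _; exact: powR_ge0. Qed.

Let cos_weighted N (v : nat -> R) phi (W : T -> R) C :
  measurable_fun [set: g_sigma_algebraType (gen N)] W -> (forall w, `|W w| <= C) ->
  \int[P]_w (W w * cos (phi + \sum_(i < N) v i * (H i w * Y i w))) =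
  \int[P]_w (W w * expR (- \sum_(i < N) `|v i| `^ p * `|H i w| `^ p) * cos phi).
Proof.
(* [cos_mixture] wants every [c i] measurable for the first [N] coordinates, so the indices from [N]
   on are given weight 0. *)
move=> mW WC; pose c i w := if (i < N)%N then v i * H i w else 0.
have mc i : measurable_fun [set: g_sigma_algebraType (gen N)] (c i).
  by rewrite /c; case: (boolP (i < N)%N) => iN //; apply: measurable_funM => //; exact: mH.
have := cos_mixture mX mY indY indXY cosY sinY N phi mW mc WC.
have -> : (fun w => W w * cos (phi + \sum_(i < N) c i w * Y i w)) =
    (fun w => W w * cos (phi + \sum_(i < N) v i * (H i w * Y i w))).
  by apply/funext => w; congr (_ * cos (_ + _)); apply: eq_bigr => i _; rewrite /c ltn_ord mulrA.
move=> ->; apply: eq_Rintegral => w _; congr (_ * expR (- _) * _); apply: eq_bigr => i _.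
by rewrite /c ltn_ord normrM powRM.
Qed.

Let s (n : nat) : R := (n%:R `^ p^-1)^-1.

Let s_ge0 n : 0 <= s n. Proof. by rewrite invr_ge0 powR_ge0. Qed.

Let s_pow n : s n `^ p = n%:R^-1.
Proof.
rewrite /s -(powR_inv1 (powR_ge0 n%:R p^-1)) -!powRrM.
have -> : p^-1 * (-1 * p) = -1 by field; rewrite gt_eqF.
by rewrite powR_inv1.
Qed.

Let IE t n w : t * I n w = \sum_(i < n) (t * s n) * (H i w * Y i w).
Proof. by rewrite /I /randomized_sum -/(s n) mulrA mulr_sumr. Qed.

Let aE t n w : \sum_(i < n) `|t * s n| `^ p * `|H i w| `^ p = `|t| `^ p * a n w.
Proof. by rewrite -mulr_sumr normrM powRM// [in `|s n|]ger0_norm// s_pow -mulrA. Qed.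

(** The factor [W] may depend on more coordinates of [X] than [I n] does; the surplus indices get
    weight 0. *)
Let cosI t n phi (W : T -> R) N C : (n <= N)%N ->
  measurable_fun [set: g_sigma_algebraType (gen N)] W -> (forall w, `|W w| <= C) ->
  \int[P]_w (W w * cos (phi + t * I n w)) = \int[P]_w (W w * expR (- (`|t| `^ p * a n w)) * cos phi).
Proof.
move=> nN mW WC; pose v i := if (i < n)%N then t * s n else 0.
have E (F : nat -> R) : \sum_(i < n) F i = \sum_(i < N) (if (i < n)%N then F i else 0).
  by rewrite (big_ord_widen N F nN) big_mkcond.
have := @cos_weighted N v phi W C mW WC.
have -> : (fun w => W w * cos (phi + \sum_(i < N) v i * (H i w * Y i w))) =
    (fun w => W w * cos (phi + t * I n w)).
  apply/funext => w; rewrite IE (E (fun i => t * s n * (H i w * Y i w))); congr (_ * cos (_ + _)).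
  by apply: eq_bigr => i _; rewrite /v; case: ifP => //; rewrite mul0r.
move=> ->; apply: eq_Rintegral => w _; congr (_ * expR (- _) * _).
rewrite -aE (E (fun i => `|t * s n| `^ p * `|H i w| `^ p)).
by apply: eq_bigr => i _; rewrite /v; case: ifP => //; rewrite normr0 powR0 ?gt_eqF// mul0r.
Qed.

Let meas1 N : measurable_fun [set: g_sigma_algebraType (gen N)] (fun=> 1 : R).
Proof. by []. Qed.

Let norm1 (w : T) : `|1 : R| <= 1.
Proof. by rewrite normr1. Qed.

Let cosN_sin (x : R) : cos (- (pi / 2) + x) = sin x.
Proof. by rewrite addrC -sinDpihalf subrK. Qed.

Let cosN_pihalf : cos (- (pi / 2) : R) = 0.
Proof. by rewrite cosN cos_pihalf. Qed.

Lemma randomized_cos t n : \int[P]_w cos (t * I n w) = \int[P]_w expR (- (`|t| `^ p * a n w)).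
Proof.
have := @cosI t n 0 (fun=> 1) n 1 (leqnn n) (@meas1 n) norm1.
by under eq_Rintegral do rewrite mul1r add0r; move=> ->; apply: eq_Rintegral => w _; rewrite cos0 mulr1 mul1r.
Qed.

(** The phase [- pi / 2] turns the cosine into a sine, while its own cosine, a factor of the result,
    vanishes. *)
Lemma randomized_sin t n : \int[P]_w sin (t * I n w) = 0.
Proof.
have := @cosI t n (- (pi / 2)) (fun=> 1) n 1 (leqnn n) (@meas1 n) norm1.
under eq_Rintegral do rewrite mul1r cosN_sin.
by move=> ->; under eq_Rintegral do rewrite cosN_pihalf mulr0; rewrite Rintegral_cst1.
Qed.

Variable c : R.
Hypothesis iH : forall i, P.-integrable setT (EFin \o (fun w => `|H i w| `^ p)).
Hypothesis cH : forall i, \int[P]_w (`|H i w| `^ p) = c.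

Let ia n : (0 < n)%N -> P.-integrable setT (EFin \o a n) /\ \int[P]_w a n w = c.
Proof.
move=> n0.
have [i1 e1] : P.-integrable setT (EFin \o (fun w => \sum_(i < n) `|H i w| `^ p)) /\
    \int[P]_w (\sum_(i < n) `|H i w| `^ p) = n%:R * c.
  elim: n {n0} => [|n [i1 e1]].
    have -> : (fun w => \sum_(i < 0) `|H i w| `^ p) = cst 0 by apply/funext => w; rewrite big_ord0.
    by rewrite Rintegral_cst1 mul0r; split => //; exact: integrable0.
  have -> : (fun w => \sum_(i < n.+1) `|H i w| `^ p) = (fun w => \sum_(i < n) `|H i w| `^ p + `|H n w| `^ p).
    by apply/funext => w; rewrite big_ord_recr.
  split; first exact: (integrableD measurableT i1 (iH n)).
  by rewrite (RintegralD measurableT i1 (iH n)) e1 cH -natr1 mulrDl mul1r.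
split; first exact: (integrableZl measurableT n%:R^-1 i1).
by rewrite (RintegralZl n%:R^-1 measurableT i1) e1 mulKf// pnatr_eq0 -lt0n.
Qed.

(* The pair [cos (t (I n +/- I m))] has random exponent [|t|^p Q] with
   [Q = (1 +/- x)^p a m + (a n - x^p a m)] and [x^p = m / n]. *)
Let pair_exponent (t eps : R) (m n : nat) : (0 < m)%N -> (m <= n)%N -> eps = 1 \/ eps = - 1 ->
  exists Q : T -> R, [/\ measurable_fun setT Q, (forall w, 0 <= Q w),
    (forall w, `|Q w - `|t| `^ p * (a m w + a n w)| <= `|t| `^ p * (3 * (Num.sqrt m%:R / Num.sqrt n%:R)) * a m w) &
    \int[P]_w cos (t * (I n w + eps * I m w)) = \int[P]_w expR (- Q w)].
Proof.
move=> m0 mn epsE; have n0 : (0 < n)%N := leq_trans m0 mn.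
have mr : (0 : R) < m%:R by rewrite ltr0n.
have nr : (0 : R) < n%:R by rewrite ltr0n.
pose x := s n / s m.
have sm : 0 < s m by rewrite invr_gt0 powR_gt0.
have sn : 0 < s n by rewrite invr_gt0 powR_gt0.
have x0 : 0 < x by rewrite divr_gt0.
have xE : x = (m%:R / n%:R) `^ p^-1.
  by rewrite /x /s invrK mulrC powRM ?invr_ge0//; congr (_ * _); rewrite -powR_inv1// -powRrM mulrC powRrM powR_inv1// powR_ge0.
have mn1 : m%:R / n%:R <= 1 :> R by rewrite ler_pdivrMr// mul1r ler_nat.
have mn0 : 0 < m%:R / n%:R :> R by rewrite divr_gt0.
have xp : x `^ p = m%:R / n%:R by rewrite xE -powRrM mulVf ?gt_eqF// powRr1// ltW.
have x1 : x <= 1.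
  by rewrite xE -[leRHS](powRr0 (m%:R / n%:R)); apply: ger_powR; [rewrite mn0|rewrite invr_ge0 ltW].
(* As m / n <= 1, the exponent may be lowered from 1 / p to 1 / 2, which is smaller because
   [p < 2]. *)
have xs : x <= Num.sqrt m%:R / Num.sqrt n%:R.
  rewrite -sqrtrV// -sqrtrM// xE -powR12_sqrt ?(ltW mn0)//; apply: ger_powR; first by rewrite mn0.
  by rewrite -[leRHS]invrK lef_pV2 ?posrE ?invr_gt0//; move: p12 => /andP[_]; rewrite invrK; exact: ltW.
have x01 : 0 <= x <= 1 by rewrite (ltW x0).
pose v i := t * (s n + eps * (if (i < m)%N then s m else 0)).
have split_sum (F : nat -> R) : \sum_(i < n) F i = \sum_(i < m) F i + \sum_(m <= i < n) F i.
  by rewrite -!(big_mkord xpredT F) -big_cat_nat.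
pose Q w := \sum_(i < n) `|v i| `^ p * `|H i w| `^ p.
have QE w : Q w = `|t| `^ p * (`|1 + eps * x| `^ p * a m w + (a n w - x `^ p * a m w)).
  rewrite /Q (split_sum (fun i => `|v i| `^ p * `|H i w| `^ p)).
  have -> : \sum_(i < m) `|v i| `^ p * `|H i w| `^ p = `|t| `^ p * (`|1 + eps * x| `^ p * a m w).
    rewrite /a /power_mean [X in _ * X]mulrA mulrA mulr_sumr; apply: eq_bigr => i _; congr (_ * _).
    rewrite /v ltn_ord normrM powRM//; congr (_ * _).
    (* This uses that [eps] squares to 1; the outer [eps] then disappears in the absolute value. *)
    have -> : s n + eps * s m = s m * (eps * (1 + eps * x)).
      by case: epsE => ->; rewrite /x; field; rewrite gt_eqF.
    have eps1 : `|eps| = 1 by case: epsE => ->; rewrite ?normrN normr1.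
    by rewrite normrM powRM// gtr0_norm// s_pow normrM eps1 mul1r mulrC.
  have -> : \sum_(m <= i < n) `|v i| `^ p * `|H i w| `^ p =
      `|t| `^ p * (n%:R^-1 * \sum_(m <= i < n) `|H i w| `^ p).
    rewrite mulrA mulr_sumr; apply: eq_big_nat => i /andP[mi _]; congr (_ * _).
    by rewrite /v ltnNge mi/= mulr0 addr0 normrM powRM// [in `|s n|]gtr0_norm// s_pow.
  rewrite -mulrDr; congr (_ * (_ + _)).
  rewrite xp /a /power_mean (split_sum (fun i => `|H i w| `^ p)).
  move: (\sum_(i < m) _) (\sum_(m <= i < n) _) => S1 S2.
  by field; rewrite !gt_eqF.
have teps : `| `|1 + eps * x| `^ p - (1 + x `^ p)| <= 3 * x.
  case: epsE => ->; first by rewrite mul1r [in `|1 + x|]ger0_norm ?addr_ge0 ?(ltW x0)//; exact: powR_1Dx_dist.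
  by rewrite mulN1r [in `|1 - x|]ger0_norm ?subr_ge0//; exact: powR_1Bx_dist.
exists Q; split.
- apply: measurable_sum => i; apply: measurable_funM => //.
  apply: (measurableT_comp (measurable_powR p)); apply: measurableT_comp => //.
  by apply: (genT (@mH _ i.+1 _)).
- by move=> w; apply: sumr_ge0 => i _; rewrite mulr_ge0// powR_ge0.
- move=> w; rewrite QE -mulrBr.
  have -> : `|1 + eps * x| `^ p * a m w + (a n w - x `^ p * a m w) - (a m w + a n w) =
    (`|1 + eps * x| `^ p - (1 + x `^ p)) * a m w by ring.
  rewrite normrM [in `| `|t| `^ p|]ger0_norm ?powR_ge0// -mulrA ler_wpM2l ?powR_ge0//.
  rewrite normrM [in `|a m w|]ger0_norm ?power_mean_ge0// ler_wpM2r ?power_mean_ge0//.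
  by rewrite (le_trans teps)// ler_wpM2l.
have := @cos_weighted n v 0 (fun=> 1) 1 (@meas1 n) norm1.
rewrite -/Q; under eq_Rintegral do rewrite mul1r add0r.
under [in RHS]eq_Rintegral do rewrite mul1r cos0 mulr1.
move=> <-; apply: eq_Rintegral => w _; congr cos.
rewrite mulrDr IE mulrCA IE mulr_sumr.
have -> : \sum_(i < m) eps * (t * s m * (H i w * Y i w)) =
   \sum_(i < n) (if (i < m)%N then eps * (t * s m * (H i w * Y i w)) else 0).
  rewrite (split_sum (fun i => if (i < m)%N then eps * (t * s m * (H i w * Y i w)) else 0)).
  rewrite [X in _ = _ + X]big1_seq ?addr0; first by apply: eq_bigr => i _; rewrite ltn_ord.
  by move=> i; rewrite mem_index_iota => /andP[_ /andP[mi _]]; rewrite ltnNge mi.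
rewrite -big_split/=; apply: eq_bigr => i _; rewrite /v; case: ifP => _; ring.
Qed.

(** The exponential is 1-Lipschitz on the negative half-line, and the exponents differ by at most a
    multiple of [a m], so only its mean [c] enters. *)
Let pair_bound (t eps : R) (m n : nat) : (0 < m)%N -> (m <= n)%N -> eps = 1 \/ eps = - 1 ->
  `|\int[P]_w cos (t * (I n w + eps * I m w)) -
    \int[P]_w (expR (- (`|t| `^ p * a m w)) * expR (- (`|t| `^ p * a n w)))| <=
  3 * `|t| `^ p * c * (Num.sqrt m%:R / Num.sqrt n%:R).
Proof.
move=> m0 mn epsE.
have [Q [mQ Q0 QB ->]] := pair_exponent t m0 mn epsE.
set x := Num.sqrt _ / _ in QB *; set k := `|t| `^ p in QB *.
have k0 : 0 <= k by exact: powR_ge0.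
have kab0 w : 0 <= k * (a m w + a n w) by rewrite mulr_ge0// addr_ge0 ?power_mean_ge0.
have bnd (f : T -> R) : measurable_fun setT f -> (forall w, 0 <= f w) ->
    P.-integrable setT (EFin \o (fun w => expR (- f w))).
  move=> mf f0; apply: (@bounded_integrable _ _ _ P _ 1).
    by apply: measurableT_comp => //; exact: measurableT_comp.
  by move=> w; rewrite ger0_norm ?expR_ge0// -expR0 ler_expR oppr_le0.
have i1 := bnd _ mQ Q0.
have mab : measurable_fun setT (fun w => k * (a m w + a n w)).
  by apply: measurable_funM => //; apply: measurable_funD; exact: measurable_power_mean.
have i2 := bnd _ mab kab0.
have -> : \int[P]_w (expR (- (k * a m w)) * expR (- (k * a n w))) =
    \int[P]_w expR (- (k * (a m w + a n w))).
  by apply: eq_Rintegral => w _; rewrite -expRD; congr expR; ring.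
rewrite -(RintegralB measurableT i1 i2).
apply: le_trans (le_normr_Rintegral measurableT (integrableB measurableT i1 i2)) _.
have [iam eam] := ia m0.
have -> : 3 * k * c * x = \int[P]_w (k * (3 * x) * a m w).
  by rewrite (RintegralZl (k * (3 * x)) measurableT iam) eam; ring.
apply: le_Rintegral => //.
- exact: (integrable_norm (integrableB measurableT i1 i2)).
- exact: (integrableZl measurableT (k * (3 * x)) iam).
move=> w _; apply: le_trans (QB w).
by rewrite ler_norml lerNl opprB expRN_lipschitz// andbT distrC expRN_lipschitz.
Qed.

Let i2 (f g : T -> R) : measurable_fun setT f -> measurable_fun setT g ->
   (forall w, `|f w| <= 1) -> (forall w, `|g w| <= 1) -> P.-integrable setT (EFin \o (fun w => f w * g w)).
Proof.
move=> mf mg f1 g1; apply: (@bounded_integrable _ _ _ _ _ 1); first exact: measurable_funM.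
by move=> w; rewrite normrM -[leRHS]mulr1 ler_pM.
Qed.

Let mtI t n (f : R -> R) : measurable_fun setT f -> measurable_fun setT (fun w => f (t * I n w)).
Proof. by move=> mf; apply: measurableT_comp => //; apply: measurable_funM => //; exact: measurable_randomized_sum. Qed.

Let e (t : R) n w := expR (- (`|t| `^ p * a n w)).

Let e1 t n w : `|e t n w| <= 1.
Proof.
by rewrite ger0_norm ?expR_ge0// -expR0 ler_expR oppr_le0 mulr_ge0 ?powR_ge0 ?power_mean_ge0.
Qed.

Let meN t n N : (n <= N)%N -> measurable_fun [set: g_sigma_algebraType (gen N)] (e t n).
Proof.
move=> nN; apply: measurableT_comp => //; apply: measurableT_comp => //.
by apply: measurable_funM => //; exact: ma.
Qed.

Let me t n : measurable_fun setT (e t n).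
Proof. exact: (genT (meN t (leqnn n))). Qed.

Let pair t m n eps := \int[P]_w cos (t * (I n w + eps * I m w)).

Let ipair t m n eps : P.-integrable setT (EFin \o (fun w => cos (t * (I n w + eps * I m w)))).
Proof.
apply: (@bounded_integrable _ _ _ _ _ 1); last by move=> w; exact: cos_max.
apply: measurableT_comp => //; apply: measurable_funM => //; apply: measurable_funD.
  exact: measurable_randomized_sum.
by apply: measurable_funM => //; exact: measurable_randomized_sum.
Qed.

(** Given [X], the cosine has mean [e t n], and [e t m] is a function of [X]; [k] is a window of
    coordinates that contains both. *)
Let cos_e t m n k : (m <= k)%N -> (n <= k)%N ->
  \int[P]_w (e t m w * cos (t * I n w)) = \int[P]_w (e t m w * e t n w).
Proof.
move=> mk nk; have := @cosI t n 0 (e t m) k 1 nk (meN t mk) (e1 t m).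
by under eq_Rintegral do rewrite add0r; move=> ->; apply: eq_Rintegral => w _; rewrite cos0 mulr1.
Qed.

(** The product of cosines is half the sum of the cosines at [I n + I m] and [I n - I m], whose
    means are both close to that of [e t m * e t n]. The two cross terms have exactly this mean, so
    everything cancels up to the bound. *)
Lemma randomized_cos_cov t m n : (0 < m)%N -> (m <= n)%N ->
  \int[P]_w ((cos (t * I m w) - expR (- (`|t| `^ p * a m w))) *
             (cos (t * I n w) - expR (- (`|t| `^ p * a n w)))) <=
  3 * `|t| `^ p * c * (Num.sqrt m%:R / Num.sqrt n%:R).
Proof.
move=> m0 mn.
have cE w : (cos (t * I m w) - e t m w) * (cos (t * I n w) - e t n w) =
   2^-1 * (cos (t * (I n w + 1 * I m w)) + cos (t * (I n w + -1 * I m w))) -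
   (e t n w * cos (t * I m w) + e t m w * cos (t * I n w) - e t m w * e t n w).
  have -> : t * (I n w + 1 * I m w) = t * I n w + t * I m w by ring.
  have -> : t * (I n w + -1 * I m w) = t * I n w - t * I m w by ring.
  by rewrite cosB cosD; field.
have cos1 k w : `|cos (t * I k w)| <= 1 by exact: cos_max.
have j1 := integrableZl measurableT 2^-1 (integrableD measurableT (ipair t m n 1) (ipair t m n (-1))).
have mc k := mtI t k measurable_cos.
have j2 := i2 (me t n) (mc m) (e1 t n) (cos1 m).
have j3 := i2 (me t m) (mc n) (e1 t m) (cos1 n).
have j4 := i2 (me t m) (me t n) (e1 t m) (e1 t n).
have j23 := integrableD measurableT j2 j3.
have j234 := integrableB measurableT j23 j4.
rewrite [leLHS](eq_Rintegral _ (fun w _ => cE w)) (RintegralB measurableT j1 j234).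
rewrite (RintegralZl 2^-1 measurableT (integrableD measurableT (ipair t m n 1) (ipair t m n (-1)))).
rewrite (RintegralD measurableT (ipair t m n 1) (ipair t m n (-1))).
rewrite (RintegralB measurableT j23 j4) (RintegralD measurableT j2 j3).
rewrite (cos_e t (leqnn n) mn) (cos_e t mn (leqnn n)).
have -> : \int[P]_w (e t n w * e t m w) = \int[P]_w (e t m w * e t n w).
  by apply: eq_Rintegral => w _; rewrite mulrC.
have := le_trans (ler_norm _) (pair_bound t m0 mn (or_introl erefl)).
have := le_trans (ler_norm _) (pair_bound t m0 mn (or_intror erefl)).
rewrite -/(e t m _).
move: (\int[P]_w cos (t * (I n w + 1 * I m w))) (\int[P]_w cos (t * (I n w + -1 * I m w))) => u v.
rewrite -[\int[P]_w (_ * _)]/(\int[P]_w (e t m w * e t n w)).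
move: (\int[P]_w (e t m w * e t n w)) (3 * _ * _ * _) => q k.
exact: half_sum_le.
Qed.

(** Here the product formula has a difference of cosines, in which the common approximate mean
    cancels. *)
Lemma randomized_sin_cov t m n : (0 < m)%N -> (m <= n)%N ->
  \int[P]_w (sin (t * I m w) * sin (t * I n w)) <=
  3 * `|t| `^ p * c * (Num.sqrt m%:R / Num.sqrt n%:R).
Proof.
move=> m0 mn.
have cE w : sin (t * I m w) * sin (t * I n w) =
   2^-1 * (cos (t * (I n w + -1 * I m w)) - cos (t * (I n w + 1 * I m w))).
  have -> : t * (I n w + 1 * I m w) = t * I n w + t * I m w by ring.
  have -> : t * (I n w + -1 * I m w) = t * I n w - t * I m w by ring.
  by rewrite cosB cosD; field.
rewrite [leLHS](eq_Rintegral _ (fun w _ => cE w)).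
rewrite (RintegralZl 2^-1 measurableT (integrableB measurableT (ipair t m n (-1)) (ipair t m n 1))).
rewrite (RintegralB measurableT (ipair t m n (-1)) (ipair t m n 1)).
have := pair_bound t m0 mn (or_introl erefl); have := pair_bound t m0 mn (or_intror erefl).
rewrite !ler_norml => /andP[h1 h2] /andP[h3 h4].
move: h1 h2 h3 h4.
move: (\int[P]_w cos (t * (I n w + 1 * I m w))) (\int[P]_w cos (t * (I n w + -1 * I m w))) => u v.
move: (\int[P]_w (_ * _)) (3 * _ * _ * _) => q k.
exact: half_sub_le.
Qed.

Lemma randomized_cos_log_average t : {ae P, forall w, (fun N => (harm N : R)^-1 *
  \sum_(i < N) i.+1%:R^-1 * (cos (t * I i.+1 w) - expR (- (`|t| `^ p * a i.+1 w)))) @ \oo --> (0 : R)}.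
Proof.
apply: (@log_average_cvg0 _ _ _ P (fun i w => cos (t * I i.+1 w) - e t i.+1 w) (3 * `|t| `^ p * c)).
- by move=> n; apply: measurable_funB; [exact: mtI|exact: me].
- move=> n w; rewrite (le_trans (ler_normB _ _))// -[leRHS]/(1 + 1) lerD//; exact: cos_max.
- by move=> m n mn; exact: randomized_cos_cov.
Qed.

Lemma randomized_sin_log_average t : {ae P, forall w, (fun N => (harm N : R)^-1 *
  \sum_(i < N) i.+1%:R^-1 * sin (t * I i.+1 w)) @ \oo --> (0 : R)}.
Proof.
apply: (@log_average_cvg0 _ _ _ P (fun i w => sin (t * I i.+1 w)) (3 * `|t| `^ p * c)).
- by move=> n; exact: mtI.
- by move=> n w; rewrite (le_trans (sin_max _))// ler1n.
- by move=> m n mn; exact: randomized_sin_cov.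
Qed.

End Randomized.

(** * Log-empirical measures *)

Section AeSwap.
Context {R : realType} {d1 d2 : measure_display} {T1 : measurableType d1} {T2 : measurableType d2}.
Variables (mu1 : {sigma_finite_measure set T1 -> \bar R}) (mu2 : {sigma_finite_measure set T2 -> \bar R}).

(** It turns pointwise convergence to 0 into the vanishing of a measurable function, on which
    Tonelli's theorem can act. *)
Lemma limn_esup_abs_eq0 (u : nat -> R) : limn_esup (fun n => `|u n|%:E) = 0%E <-> u @ \oo --> 0.
Proof.
split=> [h|h].
  apply/norm_cvg0P.
  have H : (fun n => `|u n|%:E) @ \oo --> 0%E.
    by apply: limn_esup_le_cvg => [|n]; rewrite ?h// lee_fin.
  exact: (fine_cvg H).
have : (fun n => `|u n|%:E) @ \oo --> 0%E.
  apply: cvg_EFin; first exact: nearW.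
  by apply/norm_cvg0P.
by move=> /cvg_limn_einf_sup[_].
Qed.

(** The upper limit of |G n| is measurable and nonnegative on the product; its integral is 0 in one
    order, hence in the other. *)
Lemma ae_cvg0_swap (G : nat -> T1 * T2 -> R) : (forall n, measurable_fun setT (G n)) ->
  (forall y, {ae mu1, forall x, (fun n => G n (x, y)) @ \oo --> 0}) ->
  {ae mu1, forall x, {ae mu2, forall y, (fun n => G n (x, y)) @ \oo --> 0}}.
Proof.
move=> mG hG.
pose L (z : T1 * T2) := limn_esup (fun n => `|G n z|%:E).
have mL : measurable_fun setT L.
  apply: measurable_fun_limn_esup => n; apply/measurable_EFinP.
  by apply: measurableT_comp.
have L0 z : (0 <= L z)%E.
  by apply: limf_esup_ge0 => //; case=> n _ /(_ n (leqnn n)).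
have := fubini_tonelli (m1 := mu1) (m2 := mu2) L mL L0.
have -> : (\int[mu2]_y \int[mu1]_x L (x, y) = 0)%E.
  apply: integral0_eq => y _.
  have mLy : measurable_fun setT (fun x => L (x, y)) by exact: measurableT_comp.
  rewrite -[RHS](integral0 mu1 setT); apply: ae_eq_integral => //.
  by apply: filterS (hG y) => x hx _; apply/limn_esup_abs_eq0.
move=> I0.
have mI : measurable_fun setT (fun x => \int[mu2]_y L (x, y))%E.
  exact: (measurable_fun_fubini_tonelli_F (m2 := mu2) L mL L0).
have : ae_eq mu1 setT (fun x => \int[mu2]_y L (x, y))%E (cst 0%E).
  apply/ae_eq_integral_abs => //; rewrite -[RHS]I0; apply: eq_integral => x _.
  by rewrite gee0_abs// integral_ge0.
apply: filterS => x /(_ Logic.I) /= Ix.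
have mLx : measurable_fun setT (fun y => L (x, y)) by exact: measurableT_comp.
have : ae_eq mu2 setT (fun y => L (x, y)) (cst 0%E).
  apply/ae_eq_integral_abs => //; rewrite -[RHS]Ix; apply: eq_integral => y _.
  by rewrite gee0_abs.
by apply: filterS => y /(_ Logic.I) /= /limn_esup_abs_eq0.
Qed.

End AeSwap.

(** * Logarithmic averages of convergent sequences, and the comparison of [harm] with [ln] *)

Section LogAverage.
Context {R : realType}.

Lemma harm_gt0 N : 0 < harm N.+1 :> R.
Proof. by rewrite harmS ltr_wpDl ?harm_ge0// invr_gt0. Qed.

Lemma harm_le_ln N : harm N.+1 <= 1 + ln (N.+1%:R : R).
Proof.
elim: N => [|N IH]; first by rewrite harmS harm0 add0r invr1 ln1 addr0.
rewrite harmS; have n0 : (N.+2%:R : R) != 0 by [].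
have h : ln (N.+1%:R : R) - ln N.+2%:R <= - N.+2%:R^-1.
  rewrite -ln_div ?posrE//.
  have -> : N.+1%:R / N.+2%:R = 1 + (- N.+2%:R^-1) :> R.
    by rewrite -[X in X / _](addrK 1) natr1 mulrBl mulfV// mul1r.
  by apply: le_ln1Dx; rewrite ltrN2 invf_lt1// ltr1n.
move: IH h; move: (harm N.+1) (ln N.+1%:R) (ln N.+2%:R) N.+2%:R^-1 => x y v u; lra.
Qed.

Lemma ln_le_harm N : ln (N.+1%:R : R) <= harm N.+1.
Proof.
apply: (@le_trans _ _ (harm N)); last exact: harm_nd.
elim: N => [|N IH]; first by rewrite ln1 harm_ge0.
rewrite harmS; have -> : N.+2%:R = N.+1%:R * (1 + N.+1%:R^-1) :> R.
  by rewrite mulrDr mulr1 mulfV// natr1.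
rewrite lnM ?posrE ?addr_gt0 ?invr_gt0//.
by apply: lerD => //; apply: le_ln1Dx; rewrite (@lt_trans _ _ 0)// ltrN10.
Qed.

(** Toeplitz averaging: the total weight [harm N] diverges and outweighs the finitely many terms
    before [K]. *)
Lemma log_average_cvg (u : nat -> R) (l : R) : u @ \oo --> l ->
  (fun N => (harm N)^-1 * \sum_(i < N) i.+1%:R^-1 * u i) @ \oo --> l.
Proof.
move=> ul; apply/cvgrPdist_le => e e0.
have e2 : 0 < e / 2 by rewrite divr_gt0.
have [K _ HK] : \forall i \near \oo, `|l - u i| <= e / 2 by move/cvgrPdist_le : ul => /(_ _ e2).
pose A := \sum_(i < K) i.+1%:R^-1 * `|l - u i|.
have [N0 hN0] := harm_unbounded (2 * A / e + 1).
have A0 : 0 <= A by apply: sumr_ge0 => i _; rewrite mulr_ge0// invr_ge0.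
exists N0 => // N /= NN0.
have hN : 2 * A / e + 1 <= harm N by rewrite (le_trans hN0)// harm_nd.
have h0 : 0 < harm N :> R by rewrite (lt_le_trans _ hN)// ltr_wpDl// mulr_ge0 ?invr_ge0 ?(ltW e0)// mulr_ge0.
have -> : l - (harm N)^-1 * \sum_(i < N) i.+1%:R^-1 * u i =
   (harm N)^-1 * \sum_(i < N) i.+1%:R^-1 * (l - u i).
  under [in RHS]eq_bigr do rewrite mulrBr.
  rewrite sumrB mulrBr; congr (_ - _).
  by rewrite -mulr_suml -/(harm N) mulrA mulVf ?mul1r// gt_eqF.
rewrite normrM ger0_norm ?invr_ge0 ?(ltW h0)// ler_pdivrMl//.
apply: (le_trans (ler_norm_sum _ _ _)).
have B n : \sum_(i < n) `|i.+1%:R^-1 * (l - u i)| <= A + harm n * (e / 2).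
  elim: n => [|n IH]; first by rewrite big_ord0 harm0 mul0r addr0.
  rewrite big_ord_recr/= harmS mulrDl addrA.
  have [nK|Kn] := ltnP n K; last first.
    by rewrite lerD// normrM ger0_norm ?invr_ge0// ler_wpM2l ?invr_ge0// HK.
  have hA : \sum_(i < n.+1) `|i.+1%:R^-1 * (l - u i)| <= A.
    rewrite /A -!(big_mkord xpredT (fun i => `|i.+1%:R^-1 * (l - u i)|)).
    rewrite -(big_mkord xpredT (fun i => i.+1%:R^-1 * `|l - u i|)) [leRHS](@big_cat_nat _ _ _ n.+1)//=.
    rewrite -[leLHS]addr0 lerD//; last by apply: sumr_ge0 => i _; rewrite mulr_ge0// invr_ge0.
    by apply: ler_sum => i _; rewrite normrM ger0_norm// invr_ge0.
  rewrite big_ord_recr/= in hA; rewrite (le_trans hA)// -addrA lerDl.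
  by rewrite addr_ge0// mulr_ge0// ?harm_ge0 ?invr_ge0// ltW.
apply: (le_trans (B N)).
have : A <= harm N * (e / 2).
  rewrite mulrA ler_pdivlMr// -ler_pdivrMr//; apply: le_trans hN.
  by rewrite [A * 2]mulrC lerDl.
by move: A B {A0 hN hN0} => A _; lra.
Qed.

Lemma cvg_harm_div_ln : (fun N => harm N.+1 / ln (N.+1%:R : R)) @ \oo --> (1 : R).
Proof.
apply/cvgrPdist_le => e e0.
have [N0 hN0] := harm_unbounded (e^-1 + 1).
exists N0 => // N /= NN0.
have h1 : e^-1 + 1 <= harm N.+1 by rewrite (le_trans hN0)// harm_nd// (leq_trans NN0).
have h2 := harm_le_ln N; have h3 := ln_le_harm N.
have e1 : 0 < e^-1 by rewrite invr_gt0.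
have l1 : e^-1 <= ln (N.+1%:R : R) by move: h1 h2; move: (harm _) (ln _) => x y; lra.
have l0 : 0 < ln (N.+1%:R : R) := lt_le_trans e1 l1.
rewrite distrC ger0_norm; last by rewrite subr_ge0 ler_pdivlMr// mul1r.
rewrite lerBlDr ler_pdivrMr//.
have : 1 <= e * ln N.+1%:R by rewrite -ler_pdivrMl// mulr1.
by move: h2; rewrite mulrDl mul1r; move: (harm _) (ln _) => x y; lra.
Qed.

End LogAverage.

Section LogEmpirical.
Context {R : realType}.
Variables (z : nat -> R) (N : nat).

Let weight_ge0 i : 0 <= (harm N.+1 : R)^-1 * i.+1%:R^-1.
Proof. by rewrite mulr_ge0 ?invr_ge0 ?harm_ge0. Qed.

Let comp (i : nat) : {measure set R -> \bar R} :=
  mscale (NngNum (weight_ge0 i)) (@dirac _ R (z i) R).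

Let emp : {measure set R -> \bar R} := msum comp N.+1.

Let sum_weight : \sum_(i < N.+1) (harm N.+1 : R)^-1 * i.+1%:R^-1 = 1.
Proof. by rewrite -mulr_sumr -/(harm N.+1) mulVf// gt_eqF ?harm_gt0. Qed.

Let empT : emp setT = 1%E.
Proof.
rewrite /emp /msum/= -[RHS]/(1%:E) -sum_weight -sumEFin; apply: eq_bigr => i _.
transitivity (((harm N.+1)^-1 * i.+1%:R^-1)%:E * (@dirac _ R (z i) R setT))%E => //.
by rewrite diracT mule1.
Qed.

Let emp_isP := Measure_isProbability.Build _ _ _ (msum comp N.+1) empT.

(** The index [N] stands for [N.+1] atoms, so that the total weight [harm N.+1] is never zero. *)
Definition log_empirical : probability R R := HB.pack (msum comp N.+1) emp_isP.

Let ge0_integral_emp (f : R -> R) : measurable_fun setT f -> (forall x, 0 <= f x) ->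
  \int[log_empirical]_x f x = (harm N.+1)^-1 * \sum_(i < N.+1) i.+1%:R^-1 * f (z i).
Proof.
move=> mf f0; rewrite /Rintegral.
have mf' : measurable_fun setT (EFin \o f) by exact/measurable_EFinP.
have -> : (\int[log_empirical]_x (f x)%:E = \sum_(i < N.+1) (\int[comp i]_x (f x)%:E))%E.
  by apply: (ge0_integral_measure_sum comp) => // x _; rewrite lee_fin.
rewrite mulr_sumr -[RHS]/(fine (_%:E)) -sumEFin; congr fine; apply: eq_bigr => i _.
rewrite /comp ge0_integral_mscale//=; last by move=> x _; rewrite lee_fin.
by rewrite integral_dirac// diracT mul1e -EFinM mulrA.
Qed.

(** Adding [C] makes the function nonnegative; the shift cancels because the weights sum to 1. *)
Lemma Rintegral_log_empirical (f : R -> R) (C : R) : measurable_fun setT f -> (forall x, `|f x| <= C) ->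
  \int[log_empirical]_x f x = (harm N.+1)^-1 * \sum_(i < N.+1) i.+1%:R^-1 * f (z i).
Proof.
move=> mf fC.
have i1 : log_empirical.-integrable setT (EFin \o f) := bounded_integrable log_empirical mf fC.
have i2 : log_empirical.-integrable setT (EFin \o (fun=> C)).
  by apply: (@bounded_integrable _ _ _ log_empirical _ `|C|).
have := @ge0_integral_emp (fun x => f x + C); rewrite (RintegralD measurableT i1 i2) Rintegral_cst1.
under [X in _ -> _ -> _ = _ * X]eq_bigr do rewrite mulrDr.
rewrite big_split/= mulrDr -mulr_suml -/(harm N.+1) mulKf ?gt_eqF ?harm_gt0//.
move=> H; apply: (addIr C); apply: H; first exact: measurable_funD.
by move=> x; have := fC x; rewrite ler_norml => /andP[+ _]; rewrite -lerBlDr sub0r.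
Qed.

Lemma log_empirical_cdf (x : R) : fine (log_empirical `]-oo, x]%classic) =
  (harm N.+1)^-1 * \sum_(i < N.+1) i.+1%:R^-1 * (z i <= x)%R%:R.
Proof.
have mI : measurable (`]-oo, x]%classic : set R) by [].
have := @Rintegral_log_empirical (\1_`]-oo, x]%classic) 1 (measurable_indic mI).
rewrite /Rintegral integral_indic// setIT => ->; last first.
  by move=> y; rewrite indicE; case: (_ \in _); rewrite ?normr1 ?normr0.
congr (_ * _); apply: eq_bigr => i _; congr (_ * _); rewrite indicE.
suff -> : (z i \in `]-oo, x]%classic) = (z i <= x) by [].
by apply/idP/idP; rewrite inE/= in_itv.
Qed.

End LogEmpirical.

(** * Averages along a stationary ergodic path *)

Section PathErgodic.
Context {R : realType} {d : measure_display} {T : measurableType d}.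
Variables (P : probability T R) (Phi : T -> int -> R * R).
Hypothesis mPhi : forall n, measurable_fun setT (fun w => Phi w n).
Hypothesis seP : stationary_ergodic P Phi.

Let PT := g_sigma_algebraType (@path_cylinders R).

Let cylinder (n : int) (A : set (R * R)) : measurable A -> path_sigma [set f | A (f n)].
Proof. by move=> mA; apply: sub_sigma_algebra; exists n, A. Qed.

Let mPath : measurable_fun setT (Phi : T -> PT).
Proof.
apply: measurability; first by [].
by move=> _ [_ [n [A [mA ->]]] <-]; exact: (mPhi n).
Qed.

Let shift : PT -> PT := @shift_path R.

Let mshift : measurable_fun setT shift.
Proof.
apply: measurability; first by [].
by move=> _ [_ [n [A [mA ->]]] <-]; rewrite setTI; exact: (cylinder (n + 1)).
Qed.

Let mcoord n : measurable_fun setT (fun f : PT => f n).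
Proof. by move=> _ A mA; rewrite setTI; exact: cylinder. Qed.

Let coord_law (i : nat) A : measurable A -> P [set w | A (Phi w (Posz i.+1))] = P [set w | A (Phi w 1)].
Proof.
move=> mA; elim: i => // i <-; have [inv _] := seP.
rewrite (inv _ (cylinder (Posz i.+1) mA)); congr (P _); apply/seteqP; split => w /=;
  by rewrite /shift_path -PoszD addn1.
Qed.

Variable f : R * R -> R.
Hypothesis mf : measurable_fun setT f.
Hypothesis f0 : forall x, 0 <= f x.
Hypothesis fi : P.-integrable setT (EFin \o (fun w => f (Phi w 1))).

Let mfPhi n : measurable_fun setT (fun w => f (Phi w n)).
Proof. exact: measurableT_comp. Qed.

Let same_integral i : (\int[P]_w (f (Phi w (Posz i.+1)))%:E = \int[P]_w (f (Phi w 1))%:E)%E.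
Proof.
have mfE : measurable_fun setT (EFin \o f) by exact/measurable_EFinP.
rewrite -(ge0_integral_law P (mPhi (Posz i.+1)) mfE); last by move=> x; rewrite lee_fin.
rewrite -(ge0_integral_law P (mPhi 1) mfE); last by move=> x; rewrite lee_fin.
by apply: eq_measure_integral => A mA _; exact: coord_law.
Qed.

Lemma stationary_integrable i : P.-integrable setT (EFin \o (fun w => f (Phi w (Posz i.+1)))).
Proof.
apply/integrableP; split; first exact/measurable_EFinP.
have [_] := integrableP _ _ _ fi.
have E n : (\int[P]_w `|(EFin \o (fun w => f (Phi w n))) w| = \int[P]_w (f (Phi w n))%:E)%E.
  by apply: eq_integral => w _; rewrite gee0_abs// lee_fin.
by rewrite !E same_integral.
Qed.

Lemma stationary_Rintegral i : \int[P]_w f (Phi w (Posz i.+1)) = \int[P]_w f (Phi w 1).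
Proof. by rewrite /Rintegral same_integral. Qed.

(** The shift acts on path space, not on [T]: Birkhoff's theorem is applied to the law of the path
    and pulled back by [Phi]. *)
Lemma ergodic_average : {ae P, forall w,
  (fun n => n%:R^-1 * \sum_(i < n) f (Phi w (Posz i.+1))) @ \oo --> \int[P]_w f (Phi w 1)}.
Proof.
have [inv erg] := seP.
pose Q := law P mPath.
have Qinv (A : set PT) : measurable A -> Q (shift @^-1` A) = Q A.
  by move=> mA; apply/esym; exact: inv.
have Qerg (A : set PT) : measurable A -> shift @^-1` A = A -> Q A = 0%E \/ Q A = 1%E.
  by move=> mA; exact: erg.
(* Evaluation at time 1, so that the i-th iterate of the shift reads time i + 1. *)
pose g (x : PT) := f (x 1).
have mg : measurable_fun setT g by apply: measurableT_comp => //; exact: mcoord.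
have ig : Q.-integrable setT (EFin \o g) by exact: integrable_law.
have [A [mA A0 hA]] := birkhoff mshift Qinv Qerg ig.
exists (Phi @^-1` A); split.
- by rewrite -[X in measurable X]setTI; exact: mPath.
- exact: A0.
move=> w /= hw; apply: hA => /= h; apply: hw.
have iterE i : iter i shift (Phi w) = (fun n => Phi w (n + Posz i)).
  elim: i => [|i IH]; first by apply/funext => n; rewrite addr0.
  by rewrite iterS IH /shift /shift_path; apply/funext => n; rewrite -addrA -[1]/(Posz 1) -PoszD add1n.
suff E : (fun n => n%:R^-1 * \sum_(i < n) g (iter i shift (Phi w))) =
    (fun n => n%:R^-1 * \sum_(i < n) f (Phi w (Posz i.+1))).
  by rewrite -E -(Rintegral_law mPath mg fi); exact: h.
apply/funext => n; congr (_ * _); apply: eq_bigr => i _.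
by rewrite iterE /g -[1 + _]/(1%:Z + i%:Z) -PoszD add1n.
Qed.

End PathErgodic.

(** * Convergence to the stable law *)

#[local] Lemma cvg_of_sub_cvg0 {R : realType} (u : nat -> R) (k : R) :
  (fun n => u n - k) @ \oo --> 0 -> u @ \oo --> k.
Proof.
move/cvgrPdist_le => h; apply/cvgrPdist_le => e e0.
by apply: filterS (h e e0) => n; rewrite sub0r normrN distrC.
Qed.

#[local] Lemma cvg_sub0_of {R : realType} (u : nat -> R) (k : R) :
  u @ \oo --> k -> (fun n => u n - k) @ \oo --> 0.
Proof.
move/cvgrPdist_le => h; apply/cvgrPdist_le => e e0.
by apply: filterS (h e e0) => n; rewrite sub0r normrN distrC.
Qed.

Section StableLimit.
Context {R : realType} {d d' : measure_display} {T : measurableType d} {T' : measurableType d'}.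
Variables (P : probability T R) (P' : probability T' R) (p c : R).
Variables (I a : nat -> T -> R) (Z : T' -> R).
Hypothesis mI : forall n, measurable_fun setT (I n).
Hypothesis mZ : measurable_fun setT Z.
Hypothesis cosZ : forall t, \int[P']_w cos (t * Z w) = expR (- (`|t| `^ p * c)).
Hypothesis sinZ : forall t, \int[P']_w sin (t * Z w) = 0.
Hypothesis ac : {ae P, forall w, a^~ w @ \oo --> c}.

Let mcosM (t : R) : measurable_fun [set: R] (fun x => cos (t * x)).
Proof. by apply: measurableT_comp => //; exact: measurable_funM. Qed.

Let msinM (t : R) : measurable_fun [set: R] (fun x => sin (t * x)).
Proof. by apply: measurableT_comp => //; exact: measurable_funM. Qed.

Let cvg_exp_mean (t : R) (w : T) : a^~ w @ \oo --> c ->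
  (fun n => expR (- (`|t| `^ p * a n w))) @ \oo --> expR (- (`|t| `^ p * c)).
Proof.
move=> h; apply: continuous_cvg; first exact: continuous_expR.
by apply: cvgN; apply: cvgM => //; exact: cvg_cst.
Qed.

Let law_bounded (d0 : measure_display) (T0 : measurableType d0) (Q : probability T0 R) (X : T0 -> R)
    (mX : measurable_fun setT X) (f : R -> R) (C : R) : measurable_fun setT f -> (forall x, `|f x| <= C) ->
  \int[law Q mX]_x f x = \int[Q]_w f (X w).
Proof.
move=> mf fC; apply: Rintegral_law => //.
by apply: (@bounded_integrable _ _ _ Q _ C) => [|x]; [exact: measurableT_comp|exact: fC].
Qed.

Let nu : probability R R := law P' mZ.

Let nu_cos t : \int[nu]_x cos (t * x) = expR (- (`|t| `^ p * c)).
Proof. by rewrite /nu (law_bounded P' mZ (mcosM t) (fun x => cos_max _)). Qed.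

Let nu_sin t : \int[nu]_x sin (t * x) = 0.
Proof. by rewrite /nu (law_bounded P' mZ (msinM t) (fun x => sin_max _)). Qed.

Section Weak.
Hypothesis ma : forall n, measurable_fun setT (a n).
Hypothesis a0 : forall n w, 0 <= a n w.
Hypothesis cosI : forall t n, \int[P]_w cos (t * I n w) = \int[P]_w expR (- (`|t| `^ p * a n w)).
Hypothesis sinI : forall t n, \int[P]_w sin (t * I n w) = 0.

Lemma stable_limit_weak (f : R -> R) (C : R) : continuous f -> (forall x, `|f x| <= C) ->
  (fun n => \int[P]_w f (I n w)) @ \oo --> \int[P']_w f (Z w).
Proof.
move=> cf fC; have mf : measurable_fun setT f by exact: continuous_measurable_fun.
pose nu_ n : probability R R := law P (mI n).
have cvg : cf_cvg nu_ nu.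
  split; apply: aeW => t.
    rewrite nu_cos.
    have -> : (fun n => \int[nu_ n]_x cos (t * x)) = (fun n => \int[P]_w expR (- (`|t| `^ p * a n w))).
      by apply/funext => n; rewrite /nu_ (law_bounded P (mI n) (mcosM t) (fun x => cos_max _)) cosI.
    rewrite -(Rintegral_cst1 P (expR _)).
    apply: (@bounded_cvg_Rintegral _ _ _ P _ _ 1) => //.
    - move=> n; apply: measurableT_comp => //; apply: measurableT_comp => //.
      exact: measurable_funM.
    - move=> n w; rewrite ger0_norm ?expR_ge0// -expR0 ler_expR oppr_le0.
      by rewrite mulr_ge0// powR_ge0.
    - by apply: filterS ac => w; exact: cvg_exp_mean.
  rewrite nu_sin.
  have -> : (fun n => \int[nu_ n]_x sin (t * x)) = (fun n => 0).
    by apply/funext => n; rewrite /nu_ (law_bounded P (mI n) (msinM t) (fun x => sin_max _)) sinI.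
  exact: cvg_cst.
have := cf_cvg_weak cvg cf fC; rewrite /nu (law_bounded P' mZ mf fC).
have -> : (fun n => \int[nu_ n]_x f x) = (fun n => \int[P]_w f (I n w)) => //.
by apply/funext => n; rewrite /nu_ (law_bounded P (mI n) mf fC).
Qed.

End Weak.

Section AlmostSure.
Hypothesis p1 : 1 <= p.
Hypothesis c0 : 0 < c.
Hypothesis cosI : forall t, {ae P, forall w, (fun N => (harm N : R)^-1 *
  \sum_(i < N) i.+1%:R^-1 * (cos (t * I i.+1 w) - expR (- (`|t| `^ p * a i.+1 w)))) @ \oo --> (0 : R)}.
Hypothesis sinI : forall t, {ae P, forall w, (fun N => (harm N : R)^-1 *
  \sum_(i < N) i.+1%:R^-1 * sin (t * I i.+1 w)) @ \oo --> (0 : R)}.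

Let nu_no_atom x : nu [set x] = 0%E.
Proof.
apply: cf_vanishing_no_atom => delta delta0.
(* From t >= 1 follows t <= t^p, and then t c >= 1 / delta suffices because exp u >= 1 + u. *)
exists (Num.max 1 (delta^-1 / c)) => t; rewrite ge_max => /andP[t1 tc].
rewrite nu_cos nu_sin normr0 (ltW delta0) ger0_norm ?expR_ge0//; split => //.
have t0 : 0 <= t := le_trans ler01 t1.
have tp : t <= t `^ p by rewrite -[leLHS](powRr1 t0) ler_powR.
rewrite ger0_norm// expRN -[leRHS]invrK lef_pV2 ?posrE ?expR_gt0 ?invr_gt0//.
have h : delta^-1 <= t `^ p * c.
  by rewrite (@le_trans _ _ (t * c))// ?ler_pM2r// -ler_pdivrMr.
by apply: le_trans (expR_ge1Dx _); rewrite (le_trans h)// lerDr.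
Qed.

Let mcosI (n : nat) : measurable_fun [set: T * R] (fun z => cos (z.2 * I n z.1)).
Proof.
apply: measurableT_comp => //; apply: measurable_funM => //.
by apply: measurableT_comp.
Qed.

Let msinI (n : nat) : measurable_fun [set: T * R] (fun z => sin (z.2 * I n z.1)).
Proof.
apply: measurableT_comp => //; apply: measurable_funM => //.
by apply: measurableT_comp.
Qed.

(** The random centring is replaced by its limit, [log_average_cvg] showing that the averages agree;
    then [t] and [w] are exchanged. *)
Let ae_cos : {ae P, forall w, {ae @lebesgue_measure R, forall t, (fun N => (harm N : R)^-1 *
  \sum_(i < N) i.+1%:R^-1 * cos (t * I i.+1 w) - expR (- (`|t| `^ p * c))) @ \oo --> (0 : R)}}.
Proof.
pose G N (z : T * R) := (harm N : R)^-1 * (\sum_(i < N) i.+1%:R^-1 * cos (z.2 * I i.+1 z.1)) -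
  expR (- (`|z.2| `^ p * c)).
apply: (@ae_cvg0_swap _ _ _ _ _ P (@lebesgue_measure R) G).
  move=> N; apply: measurable_funB.
    apply: measurable_funM => //; apply: measurable_sum => i.
    by apply: measurable_funM => //; exact: mcosI.
  apply: measurableT_comp => //; apply: measurableT_comp => //; apply: measurable_funM => //.
  by apply: (measurableT_comp (measurable_powR p)); apply: measurableT_comp.
move=> t; apply: filterS2 (cosI t) ac => w h1 h2.
have h3 : (fun i => expR (- (`|t| `^ p * a i.+1 w))) @ \oo --> expR (- (`|t| `^ p * c)).
  by have := cvg_exp_mean (t := t) h2; rewrite -(cvg_shiftS (fun n => expR (- (`|t| `^ p * a n w)))).
have h4 := log_average_cvg h3.
set k := expR _ in h4 *.
have -> : (fun n => G n (w, t)) = (fun N =>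
    (harm N : R)^-1 * (\sum_(i < N) i.+1%:R^-1 * (cos (t * I i.+1 w) - expR (- (`|t| `^ p * a i.+1 w)))) +
    (harm N : R)^-1 * (\sum_(i < N) i.+1%:R^-1 * expR (- (`|t| `^ p * a i.+1 w))) - k).
  apply/funext => N; rewrite /G /=; congr (_ - _); rewrite -mulrDr -big_split/=; congr (_ * _).
  by apply: eq_bigr => i _; rewrite -mulrDr subrK.
apply: cvg_sub0_of; rewrite -[k in _ --> k]add0r; exact: cvgD.
Qed.

Let ae_sin : {ae P, forall w, {ae @lebesgue_measure R, forall t, (fun N => (harm N : R)^-1 *
  \sum_(i < N) i.+1%:R^-1 * sin (t * I i.+1 w)) @ \oo --> (0 : R)}}.
Proof.
pose G N (z : T * R) := (harm N : R)^-1 * (\sum_(i < N) i.+1%:R^-1 * sin (z.2 * I i.+1 z.1)).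
apply: (@ae_cvg0_swap _ _ _ _ _ P (@lebesgue_measure R) G); last exact: sinI.
move=> N; apply: measurable_funM => //; apply: measurable_sum => i.
by apply: measurable_funM => //; exact: msinI.
Qed.

Lemma stable_limit_almost_sure (x : R) : {ae P, forall w,
  (fun N => (ln (N%:R : R))^-1 * \sum_(1 <= n < N.+1) n%:R^-1 * (I n w <= x)%R%:R) @ \oo -->
  fine (P' [set w' | Z w' <= x])}.
Proof.
apply: filterS2 ae_cos ae_sin => w hc hs.
pose nu_ N := log_empirical (fun i => I i.+1 w) N.
have F := @ae_filter_ringOfSetsType _ _ _ (@lebesgue_measure R).
have cvg : cf_cvg nu_ nu.
  split.
    apply: filterS hc => t h; rewrite nu_cos.
    have -> : (fun N => \int[nu_ N]_x cos (t * x)) =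
        (fun N => (harm N.+1 : R)^-1 * \sum_(i < N.+1) i.+1%:R^-1 * cos (t * I i.+1 w)).
      by apply/funext => N; rewrite (Rintegral_log_empirical _ _ (mcosM t) (fun x => cos_max _)).
    rewrite (cvg_shiftS (fun N => (harm N : R)^-1 * \sum_(i < N) i.+1%:R^-1 * cos (t * I i.+1 w))).
    set k := expR _ in h *.
    exact: cvg_of_sub_cvg0.
  apply: filterS hs => t h; rewrite nu_sin.
  have -> : (fun N => \int[nu_ N]_x sin (t * x)) =
      (fun N => (harm N.+1 : R)^-1 * \sum_(i < N.+1) i.+1%:R^-1 * sin (t * I i.+1 w)).
    by apply/funext => N; rewrite (Rintegral_log_empirical _ _ (msinM t) (fun x => sin_max _)).
  by rewrite (cvg_shiftS (fun N => (harm N : R)^-1 * \sum_(i < N) i.+1%:R^-1 * sin (t * I i.+1 w))).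
have := cf_cvg_cdf cvg (nu_no_atom x).
have -> : nu `]-oo, x]%classic = P' [set w' | Z w' <= x].
  by rewrite /nu lawE; congr (P' _); apply/seteqP; split => w' /=; rewrite in_itv.
have -> : (fun N => fine (nu_ N `]-oo, x]%classic)) =
    (fun N => (harm N.+1 : R)^-1 * \sum_(i < N.+1) i.+1%:R^-1 * (I i.+1 w <= x)%R%:R).
  by apply/funext => N; exact: log_empirical_cdf.
(* The measure of index [N] has [N.+1] points, hence the shift. The change of normalisation costs a
   factor [harm / ln] that tends to 1. *)
move=> h; rewrite -(cvg_shiftS (fun N => (ln (N%:R : R))^-1 * \sum_(1 <= n < N.+1) n%:R^-1 * (I n w <= x)%R%:R)).
have -> : (fun N => (ln (N.+1%:R : R))^-1 * \sum_(1 <= n < N.+2) n%:R^-1 * (I n w <= x)%R%:R) =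
    (fun N => (harm N.+1 / ln (N.+1%:R : R)) *
      ((harm N.+1 : R)^-1 * \sum_(i < N.+1) i.+1%:R^-1 * (I i.+1 w <= x)%R%:R)).
  apply/funext => N; rewrite [RHS]mulrA big_add1 big_mkord; congr (_ * _).
  by rewrite mulrAC mulfV ?mul1r// gt_eqF// harm_gt0.
by rewrite -[fine (P' _)]mul1r; apply: cvgM => //; exact: cvg_harm_div_ln.
Qed.

End AlmostSure.

End StableLimit.

(** * Continuous marginals and the limit theorem for the GARCH process *)

Lemma measurable_sublevel {R : realType} {d : measure_display} {T : measurableType d} (X : T -> R) (x : R) :
  measurable_fun setT X -> measurable [set w | X w <= x].
Proof.
move=> mX; have -> : [set w | X w <= x] = setT `&` X @^-1` `]-oo, x]%classic.
  by rewrite setTI; apply/seteqP; split => w /=; rewrite in_itv.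
by apply: mX => //; exact: measurable_itv.
Qed.

Section ContinuousCdf.
Context {R : realType} {d : measure_display} {T : measurableType d}.
Variables (P : probability T R) (X : T -> R).
Hypothesis mX : measurable_fun setT X.
Hypothesis cF : continuous (fun x : R => fine (P [set w | X w <= x])).

(** The atom at [x] is at most F x - F y for every y < x, which tends to 0 as y tends to [x]. *)
Lemma continuous_cdf_no_atom (x : R) : {ae P, forall w, X w != x}.
Proof.
have mle y : measurable [set w | X w <= y] by exact: measurable_sublevel.
have mx : measurable [set w | X w = x].
  have -> : [set w | X w = x] = setT `&` X @^-1` [set x] by rewrite setTI.
  by apply: mX => //; exact: measurable_set1.
exists [set w | X w = x]; split => //; last by move=> w /= /negP; rewrite negbK => /eqP.
have fx : P [set w | X w = x] \is a fin_num by exact: fin_num_measure.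
apply/eqP; rewrite eq_le measure_ge0 andbT -(fineK fx) lee_fin.
apply/ler_addgt0Pl => e e0; rewrite addr0.
have cFx : (fun y : R => fine (P [set w | X w <= y])) @ x --> fine (P [set w | X w <= x]) by exact: cF.
move/cvgrPdist_le : cFx => /(_ e e0)/nbhs_ballP[r /= r0 hr].
have /hr/= : ball x r (x - r / 2).
  by rewrite /ball/= opprB addrC subrK ger0_norm ?divr_ge0 ?(ltW r0)// ltr_pdivrMr// ltr_pMr// ltr1n.
set y := x - r / 2; have yx : y < x by rewrite /y ltrBlDr ltrDl divr_gt0.
apply: le_trans; apply: le_trans (ler_norm _).
rewrite lerBrDr -lee_fin EFinD !fineK ?fin_num_measure//.
rewrite -measureU//; last first.
  by apply/seteqP; split => w //= [-> ]; rewrite leNgt yx.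
apply: le_measure; rewrite ?inE//; first exact: measurableU.
by move=> w /= [-> //|/le_trans]; apply; exact: ltW.
Qed.

End ContinuousCdf.

Theorem theorem4p2 (R : realType) (d : measure_display) (Omega : measurableType d)
  (P : probability Omega R) (xi sigma X : int -> Omega -> R) (a0 a1 b1 : R)
  (Y : nat -> Omega -> R) (p r : R) :
  garch11 P xi sigma X a0 a1 b1 ->
  continuous (fun x : R => fine (P [set w | X 1 w <= x])) ->
  1 < p < 2 ->
  (forall n, measurable_fun setT (Y n)) ->
  iid P (fun i : nat => Y i.+1) ->
  (forall (n : nat) (t : R), (0 < n)%N ->
     (\int[P]_w (cos (t * Y n w))%:E = (expR (- (`|t| `^ p)))%:E)%E /\
     (\int[P]_w (sin (t * Y n w))%:E = 0)%E) ->
  indep_families P X (fun i : nat => Y i.+1) ->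
  P.-integrable setT (fun w => (X 1 w ^+ 2)%:E) ->
  let h := fun x : R => x ^+ 2 - fine (\int[P]_w (X 1 w ^+ 2)%:E)%E in
  let FX := fun x : R => fine (P [set w | X 1 w <= x]) in
  p < r ->
  measurable_fun (`[0%R, 1%R]%classic : set R) (h \o quantile FX) ->
  (\int[lebesgue_measure]_(u in `[0%R, 1%R]%classic : set R) (`|h (quantile FX u)| `^ r)%:E < +oo)%E ->
  let In := fun (n : nat) (w : Omega) =>
    (n%:R `^ p^-1)^-1 * \sum_(1 <= i < n.+1) h (X (Posz i) w) * Y i w in
  forall (d' : measure_display) (Omega' : measurableType d') (P' : probability Omega' R)
    (F : R -> set (set Omega')) (M : R -> Omega' -> R) (Z : Omega' -> R),
  stable_motion P' p F M ->
  stable_integral P' p M (h \o quantile FX) Z ->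
  (forall f : R -> R, continuous f -> (exists C : R, forall x, `|f x| <= C) ->
     (fun n => (\int[P]_w (f (In n w))%:E)%E) @ \oo --> (\int[P']_w (f (Z w))%:E)%E) /\
  (forall x : R, {ae P, forall w,
     (fun N : nat => ((ln N%:R)^-1 *
        \sum_(1 <= n < N.+1) n%:R^-1 * \1_[set v | In n v <= x] w)%:E) @ \oo -->
     P' [set w' | Z w' <= x]}).
Proof.
move=> G cF p12 mY iidY cfY indXY _ h FX pr mq ri In d' Omega' P' F M Z sM sZ.
have [p1 p2] := andP p12; have p0 : 0 < p by exact: lt_trans p1.
have mxi := garch_xi_meas G; have msigma := garch_sigma_meas G.
have XE n w : X n w = sigma n w * xi n w by exact: garch_X G n w.
have mX n : measurable_fun setT (X n).
  have -> : X n = (fun w => sigma n w * xi n w) by apply/funext.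
  exact: measurable_funM.
have mh : measurable_fun setT h.
  by apply: measurable_funB => //; exact: measurable_funX.
have mpow q : measurable_fun setT (fun x : R => `|h x| `^ q).
  by apply: (measurableT_comp (measurable_powR q)); exact: measurableT_comp.
have mhX : measurable_fun setT (fun w => `|h (X 1 w)| `^ p).
  exact: (measurableT_comp (mpow p) (mX 1)).
pose Phi w n := (xi n w, sigma n w).
have mPhi n : measurable_fun setT (fun w => Phi w n) by exact: measurable_fun_pair.
have seP : stationary_ergodic P Phi := garch_stat_erg G.
(* [X n] is the product of the two coordinates of the ergodic path at time [n], so the averages of
   |h(X_n)|^p are ergodic averages. *)
pose f (z : R * R) := `|h (z.2 * z.1)| `^ p.
have mf : measurable_fun setT f.
  apply: (measurableT_comp (mpow p)); exact: measurable_funM.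
have f0 z : 0 <= f z by exact: powR_ge0.
have fE n w : f (Phi w n) = `|h (X n w)| `^ p by rewrite /f /Phi/= -XE.
have iX : P.-integrable setT (EFin \o (fun w => `|h (X 1 w)| `^ p)).
  apply/integrableP; split; first exact/measurable_EFinP.
  have := ri; rewrite (integral_quantile (mX 1) cF (mpow r)); last by move=> x; exact: powR_ge0.
  (* |h|^p <= 1 + |h|^r, since [p < r]. *)
  move=> hr; apply: (@le_lt_trans _ _ (\int[P]_w (1 + (`|h (X 1 w)| `^ r)%:E))%E).
    apply: ge0_le_integral => //.
    - by apply: measurableT_comp => //; exact/measurable_EFinP.
    - by apply: emeasurable_funD => //; apply/measurable_EFinP; exact: (measurableT_comp (mpow r) (mX 1)).
    - move=> w _ /=; rewrite lee_fin ger0_norm ?powR_ge0//.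
      have [h1|h1] := leP `|h (X 1 w)| 1.
        apply: (@le_trans _ _ 1); last by rewrite lerDl powR_ge0.
        by apply: le_trans (ge0_ler_powR (ltW p0) _ _ h1) _; rewrite ?nnegrE ?powR1.
      apply: (@le_trans _ _ (`|h (X 1 w)| `^ r)); last by rewrite lerDr.
      by apply: ler_powR; exact: ltW.
  rewrite ge0_integralD//; last first.
    by apply/measurable_EFinP; exact: (measurableT_comp (mpow r) (mX 1)).
  by rewrite integral_cst1 lte_add_pinfty// ltry.
pose c := \int[P]_w `|h (X 1 w)| `^ p.
have cE : (\int[P]_w (`|h (X 1 w)| `^ p)%:E = c%:E)%E by rewrite /c EFin_Rintegral.
have fi : P.-integrable setT (EFin \o (fun w => f (Phi w 1))).
  by have -> : (fun w => f (Phi w 1)) = (fun w => `|h (X 1 w)| `^ p) by apply/funext => w; rewrite fE.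
have iH i : P.-integrable setT (EFin \o (fun w => `|h (X (Posz i.+1) w)| `^ p)).
  have := stationary_integrable mPhi seP mf f0 fi i.
  by have -> : (fun w => f (Phi w (Posz i.+1))) = (fun w => `|h (X (Posz i.+1) w)| `^ p) by apply/funext => w; rewrite fE.
have cH i : \int[P]_w (`|h (X (Posz i.+1) w)| `^ p) = c.
  have := stationary_Rintegral mPhi seP mf f0 i.
  by rewrite (eq_Rintegral _ (fun w _ => fE (Posz i.+1) w)) (eq_Rintegral _ (fun w _ => fE 1 w)).
have ac : {ae P, forall w, (power_mean X p h)^~ w @ \oo --> c}.
  apply: filterS (ergodic_average mPhi seP mf fi) => w.
  rewrite (eq_Rintegral _ (fun w _ => fE 1 w)) -/c.
  suff -> : (fun n => n%:R^-1 * \sum_(i < n) f (Phi w (Posz i.+1))) = (power_mean X p h)^~ w by [].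
  by apply/funext => n; rewrite /power_mean; congr (_ * _); apply: eq_bigr => i _; rewrite fE.
(* If [c = 0], the square of [X 1] is almost surely equal to its mean [m], so [X 1] sits at one of
   two points, neither of which is an atom. *)
have c0 : 0 < c.
  have cge : 0 <= c by apply: Rintegral_ge0 => w _; exact: powR_ge0.
  rewrite lt_neqAle cge andbT eq_sym; apply/eqP => c00.
  pose m := fine (\int[P]_w (X 1 w ^+ 2)%:E)%E.
  have hz : {ae P, forall w, `|h (X 1 w)| `^ p = 0}.
    have : ae_eq P setT (fun w => (`|h (X 1 w)| `^ p)%:E) (cst 0%E).
      apply/ae_eq_integral_abs => //; first exact/measurable_EFinP.
      rewrite -[RHS]/(0%:E) -c00 -cE; apply: eq_integral => w _.
      by rewrite gee0_abs// lee_fin powR_ge0.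
    by apply: filterS => w /(_ Logic.I) [].
  have : {ae P, forall w : Omega, False}.
    apply: filterS3 hz (continuous_cdf_no_atom (mX 1) cF (Num.sqrt m))
      (continuous_cdf_no_atom (mX 1) cF (- Num.sqrt m)).
    move=> w /eqP; rewrite powR_eq0 normr_eq0 => /andP[/eqP hX _] n1 n2.
    have Xm : X 1 w ^+ 2 = m by apply/eqP; rewrite -subr_eq0; apply/eqP.
    by move: n1 n2; rewrite -Xm sqrtr_sqr; case: (ler0P (X 1 w)) => _; rewrite ?opprK eqxx.
  move=> [A [mA A0 hA]].
  have : (P setT <= P A)%E by apply: le_measure; rewrite ?inE// => w _; exact: hA.
  by rewrite A0 probability_setT lee_fin ler10.
have gb : (\int[lebesgue_measure]_(u in `[0%R, 1%R]%classic) (`|(h \o quantile FX) u| `^ p)%:E = c%:E)%E.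
  by rewrite -cE (integral_quantile (mX 1) cF (mpow p))// => x; exact: powR_ge0.
have p12' : 1 <= p <= 2 by rewrite !ltW.
have cfZ := stable_integral_cf sM sZ p12' mq gb.
have mZ : measurable_fun setT Z by have [] := sZ.
(* The statement numbers [Y] from 1, the lemmas from 0. *)
pose Y' (i : nat) := Y i.+1.
have mY' i : measurable_fun setT (Y' i) by exact: mY.
have cosY n t : \int[P]_w cos (t * Y' n w) = expR (- (`|t| `^ p)).
  by rewrite /Rintegral (cfY n.+1 t isT).1.
have sinY n t : \int[P]_w sin (t * Y' n w) = 0.
  by rewrite /Rintegral (cfY n.+1 t isT).2.
have indY : mutually_indep P Y' := iidY.1.
pose I := randomized_sum X Y' p h.
have InE : In = I.
  apply/funext => n; apply/funext => w; rewrite /In /I /randomized_sum.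
  by rewrite big_add1 big_mkord.
have mI n : measurable_fun setT (I n) by exact: measurable_randomized_sum.
rewrite InE; split.
  move=> k ck [C kC]; have mk : measurable_fun setT k by exact: continuous_measurable_fun.
  have kI n : P.-integrable setT (EFin \o (k \o I n)).
    by apply: (@bounded_integrable _ _ _ P _ C) => [|w]; [exact: measurableT_comp|exact: kC].
  have kZ : P'.-integrable setT (EFin \o (k \o Z)).
    by apply: (@bounded_integrable _ _ _ P' _ C) => [|w]; [exact: measurableT_comp|exact: kC].
  rewrite -(EFin_Rintegral kZ).
  have -> : (fun n => \int[P]_w (k (I n w))%:E)%E = (fun n => (\int[P]_w k (I n w))%:E).
    by apply/funext => n; rewrite (EFin_Rintegral (kI n)).
  apply: cvg_EFin; first exact: nearW.
  apply: (@stable_limit_weak _ _ _ _ _ P P' p c I (power_mean X p h) Z) ck kC => //.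
  - by move=> t; have [] := cfZ t.
  - by move=> t; have [] := cfZ t.
  - by move=> n; exact: measurable_power_mean.
  - by move=> n w; exact: power_mean_ge0.
  - by move=> t n; exact: randomized_cos.
  - by move=> t n; exact: randomized_sin.
move=> x.
have := @stable_limit_almost_sure _ _ _ _ _ P P' p c I (power_mean X p h) Z mI mZ
  (fun t => (cfZ t).1) (fun t => (cfZ t).2) ac (ltW p1) c0
  (randomized_cos_log_average mX mY' indY indXY p12 cosY sinY mh iH cH)
  (randomized_sin_log_average mX mY' indY indXY p12 cosY sinY mh iH cH) x.
apply: filterS => w hw.
have mZx : measurable [set w' | Z w' <= x] := measurable_sublevel x mZ.
rewrite -(fineK (fin_num_measure P' _ mZx)).
apply: cvg_EFin; first exact: nearW.
have -> // : (fine \o (fun N : nat => ((ln (N%:R : R))^-1 *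
      \sum_(1 <= n < N.+1) n%:R^-1 * \1_[set v | I n v <= x] w)%:E)) =
  (fun N : nat => (ln (N%:R : R))^-1 * \sum_(1 <= n < N.+1) n%:R^-1 * (I n w <= x)%R%:R).
apply/funext => N /=; congr (_ * _); apply: eq_bigr => n _; congr (_ * _); rewrite indicE.
suff -> : (w \in [set v | I n v <= x]) = (I n w <= x) by [].
by apply/idP/idP; rewrite inE.
Qed.
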